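(* Let $\sigma=(\sigma_1,\sigma_2,\sigma_3)\in V$. (1) If $\sigma\in V^\times$, then the Lie supergroup $\widehat{\mathbf G}_\sigma$ is simple. (2) If $\sigma\in V\setminus V^\times$ with $\sigma_i=0$ and $\sigma_j\ne0\ne\sigma_k$, where $\{i,j,k\}=\{1,2,3\}$, then $\widehat A_i$ is a central Lie subsupergroup of $\widehat{\mathbf G}_\sigma$, with $\widehat A_i\cong\mathbb C\times\mathbb C^\times\times\mathbb C$, while $\widehat A_j\cong\widehat A_k\cong\mathrm{SL}(2)$. Also, there is a semidirect product splitting $$\widehat{\mathbf G}_\sigma\cong(\widehat{\mathbf G}_\sigma)_{\rm rd}\ltimes(\widehat{\mathbf G}_\sigma)_{\bar1}$$ with $(\widehat{\mathbf G}_\sigma)_{\rm rd}=\widehat A_1\times\widehat A_2\times\widehat A_3\cong(\mathbb C\times\mathbb C^\times\times\mathbb C)\times\mathrm{SL}(2)\times\mathrm{SL}(2)$, while $(\widehat{\mathbf G}_\sigma)_{\bar1}$ is the subsupergroup of $\widehat{\mathbf G}_\sigma$ generated by the $\widehat x_{\pm\theta}(\eta)$'s and the $\widehat x_{\pm\beta_\ell}(\eta)$'s (for all $\ell\in\{1,2,3\}$), which is normal Abelian, isomorphic to $\mathbb A_{\mathbb C}^{0|8}$, and such that $(\widehat{\mathbf G}_\sigma)_{\bar1}\cong(\mathbf 1\oplus\mathbf 1)\boxtimes\Box\boxtimes\Box$ as a module over $(\widehat{\mathbf G}_\sigma)_{\rm rd}\cong(\mathbb C\times\mathbb C^\times\times\mathbb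 C)\times\mathrm{SL}(2)\times\mathrm{SL}(2)$. In other words, there is a split short exact sequence of Lie supergroups $$\mathbf 1\longrightarrow(\mathbf 1\oplus\mathbf 1)\boxtimes\Box\boxtimes\Box\cong(\widehat{\mathbf G}_\sigma)_{\bar1}\longrightarrow\widehat{\mathbf G}_\sigma\longrightarrow(\widehat{\mathbf G}_\sigma)_{\rm rd}\cong(\mathbb C\times\mathbb C^\times\times\mathbb C)\times\mathrm{SL}(2)^2\longrightarrow\mathbf 1 .$$ (3) If $\sigma=\mathbf 0=(0,0,0)$, then $\widehat{\mathbf G}_\sigma$ is the Abelian Lie supergroup $\widehat{\mathbf G}_\sigma\cong(\mathbb C\times\mathbb C^\times\times\mathbb C)^3\times(\mathbf 1\oplus\mathbf 1)^{\boxtimes3}$.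
   Context: **Lie superalgebras.** $V:=\{\sigma=(\sigma_1,\sigma_2,\sigma_3)\in\mathbb C^3 : \sigma_1+\sigma_2+\sigma_3=0\}$, $V^\times:=V\cap(\mathbb C^\times)^3$. Let $\mathbb C[x]:=\mathbb C[x_1,x_2,x_3]/(x_1+x_2+x_3)$, $\Delta_{\bar0}=\{\pm2\varepsilon_i\}_{i=1,2,3}$, $\Delta_{\bar1}=\{\pm\beta_1,\pm\beta_2,\pm\beta_3,\pm\theta\}$, $\Delta=\Delta_{\bar0}\cup\Delta_{\bar1}$. $\mathfrak g(x)$ is the Lie superalgebra over $\mathbb C[x]$, free as a module with basis $\{H_{2\varepsilon_1},H_{2\varepsilon_2},H_{2\varepsilon_3}\}\cup\{X_\alpha\}_{\alpha\in\Delta}$, with $H_{2\varepsilon_i},X_{\pm2\varepsilon_i}$ even and $X_\beta$ ($\beta\in\Delta_{\bar1}$) odd; put $H_\theta:=\tfrac12(H_{2\varepsilon_1}+H_{2\varepsilon_2}+H_{2\varepsilon_3})$. Its superbracket is determined by super-antisymmetry and, for $i,j\in\{1,2,3\}$, $k\in\{1,2,3\}\setminus\{i,j\}$ (the terms with $k$ occurring only for $i\ne j$): $[H_{2\varepsilon_i},H_{2\varepsilon_j}]=0$; $[H_{2\varepsilon_i},X_{\pm2\varepsilon_j}]=\pm2\delta_{ij}x_iX_{\pm2\varepsilon_j}$; $[X_{2\varepsilon_i},X_{2\varepsilon_j}]=0=[X_{-2\varepsilon_i},X_{-2\varepsilon_j}]$; $[X_{2\varepsilon_i},X_{-2\varepsilon_j}]=\delta_{ij}x_iH_{2\varepsilon_i}$;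 $[H_{2\varepsilon_i},X_{\pm\beta_j}]=\pm(-1)^{\delta_{ij}}x_iX_{\pm\beta_j}$; $[H_{2\varepsilon_i},X_{\pm\theta}]=\pm x_iX_{\pm\theta}$; $[X_{2\varepsilon_i},X_{\beta_j}]=\delta_{ij}x_iX_\theta$; $[X_{2\varepsilon_i},X_{-\beta_j}]=(1-\delta_{ij})x_iX_{\beta_k}$; $[X_{-2\varepsilon_i},X_{\beta_j}]=(1-\delta_{ij})x_iX_{-\beta_k}$; $[X_{-2\varepsilon_i},X_{-\beta_j}]=\delta_{ij}x_iX_{-\theta}$; $[X_{2\varepsilon_i},X_\theta]=0$; $[X_{2\varepsilon_i},X_{-\theta}]=x_iX_{-\beta_i}$; $[X_{-2\varepsilon_i},X_\theta]=x_iX_{\beta_i}$; $[X_{-2\varepsilon_i},X_{-\theta}]=0$; $[X_{\beta_i},X_{\beta_j}]=(1-\delta_{ij})X_{2\varepsilon_k}$; $[X_{-\beta_i},X_{-\beta_j}]=-(1-\delta_{ij})X_{-2\varepsilon_k}$; $[X_{\beta_i},X_{-\beta_j}]=\delta_{ij}(H_{2\varepsilon_i}-H_\theta)$; $[X_{\beta_i},X_\theta]=0$; $[X_{\beta_i},X_{-\theta}]=X_{-2\varepsilon_i}$; $[X_{-\beta_i},X_\theta]=-X_{2\varepsilon_i}$; $[X_{-\beta_i},X_{-\theta}]=0$; $[X_\theta,X_\theta]=0=[X_{-\theta},X_{-\theta}]$; $[X_\theta,X_{-\theta}]=H_\theta$. Let $\tau:=x_1x_2x_3$, $\mathfrak g(x)_\tau:=\mathfrak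 g(x)_{\bar0}\oplus\tau\,\mathfrak g(x)_{\bar1}$, and for $\sigma\in V$ let $I_\sigma=(x_1-\sigma_1,x_2-\sigma_2,x_3-\sigma_3)\subset\mathbb C[x]$ and $\widehat{\mathfrak g}(\sigma):=\mathfrak g(x)_\tau/I_\sigma\,\mathfrak g(x)_\tau$, a complex Lie superalgebra with $\mathbb C$-basis the classes of $H_{2\varepsilon_i}$, $X_{\pm2\varepsilon_i}$ (denoted by the same symbols) and $\widehat X_\beta:=\tau X_\beta$ ($\beta\in\Delta_{\bar1}$). **Lie supergroups.** A Weil superalgebra is a finite-dimensional supercommutative complex superalgebra $A=A_{\bar0}\oplus A_{\bar1}=\mathbb C\oplus\mathfrak N(A)$ with $\mathfrak N(A)$ a $\mathbb Z_2$-graded nilpotent ideal. Complex (holomorphic) Lie supergroups are identified with their group-valued functors $A\mapsto\mathbf G(A)$ on Weil superalgebras; an ordinary Lie group $G$ is viewed as a supergroup via $A\mapsto G(A):=G(A_{\bar0})$. A super Harish-Chandra pair $(G,\mathfrak g)$ is a complex Lie group $G$ and a complex Lie superalgebra $\mathfrak g$ with $\mathfrak g_{\bar0}=\mathrm{Lie}(G)$, with a holomorphic action $\mathrm{Ad}$ of $G$ on $\mathfrak g$ by Lie superalgebra automorphisms, which restricts to the adjoint action on $\mathfrak g_{\bar0}$ and whose differential is the adjoint action of $\mathfrak g_{\bar0}$ on $\mathfrak g$. The Lie supergroup $\mathbf G_{\mathcal P}$ associated with $\mathcal P=(G,\mathfrak g)$ is, given a basis $(Y_i)_{i\in I}$ of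 $\mathfrak g_{\bar1}$, the functor for which $\mathbf G_{\mathcal P}(A)$ is generated by $G(A)$ and symbols $(1+\eta Y_i)$, $i\in I$, $\eta\in A_{\bar1}$, with relations: those of $G(A)$; $(1+\eta Y_i)\,g=g\,(1+c_{j_1}\eta Y_{j_1})\cdots(1+c_{j_k}\eta Y_{j_k})$ if $\mathrm{Ad}(g^{-1})(Y_i)=c_{j_1}Y_{j_1}+\dots+c_{j_k}Y_{j_k}$; $(1+\eta'Y_i)(1+\eta''Y_i)=\exp(\eta''\eta'\,\tfrac12[Y_i,Y_i])\,(1+(\eta'+\eta'')Y_i)$; $(1+\eta_iY_i)(1+\eta_jY_j)=\exp(\eta_j\eta_i[Y_i,Y_j])\,(1+\eta_jY_j)(1+\eta_iY_i)$. Its underlying Lie group is $(\mathbf G_{\mathcal P})_{\rm rd}=G$ and its tangent Lie superalgebra is $\mathfrak g$. A Lie supergroup is simple if it has no non-trivial normal closed connected Lie subsupergroup. **The supergroup $\widehat{\mathbf G}_\sigma$.** Put $\widehat{\mathfrak a}_i:=\mathbb CX_{2\varepsilon_i}\oplus\mathbb CH_{2\varepsilon_i}\oplus\mathbb CX_{-2\varepsilon_i}$, so $\widehat{\mathfrak g}(\sigma)_{\bar0}=\widehat{\mathfrak a}_1\oplus\widehat{\mathfrak a}_2\oplus\widehat{\mathfrak a}_3$. If $\sigma_i\ne0$ let $\widehat A_i:=\mathrm{SL}_2$, with Lie algebra $\widehat{\mathfrak a}_i$ via $X_{2\varepsilon_i}\mapsto\sigma_ie$, $H_{2\varepsilon_i}\mapsto\sigma_ih$,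 $X_{-2\varepsilon_i}\mapsto\sigma_if$; if $\sigma_i=0$ let $\widehat A_i:=\mathbb C\times\mathbb C^\times\times\mathbb C$, with Abelian Lie algebra $\widehat{\mathfrak a}_i$ (factors corresponding to $X_{2\varepsilon_i},H_{2\varepsilon_i},X_{-2\varepsilon_i}$). Let $\widehat G:=\widehat A_1\times\widehat A_2\times\widehat A_3$, acting on $\widehat{\mathfrak g}(\sigma)$ by integrating the adjoint action of $\widehat{\mathfrak g}(\sigma)_{\bar0}$. $\widehat{\mathbf G}_\sigma$ is the Lie supergroup associated with $(\widehat G,\widehat{\mathfrak g}(\sigma))$, using the basis $\{\widehat X_\beta\}_{\beta\in\Delta_{\bar1}}$; put $\widehat x_\beta(\eta):=(1+\eta\widehat X_\beta)$ for $\beta\in\Delta_{\bar1}$, $\eta\in A_{\bar1}$. $\Box$ is the tautological 2-dimensional module of $\mathrm{SL}(2)$, $\mathbf 1$ the trivial one-dimensional representation, $\boxtimes$ the outer tensor product; a module $M$ is viewed as the purely odd Abelian supergroup $A\mapsto A_{\bar1}\otimes M$. $\mathbb A_{\mathbb C}^{0|8}$ is the totally odd complex affine Abelian supergroup of superdimension $0|8$, $A\mapsto A_{\bar1}^8$. *)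

(* Defs.v *)
From HB Require Import structures.
From mathcomp Require Import all_boot all_order all_algebra all_field.
From mathcomp Require Import complex generic_quotient.
From mathcomp Require Import boolp classical_sets reals topology normedtype.
From mathcomp Require Import derive ring.

Set Implicit Arguments.
Unset Strict Implicit.
Unset Printing Implicit Defensive.

Import Order.TTheory GRing.Theory Num.Theory.
Import numFieldNormedType.Exports.
Local Open Scope quotient_scope.
Local Open Scope ring_scope.

(* Typed as a numClosedFieldType so that the normed topology is found. *)
Definition CC (R : realType) : numClosedFieldType := (R[i])%C.

Record weil (R : realType) := Weil {
  walg :> falgType (CC R);
  w0 : {vspace walg};
  w1 : {vspace walg};
  wN : {vspace walg};
  w01_full : (w0 + w1)%VS = fullv;
  w01_dir : (w0 :&: w1)%VS = 0%VS;
  w0_1 : 1 \in w0;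
  w00 : {in w0 & w0, forall a b, a * b \in w0};
  w01 : {in w0 & w1, forall a b, a * b \in w1};
  w11 : {in w1 & w1, forall a b, a * b \in w0};
  w0C : {in w0, forall a b, a * b = b * a};
  w1C : {in w1 & w1, forall a b, a * b = - (b * a)};
  wN_full : (<[1]> + wN)%VS = fullv;
  wN_dir : (<[1]> :&: wN)%VS = 0%VS;
  wN_ideal : forall a b, b \in wN -> a * b \in wN /\ b * a \in wN;
  wN_graded : wN = (wN :&: w0 + wN :&: w1)%VS;
  wN_nil : exists n : nat, (wN ^+ n)%VS = 0%VS }.

Record weil_hom (R : realType) (A B : weil R) := WeilHom {
  whom :> {lrmorphism A -> B};
  whom0 : forall a, a \in w0 A -> whom a \in w0 B;
  whom1 : forall a, a \in w1 A -> whom a \in w1 B }.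

Section EvenOdd.
Variables (R : realType) (A : weil R).

Definition even_of : Type := subvs_of (w0 A).
Definition odd_of : Type := subvs_of (w1 A).
HB.instance Definition _ := Vector.copy even_of (subvs_of (w0 A)).
HB.instance Definition _ := Vector.copy odd_of (subvs_of (w1 A)).

Definition e2a (a : even_of) : A := vsval a.
Definition o2a (a : odd_of) : A := vsval a.

(* vsproj U is the identity on U, so the products below are those of A. *)
Definition even1 : even_of := vsproj (w0 A) 1.
Definition emul (a b : even_of) : even_of := vsproj (w0 A) (e2a a * e2a b).
Definition eact (a : even_of) (x : odd_of) : odd_of := vsproj (w1 A) (e2a a * o2a x).
Definition omul (x y : odd_of) : even_of := vsproj (w0 A) (o2a x * o2a y).

Lemma e2a_inj : injective e2a.
Proof. exact: subvs_inj. Qed.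

Lemma e2a_in a : e2a a \in w0 A.
Proof. exact: subvsP. Qed.

Lemma o2a_in a : o2a a \in w1 A.
Proof. exact: subvsP. Qed.

Lemma e2a1 : e2a even1 = 1.
Proof. by rewrite /e2a vsprojK // w0_1. Qed.

Lemma e2aM a b : e2a (emul a b) = e2a a * e2a b.
Proof. by rewrite /e2a vsprojK // w00 // e2a_in. Qed.

Lemma o2a_act a x : o2a (eact a x) = e2a a * o2a x.
Proof. by rewrite /o2a vsprojK // w01 ?e2a_in ?o2a_in. Qed.

Lemma e2a_omul x y : e2a (omul x y) = o2a x * o2a y.
Proof. by rewrite /e2a vsprojK // w11 ?o2a_in. Qed.

Lemma e2aD a b : e2a (a + b) = e2a a + e2a b.
Proof. exact: raddfD. Qed.

Fact emulA : associative emul.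
Proof. by move=> a b c; apply: e2a_inj; rewrite !e2aM mulrA. Qed.

Fact emulC : commutative emul.
Proof. by move=> a b; apply: e2a_inj; rewrite !e2aM w0C ?e2a_in. Qed.

Fact emul1 : left_id even1 emul.
Proof. by move=> a; apply: e2a_inj; rewrite e2aM e2a1 mul1r. Qed.

Fact emulDl : left_distributive emul +%R.
Proof. by move=> a b c; apply: e2a_inj; rewrite !(e2aM, e2aD) mulrDl. Qed.

Fact even1_neq0 : even1 != 0.
Proof.
by apply/eqP => /(congr1 e2a); rewrite e2a1 /e2a raddf0; apply/eqP/oner_neq0.
Qed.

HB.instance Definition _ := GRing.Zmodule_isComNzRing.Build even_of
  emulA emulC emul1 emulDl even1_neq0.

Fact escaleAl (c : CC R) (a b : even_of) : c *: (a * b) = (c *: a) * b.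
Proof.
apply: e2a_inj; rewrite e2aM /e2a !linearZ /=.
by rewrite -[vsval (a * b)]/(e2a (a * b)) e2aM -scalerAl.
Qed.
HB.instance Definition _ :=
  GRing.LSemiModule_isLSemiAlgebra.Build (CC R) even_of escaleAl.
HB.instance Definition _ := GRing.Lalgebra_isComAlgebra.Build (CC R) even_of.

End EvenOdd.

Section WeilMaps.
Variables (R : realType) (A B : weil R) (f : weil_hom A B).

Definition emap (a : even_of A) : even_of B := vsproj (w0 B) (f (e2a a)).
Definition omap (x : odd_of A) : odd_of B := vsproj (w1 B) (f (o2a x)).

Lemma e2a_map a : e2a (emap a) = f (e2a a).
Proof. by rewrite /e2a vsprojK // whom0 // e2a_in. Qed.

Lemma o2a_map x : o2a (omap x) = f (o2a x).
Proof. by rewrite /o2a vsprojK // whom1 // o2a_in. Qed.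

Fact emap_additive : additive emap.
Proof.
by move=> a b; apply: e2a_inj; rewrite /e2a raddfB /= -!/(e2a _) !e2a_map /e2a !raddfB.
Qed.

Fact emap_multiplicative : monoid_morphism emap.
Proof.
split=> [|a b]; apply: e2a_inj; rewrite ?e2a_map.
  by rewrite -[1]/(even1 _) !e2a1 rmorph1.
by rewrite -[a * b]/(emul _ _) -[emap a * _]/(emul _ _) !e2aM !e2a_map rmorphM.
Qed.

Fact emap_scalable : scalable emap.
Proof.
by move=> c a; apply: e2a_inj; rewrite e2a_map /e2a !linearZ /= -!/(e2a _) e2a_map.
Qed.

Fact omap_additive : additive omap.
Proof.
by move=> x y; apply: subvs_inj; rewrite raddfB /= -!/(o2a _) !o2a_map /o2a !raddfB.
Qed.

HB.instance Definition _ :=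
  GRing.isZmodMorphism.Build (even_of A) (even_of B) emap emap_additive.
HB.instance Definition _ :=
  GRing.isMonoidMorphism.Build (even_of A) (even_of B) emap emap_multiplicative.
HB.instance Definition _ :=
  GRing.isScalable.Build (CC R) (even_of A) (even_of B) *:%R emap emap_scalable.
HB.instance Definition _ :=
  GRing.isZmodMorphism.Build (odd_of A) (odd_of B) omap omap_additive.

Lemma emap_omul x y : emap (omul x y) = omul (omap x) (omap y).
Proof. by apply: e2a_inj; rewrite e2a_map !e2a_omul rmorphM !o2a_map. Qed.

Lemma omap_act a x : omap (eact a x) = eact (emap a) (omap x).
Proof.
by apply: subvs_inj; rewrite -!/(o2a _) o2a_map !o2a_act rmorphM e2a_map o2a_map.
Qed.

End WeilMaps.

Section WeilBase.
Variable R : realType.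

Fact weilC_nil : ((0 : {vspace (CC R)^o}) ^+ 1)%VS = 0%VS.
Proof. by rewrite expv1. Qed.

Definition weilC : weil R.
refine (@Weil R (CC R)^o fullv 0%VS 0%VS _ _ _ _ _ _ _ _ _ _ _ _ _).
- by rewrite addv0.
- by rewrite capv0.
- exact: memvf.
- by move=> a b _ _; exact: memvf.
- by move=> a b _; rewrite memv0 => /eqP ->; rewrite mulr0 mem0v.
- by move=> a b _ _; exact: memvf.
- by move=> a _ b; rewrite mulrC.
- by move=> a b; rewrite !memv0 => /eqP -> /eqP ->; rewrite mulr0 oppr0.
- rewrite addv0; apply/eqP; rewrite eqEsubv subvf /=.
  apply/subvP => c _; apply/vlineP; exists c.
  by rewrite /GRing.scale /= mulr1.
- by rewrite capv0.
- by move=> a b; rewrite memv0 => /eqP ->; rewrite mulr0 mul0r mem0v.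
- by rewrite !cap0v addv0.
- by exists 1%N; exact: weilC_nil.
Defined.

Variable A : weil R.
Definition scal_fun (c : weilC) : A := (c : CC R) *: 1.
Fact scal_additive : additive scal_fun.
Proof. by move=> a b; rewrite /scal_fun scalerBl. Qed.
Fact scal_multiplicative : monoid_morphism scal_fun.
Proof.
split=> [|a b]; rewrite /scal_fun ?scale1r //.
by rewrite -scalerAl -scalerAr mulr1 scalerA.
Qed.
Fact scal_scalable : scalable scal_fun.
Proof. by move=> a b; rewrite /scal_fun scalerA. Qed.
HB.instance Definition _ :=
  GRing.isZmodMorphism.Build weilC A scal_fun scal_additive.
HB.instance Definition _ :=
  GRing.isMonoidMorphism.Build weilC A scal_fun scal_multiplicative.
HB.instance Definition _ :=
  GRing.isScalable.Build (CC R) weilC A *:%R scal_fun scal_scalable.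

Definition scal_hom : weil_hom weilC A.
refine (@WeilHom R weilC A scal_fun _ _).
- by move=> a _; rewrite /= /scal_fun memvZ // w0_1.
- by move=> a; rewrite memv0 => /eqP ->; rewrite /= raddf0 mem0v.
Defined.

End WeilBase.
Arguments weilC {R}.

(* The holomorphic structure is recorded by coordinates: every supergroup     *)
(* below is a closed subsupermanifold of an affine superspace C^(m|n), and    *)
(* sg_coord x p says that the point x in G(A) has coordinates p in            *)
(* A_0^m x A_1^n, even and odd coordinates being indexed together by sg_ix.   *)
Record supergroup (R : realType) := Supergroup {
  sg_pt :> weil R -> groupType;
  sg_map : forall A B : weil R, weil_hom A B -> sg_pt A -> sg_pt B;
  sg_mapM : forall A B (f : weil_hom A B),
    {morph sg_map f : x y / (x * y)%g >-> (x * y)%g};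
  sg_map_id : forall A (f : weil_hom A A), f =1 id -> sg_map f =1 id;
  sg_map_comp : forall (A B D : weil R) (f : weil_hom A B) (g : weil_hom B D)
    (h : weil_hom A D), h =1 g \o f -> sg_map h =1 sg_map g \o sg_map f;
  sg_ix : finType;
  sg_coord : forall A : weil R, sg_pt A -> {ffun sg_ix -> A} -> Prop;
  sg_coord_map : forall (A B : weil R) (f : weil_hom A B) x p,
    sg_coord x p -> sg_coord (sg_map f x) [ffun i => f (p i)] }.

Section Holomorphic.
Variables (R : realType) (A : weil R).

(* A norm on the finite-dimensional space A; the choice of basis is immaterial *)
Definition wnorm (a : A) : CC R := \sum_i `|coord (vbasis fullv) i a|.
Definition pnorm (I : finType) (p : {ffun I -> A}) : CC R := \sum_i wnorm (p i).

Definition A0_linear (I J : finType) (L : {ffun I -> A} -> {ffun J -> A}) :=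
  (forall u v, L (u + v) = L u + L v) /\
  (forall (a : A) (u : {ffun I -> A}), a \in w0 A ->
     L [ffun i => a * u i] = [ffun j => a * L u j]).

(* A map between sets of A-points is A_0-holomorphic if, in coordinates, it   *)
(* is everywhere complex differentiable with an A_0-linear differential; the  *)
(* morphisms of supermanifolds are the natural families of such maps.         *)
Definition holo (X Y : Type) (I J : finType)
    (cX : X -> {ffun I -> A} -> Prop) (cY : Y -> {ffun J -> A} -> Prop)
    (f : X -> Y) :=
  forall x p, cX x p -> exists2 q, cY (f x) q &
  exists2 L, A0_linear L &
  forall e : CC R, 0 < e -> exists2 d : CC R, 0 < d &
  forall x' p', cX x' p' -> pnorm (p' - p) < d ->
  exists2 q', cY (f x') q' &
    pnorm (q' - q - L (p' - p)) <= e * pnorm (p' - p).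

End Holomorphic.

Record lie_hom (R : realType) (G H : supergroup R) := LieHom {
  lh_fun :> forall A, G A -> H A;
  lhM : forall A, {morph @lh_fun A : x y / (x * y)%g >-> (x * y)%g};
  lh_nat : forall A B (f : weil_hom A B) x,
    @lh_fun B (sg_map f x) = sg_map f (@lh_fun A x);
  lh_holo : forall A, holo (@sg_coord R G A) (@sg_coord R H A) (@lh_fun A) }.
Arguments lh_fun {R G H} l A x.

Definition lie_isom (R : realType) (G H : supergroup R) (f : lie_hom G H) :=
  exists g : lie_hom H G, forall A, cancel (f A) (g A) /\ cancel (g A) (f A).

Definition isomorphic (R : realType) (G H : supergroup R) :=
  exists f : lie_hom G H, lie_isom f.

Record subsg (R : realType) (G : supergroup R) := SubSG {
  ss_set :> forall A, set (G A);
  ss1 : forall A, @ss_set A 1%g;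
  ssM : forall A x y, @ss_set A x -> @ss_set A y -> @ss_set A (x * y)%g;
  ssV : forall A x, @ss_set A x -> @ss_set A (x^-1)%g;
  ss_map : forall A B (f : weil_hom A B) x,
    @ss_set A x -> @ss_set B (sg_map f x) }.
Arguments ss_set {R G} s A x.

Definition generated (G : groupType) (X : set G) : set G :=
  fun x => forall S : set G, S 1%g -> (forall y z, S y -> S z -> S (y * z)%g) ->
    (forall y, S y -> S (y^-1)%g) -> (forall y, X y -> S y) -> S x.

Definition abelian_sg (R : realType) (G : supergroup R) :=
  forall A (x y : G A), (x * y = y * x)%g.

Section SubSG.
Variables (R : realType) (G : supergroup R).

Definition normal (S : forall A, set (G A)) :=
  forall A (g x : G A), S A x -> S A (g * x * g^-1)%g.
Definition central (S : forall A, set (G A)) :=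
  forall A (g x : G A), S A x -> (g * x = x * g)%g.

Variable S : subsg G.

Section Points.
Variable A : weil R.
Definition sub_pt : Type := {x : G A | `[< ss_set S A x >]}.
HB.instance Definition _ := Choice.copy sub_pt {x : G A | `[< ss_set S A x >]}.
Definition sub_one : sub_pt := Sub (1%g : G A) (asboolT (ss1 S A)).
Definition sub_mul (x y : sub_pt) : sub_pt :=
  Sub (val x * val y)%g (asboolT (ssM (asboolW (valP x)) (asboolW (valP y)))).
Definition sub_inv (x : sub_pt) : sub_pt :=
  Sub ((val x)^-1)%g (asboolT (ssV (asboolW (valP x)))).
Fact sub_mulA : associative sub_mul.
Proof. by move=> x y z; apply: val_inj; rewrite /= mulgA. Qed.
Fact sub_mul1 : left_id sub_one sub_mul.
Proof. by move=> x; apply: val_inj; rewrite /= mul1g. Qed.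
Fact sub_mulr1 : right_id sub_one sub_mul.
Proof. by move=> x; apply: val_inj; rewrite /= mulg1. Qed.
Fact sub_mulV : left_inverse sub_one sub_inv sub_mul.
Proof. by move=> x; apply: val_inj; rewrite /= mulVg. Qed.
Fact sub_mulrV : right_inverse sub_one sub_inv sub_mul.
Proof. by move=> x; apply: val_inj; rewrite /= mulgV. Qed.
HB.instance Definition _ := isGroup.Build sub_pt
  sub_mulA sub_mul1 sub_mulr1 sub_mulV sub_mulrV.
End Points.

Definition sub_map A B (f : weil_hom A B) (x : sub_pt A) : sub_pt B :=
  Sub (sg_map f (val x)) (asboolT (ss_map f (asboolW (valP x)))).

Definition sg_sub : supergroup R.
refine (@Supergroup R (fun A => sub_pt A) sub_map _ _ _ (sg_ix G)
  (fun A x p => sg_coord (val x) p) _).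
- by move=> A B f x y; apply: val_inj; rewrite /= sg_mapM.
- by move=> A f fid x; apply: val_inj; rewrite /= sg_map_id.
- by move=> A B D f g h hgf x; apply: val_inj; rewrite /= (sg_map_comp hgf).
- by move=> A B f x p; exact: sg_coord_map.
Defined.

End SubSG.

Section GeneratedSub.
Variables (R : realType) (G : supergroup R).

Lemma sg_map1 (H : supergroup R) A B (f : weil_hom A B) :
  sg_map f (1%g : H A) = 1%g.
Proof. by apply: (mulgI (sg_map f 1%g)); rewrite -sg_mapM !mulg1. Qed.

Lemma sg_mapV (H : supergroup R) A B (f : weil_hom A B) (x : H A) :
  sg_map f (x^-1)%g = ((sg_map f x)^-1)%g.
Proof. by apply: (mulgI (sg_map f x)); rewrite -sg_mapM !mulgV sg_map1. Qed.

Definition gen_sub (X : forall A, set (G A))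
  (Xmap : forall A B (f : weil_hom A B) x, X A x -> X B (sg_map f x)) : subsg G.
refine (@SubSG R G (fun A => generated (X A)) _ _ _ _).
- by move=> A S.
- move=> A x y Sx Sy S S1 SM SV SX.
  exact: (SM _ _ (Sx S S1 SM SV SX) (Sy S S1 SM SV SX)).
- by move=> A x Sx S S1 SM SV SX; exact: (SV _ (Sx S S1 SM SV SX)).
- move=> A B f x Sx S S1 SM SV SX.
  apply: (Sx (fun y => S (sg_map f y))) => [|y z|y|y Xy].
  + by rewrite sg_map1.
  + by rewrite sg_mapM; apply: SM.
  + by rewrite sg_mapV; apply: SV.
  + by apply: SX; apply: Xmap.
Defined.

End GeneratedSub.

Section Product.
Variables (R : realType) (G H : supergroup R).

Definition sg_prod : supergroup R.
refine (@Supergroup R (fun A => (G A * H A)%type)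
  (fun A B f x => (sg_map f x.1, sg_map f x.2)) _ _ _ (sg_ix G + sg_ix H)%type
  (fun A x p => sg_coord x.1 [ffun i => p (inl i)] /\
                sg_coord x.2 [ffun i => p (inr i)]) _).
- by move=> A B f x y; rewrite !sg_mapM.
- by move=> A f fid [x y] /=; rewrite !(sg_map_id fid).
- by move=> A B D f g h hgf [x y]; rewrite /= !(sg_map_comp hgf).
- move=> A B f x p [/(sg_coord_map f) cx /(sg_coord_map f) cy]; split.
  + by move: cx; congr sg_coord; apply/ffunP => i; rewrite !ffunE.
  + by move: cy; congr sg_coord; apply/ffunP => i; rewrite !ffunE.
Defined.

End Product.

Section BigProduct.
Variables (R : realType) (I : finType) (F : I -> supergroup R).

Section Points.
Variable A : weil R.
Definition big_pt : Type := {dffun forall i : I, F i A}.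
HB.instance Definition _ := Choice.copy big_pt {dffun forall i : I, F i A}.
Definition big_one : big_pt := [ffun i => 1%g].
Definition big_mul (x y : big_pt) : big_pt := [ffun i => (x i * y i)%g].
Definition big_inv (x : big_pt) : big_pt := [ffun i => ((x i)^-1)%g].
Fact big_mulA : associative big_mul.
Proof. by move=> x y z; apply/ffunP => i; rewrite !ffunE mulgA. Qed.
Fact big_mul1 : left_id big_one big_mul.
Proof. by move=> x; apply/ffunP => i; rewrite !ffunE mul1g. Qed.
Fact big_mulr1 : right_id big_one big_mul.
Proof. by move=> x; apply/ffunP => i; rewrite !ffunE mulg1. Qed.
Fact big_mulV : left_inverse big_one big_inv big_mul.
Proof. by move=> x; apply/ffunP => i; rewrite !ffunE mulVg. Qed.
Fact big_mulrV : right_inverse big_one big_inv big_mul.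
Proof. by move=> x; apply/ffunP => i; rewrite !ffunE mulgV. Qed.
HB.instance Definition _ := isGroup.Build big_pt
  big_mulA big_mul1 big_mulr1 big_mulV big_mulrV.
End Points.

Definition big_map A B (f : weil_hom A B) (x : big_pt A) : big_pt B :=
  [ffun i => sg_map f (x i)].

Definition sg_bigprod : supergroup R.
refine (@Supergroup R (fun A => big_pt A) big_map _ _ _
  {i : I & sg_ix (F i)}
  (fun A x p => forall i, sg_coord (x i) 
    [ffun c => p (Tagged (fun i => sg_ix (F i) : Type) c)]) _).
- by move=> A B f x y; apply/ffunP => i; rewrite !ffunE sg_mapM.
- by move=> A f fid x; apply/ffunP => i; rewrite !ffunE (sg_map_id fid).
- by move=> A B D f g h hgf x; apply/ffunP => i; rewrite !ffunE (sg_map_comp hgf).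
- move=> A B f x p cx i; have := sg_coord_map f (cx i).
  by rewrite /big_map ffunE; congr sg_coord; apply/ffunP => c; rewrite !ffunE.
Defined.

End BigProduct.

(* The additive group of V, written multiplicatively *)
Section AddGroup.
Variable V : zmodType.
Definition addg : Type := V.
HB.instance Definition _ := Choice.copy addg V.
HB.instance Definition _ := isGroup.Build addg (@addrA V) (@add0r V) (@addr0 V)
  (@addNr V) (@addrN V).
End AddGroup.

(* The multiplicative group of K, as the set of pairs (u, u^-1) *)
Section UnitGroup.
Variable K : comNzRingType.
Definition unitg : Type := {u : K * K | u.1 * u.2 == 1}.
HB.instance Definition _ := Choice.copy unitg {u : K * K | u.1 * u.2 == 1}.
Fact unitg_one_subproof : (1 : K, 1 : K).1 * (1 : K, 1 : K).2 == 1.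
Proof. by rewrite mulr1. Qed.
Fact unitg_mul_subproof (x y : unitg) :
  ((val x).1 * (val y).1, (val x).2 * (val y).2).1 *
  ((val x).1 * (val y).1, (val x).2 * (val y).2).2 == 1.
Proof. by rewrite /= mulrACA (eqP (valP x)) (eqP (valP y)) mulr1. Qed.
Fact unitg_inv_subproof (x : unitg) :
  ((val x).2, (val x).1).1 * ((val x).2, (val x).1).2 == 1.
Proof. by rewrite /= mulrC (valP x). Qed.
Definition unitg_one : unitg := Sub (1 : K, 1 : K) unitg_one_subproof.
Definition unitg_mul (x y : unitg) : unitg :=
  Sub ((val x).1 * (val y).1, (val x).2 * (val y).2) (unitg_mul_subproof x y).
Definition unitg_inv (x : unitg) : unitg :=
  Sub ((val x).2, (val x).1) (unitg_inv_subproof x).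
Fact unitg_mulA : associative unitg_mul.
Proof. by move=> x y z; apply: val_inj; rewrite /= !mulrA. Qed.
Fact unitg_mulC : commutative unitg_mul.
Proof.
by move=> x y; apply: val_inj; rewrite /= mulrC [X in (_, X)]mulrC.
Qed.
Fact unitg_mul1 : left_id unitg_one unitg_mul.
Proof. by move=> x; apply: val_inj; rewrite /= !mul1r -surjective_pairing. Qed.
Fact unitg_mulr1 : right_id unitg_one unitg_mul.
Proof. by move=> x; rewrite unitg_mulC unitg_mul1. Qed.
Fact unitg_mulV : left_inverse unitg_one unitg_inv unitg_mul.
Proof.
move=> x; apply: val_inj => /=.
by rewrite [_.2 * _.1]mulrC (eqP (valP x)).
Qed.
Fact unitg_mulrV : right_inverse unitg_one unitg_inv unitg_mul.
Proof. by move=> x; rewrite unitg_mulC unitg_mulV. Qed.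
HB.instance Definition _ := isGroup.Build unitg
  unitg_mulA unitg_mul1 unitg_mulr1 unitg_mulV unitg_mulrV.
End UnitGroup.

Section SL2Group.
Variable K : comNzRingType.
Definition sl2g : Type := {M : 'M[K]_2 | \det M == 1}.
HB.instance Definition _ := Choice.copy sl2g {M : 'M[K]_2 | \det M == 1}.
Fact sl2_one_subproof : \det (1%:M : 'M[K]_2) == 1.
Proof. by rewrite det1. Qed.
Fact sl2_mul_subproof (x y : sl2g) : \det (val x *m val y) == 1.
Proof. by rewrite det_mulmx (eqP (valP x)) (eqP (valP y)) mulr1. Qed.
Fact sl2_inv_subproof (x : sl2g) : \det (\adj (val x)) == 1.
Proof.
have := congr1 determinant (mul_mx_adj (val x)).
by rewrite (eqP (valP x)) det_mulmx det1 (eqP (valP x)) mul1r => ->.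
Qed.
Definition sl2_one : sl2g := Sub (1%:M : 'M[K]_2) sl2_one_subproof.
Definition sl2_mul (x y : sl2g) : sl2g := Sub (val x *m val y) (sl2_mul_subproof x y).
Definition sl2_inv (x : sl2g) : sl2g := Sub (\adj (val x)) (sl2_inv_subproof x).
Fact sl2_mulA : associative sl2_mul.
Proof. by move=> x y z; apply: val_inj; rewrite /= mulmxA. Qed.
Fact sl2_mul1 : left_id sl2_one sl2_mul.
Proof. by move=> x; apply: val_inj; rewrite /= mul1mx. Qed.
Fact sl2_mulr1 : right_id sl2_one sl2_mul.
Proof. by move=> x; apply: val_inj; rewrite /= mulmx1. Qed.
Fact sl2_mulV : left_inverse sl2_one sl2_inv sl2_mul.
Proof. by move=> x; apply: val_inj; rewrite /= mul_adj_mx (eqP (valP x)). Qed.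
Fact sl2_mulrV : right_inverse sl2_one sl2_inv sl2_mul.
Proof. by move=> x; apply: val_inj; rewrite /= mul_mx_adj (eqP (valP x)). Qed.
HB.instance Definition _ := isGroup.Build sl2g
  sl2_mulA sl2_mul1 sl2_mulr1 sl2_mulV sl2_mulrV.
End SL2Group.

Section BasicGroups.
Variable R : realType.

Definition Ga : supergroup R.
refine (@Supergroup R (fun A => addg (even_of A)) (@emap R) _ _ _
  unit (fun A x p => p tt = e2a x) _).
- by move=> A B f x y; rewrite -[(x * y)%g]/((x : even_of A) + y) raddfD.
- by move=> A f fid x; apply: e2a_inj; rewrite e2a_map fid.
- by move=> A B D f g h hgf x; apply: e2a_inj; rewrite /= !e2a_map hgf.
- by move=> A B f x p px; rewrite ffunE px e2a_map.
Defined.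

Fact Gm_map_subproof (A B : weil R) (f : weil_hom A B) (x : unitg (even_of A)) :
  let u := (emap f (val x).1, emap f (val x).2) in u.1 * u.2 == 1.
Proof. by rewrite /= -rmorphM (eqP (valP x)) rmorph1. Qed.

Definition Gm : supergroup R.
refine (@Supergroup R (fun A => unitg (even_of A))
  (fun A B f x => Sub (emap f (val x).1, emap f (val x).2) (Gm_map_subproof f x))
  _ _ _ bool
  (fun A x p => p true = e2a (val x).1 /\ p false = e2a (val x).2) _).
- by move=> A B f x y; apply: val_inj; rewrite /= !rmorphM.
- move=> A f fid x; apply: val_inj => /=; rewrite [RHS]surjective_pairing.
  by congr pair; apply: e2a_inj; rewrite e2a_map fid.
- move=> A B D f g h hgf x; apply: val_inj => /=.
  by congr pair; apply: e2a_inj; rewrite !e2a_map hgf.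
- by move=> A B f x p [p1 p2]; rewrite !ffunE p1 p2 /= !e2a_map.
Defined.

Fact SL2_map_subproof (A B : weil R) (f : weil_hom A B) (x : sl2g (even_of A)) :
  \det (map_mx (emap f) (val x)) == 1.
Proof. by rewrite det_map_mx (eqP (valP x)) rmorph1. Qed.

Definition SL2 : supergroup R.
refine (@Supergroup R (fun A => sl2g (even_of A))
  (fun A B f x => Sub (map_mx (emap f) (val x)) (SL2_map_subproof f x))
  _ _ _ ('I_2 * 'I_2)%type
  (fun A x p => forall i j, p (i, j) = e2a (val x i j)) _).
- by move=> A B f x y; apply: val_inj; rewrite /= map_mxM.
- move=> A f fid x; apply: val_inj; apply/matrixP => i j; rewrite /= mxE.
  by apply: e2a_inj; rewrite e2a_map fid.
- move=> A B D f g h hgf x; apply: val_inj; apply/matrixP => i j; rewrite /= !mxE.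
  by apply: e2a_inj; rewrite !e2a_map hgf.
- by move=> A B f x p px i j; rewrite ffunE px /= mxE e2a_map.
Defined.

(* The factors correspond to X_{2 eps_i}, H_{2 eps_i}, X_{-2 eps_i} *)
Definition T3 : supergroup R := sg_prod (sg_prod Ga Gm) Ga.

Definition odd_affine (I : finType) : supergroup R.
refine (@Supergroup R (fun A => addg {ffun I -> odd_of A})
  (fun A B f x => [ffun i => omap f (x i)] : {ffun I -> odd_of B}) _ _ _ I
  (fun A x p => forall i, p i = o2a (x i)) _).
- move=> A B f x y; apply/ffunP => i.
  by rewrite ffunE -[(x * y)%g]/((x : {ffun I -> odd_of A}) + y) !ffunE raddfD.
- by move=> A f fid x; apply/ffunP => i; rewrite ffunE; apply: subvs_inj;
    rewrite -/(o2a _) o2a_map fid.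
- by move=> A B D f g h hgf x; apply/ffunP => i; rewrite !ffunE;
    apply: subvs_inj; rewrite -!/(o2a _) !o2a_map hgf.
- by move=> A B f x p px i; rewrite !ffunE px o2a_map.
Defined.

End BasicGroups.
Arguments Ga {R}.
Arguments Gm {R}.
Arguments SL2 {R}.
Arguments T3 {R}.
Arguments odd_affine {R} I.

Section Presented.
Variables (T : choiceType) (rel : seq T -> seq T -> Prop).

(* (true, x) stands for x and (false, x) for its formal inverse *)
Definition pos (u : seq T) : seq (bool * T) := [seq (true, x) | x <- u].

Inductive wrel : seq (bool * T) -> seq (bool * T) -> Prop :=
| wrel_refl u : wrel u u
| wrel_sym u v : wrel u v -> wrel v u
| wrel_trans u v w : wrel u v -> wrel v w -> wrel u w
| wrel_cat u u' v v' : wrel u u' -> wrel v v' -> wrel (u ++ v) (u' ++ v')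
| wrel_cancel b x : wrel [:: (b, x); (~~ b, x)] [::]
| wrel_rel u v : rel u v -> wrel (pos u) (pos v).

Definition wrelb u v := `[< wrel u v >].
Fact wrelb_refl : reflexive wrelb.
Proof. by move=> u; apply/asboolP; exact: wrel_refl. Qed.
Fact wrelb_sym : symmetric wrelb.
Proof. by move=> u v; apply/asboolP/asboolP; exact: wrel_sym. Qed.
Fact wrelb_trans : transitive wrelb.
Proof.
by move=> v u w /asboolP uv /asboolP vw; apply/asboolP; exact: wrel_trans uv vw.
Qed.
Canonical wrel_equiv := EquivRel wrelb wrelb_refl wrelb_sym wrelb_trans.

Definition presg : Type := {eq_quot wrel_equiv}.
HB.instance Definition _ := Choice.copy presg {eq_quot wrel_equiv}.
HB.instance Definition _ := EqQuotient.on presg.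

Definition wclass (u : seq (bool * T)) : presg := \pi_{eq_quot wrel_equiv} u.
Definition pgen (x : T) : presg := wclass [:: (true, x)].

Lemma wclassP u v : wclass u = wclass v <-> wrel u v.
Proof.
split=> [/eqP|uv]; last by apply/eqP; rewrite /wclass eqmodE; apply/asboolP.
by rewrite /wclass eqmodE => /asboolP.
Qed.

Lemma wrepr (x : presg) : {u | x = wclass u}.
Proof. by exists (repr x); rewrite /wclass reprK. Qed.

Lemma wrel_repr u : wrel (repr (wclass u)) u.
Proof. by apply/wclassP; rewrite {1}/wclass reprK. Qed.

Definition winv (u : seq (bool * T)) := rev [seq (~~ a.1, a.2) | a <- u].

Lemma winv_cat u v : winv (u ++ v) = winv v ++ winv u.
Proof. by rewrite /winv map_cat rev_cat. Qed.

Lemma winvK : involutive winv.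
Proof.
move=> u; rewrite /winv map_rev revK -map_comp map_id_in // => -[b x] _ /=.
by rewrite negbK.
Qed.

Lemma winv_mul u : wrel (winv u ++ u) [::].
Proof.
elim: u => [|[b x] u IHu]; first exact: wrel_refl.
rewrite -cat1s winv_cat -catA.
apply: wrel_trans IHu; apply: wrel_cat; first exact: wrel_refl.
rewrite catA -[X in wrel _ X]cat0s; apply: wrel_cat; last exact: wrel_refl.
by have := wrel_cancel (~~ b) x; rewrite negbK.
Qed.

Lemma wrel_winv u v : wrel u v -> wrel (winv u) (winv v).
Proof.
move=> uv; have := wrel_cat (wrel_refl (winv u)) (wrel_cat uv (wrel_refl (winv v))).
have := winv_mul (winv v); rewrite winvK => v1 uvv.
have {}uvv : wrel (winv u ++ u ++ winv v) (winv u).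
  apply: wrel_trans uvv _; rewrite -[X in wrel _ X]cats0.
  by apply: wrel_cat; [exact: wrel_refl | exact: v1].
apply: wrel_trans (wrel_sym uvv) _.
rewrite catA -[X in wrel _ X]cat0s; apply: wrel_cat; last exact: wrel_refl.
exact: winv_mul.
Qed.

Definition pres_one : presg := wclass [::].
Definition pres_mul (x y : presg) : presg := wclass (repr x ++ repr y).
Definition pres_inv (x : presg) : presg := wclass (winv (repr x)).

Lemma pres_mulE u v : pres_mul (wclass u) (wclass v) = wclass (u ++ v).
Proof. by apply/wclassP/wrel_cat; exact: wrel_repr. Qed.

Lemma pres_invE u : pres_inv (wclass u) = wclass (winv u).
Proof. by apply/wclassP/wrel_winv; exact: wrel_repr. Qed.

Fact pres_mulA : associative pres_mul.
Proof.
move=> x y z; have [u ->] := wrepr x; have [v ->] := wrepr y.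
by have [w ->] := wrepr z; rewrite !pres_mulE catA.
Qed.
Fact pres_mul1 : left_id pres_one pres_mul.
Proof. by move=> x; have [u ->] := wrepr x; rewrite pres_mulE. Qed.
Fact pres_mulr1 : right_id pres_one pres_mul.
Proof. by move=> x; have [u ->] := wrepr x; rewrite pres_mulE cats0. Qed.
Fact pres_mulV : left_inverse pres_one pres_inv pres_mul.
Proof.
move=> x; have [u ->] := wrepr x; rewrite pres_invE pres_mulE.
by apply/wclassP; exact: winv_mul.
Qed.
Fact pres_mulrV : right_inverse pres_one pres_inv pres_mul.
Proof.
move=> x; have [u ->] := wrepr x; rewrite pres_invE pres_mulE.
by apply/wclassP; rewrite -{1}(winvK u); exact: winv_mul.
Qed.
HB.instance Definition _ := isGroup.Build presg
  pres_mulA pres_mul1 pres_mulr1 pres_mulV pres_mulrV.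

End Presented.
Arguments pgen {T} rel x.

Section PresentedMap.
Variables (T T' : choiceType).
Variables (rel : seq T -> seq T -> Prop) (rel' : seq T' -> seq T' -> Prop).
Variable f : T -> T'.

Definition wmap (u : seq (bool * T)) := [seq (a.1, f a.2) | a <- u].
Definition pres_map (x : presg rel) : presg rel' := wclass rel' (wmap (repr x)).

Hypothesis frel : forall u v, rel u v -> rel' (map f u) (map f v).

Lemma wrel_map u v : wrel rel u v -> wrel rel' (wmap u) (wmap v).
Proof.
elim=> {u v} [u|u v _ /wrel_sym //|u v w _ uv _|u u' v v' _ uu _ vv|b x|u v uv].
- exact: wrel_refl.
- exact: wrel_trans uv.
- by rewrite /wmap !map_cat; exact: wrel_cat.
- exact: wrel_cancel.
- have := wrel_rel (frel uv); rewrite /pos /wmap -!map_comp.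
  by congr wrel; apply: eq_map.
Qed.

Lemma pres_mapE u : pres_map (wclass rel u) = wclass rel' (wmap u).
Proof. by apply/wclassP/wrel_map; exact: wrel_repr. Qed.

Lemma pres_mapM : {morph pres_map : x y / (x * y)%g >-> (x * y)%g}.
Proof.
move=> x y; have [u ->] := wrepr x; have [v ->] := wrepr y.
rewrite -[(_ * _)%g]/(pres_mul _ _) pres_mulE !pres_mapE.
by rewrite -[RHS]/(pres_mul _ _) pres_mulE /wmap map_cat.
Qed.

Lemma pres_map_gen x : pres_map (pgen rel x) = pgen rel' (f x).
Proof. exact: pres_mapE. Qed.

End PresentedMap.

Lemma omul_sq (R : realType) (A : weil R) (x y : odd_of A) :
  omul x y * omul x y = 0.
Proof.
have xx : o2a x * o2a x = 0.
  have : (2 : CC R) *: (o2a x * o2a x) = 0.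
    by rewrite scaler_nat mulr2n {2}w1C ?o2a_in // subrr.
  by move/eqP; rewrite scaler_eq0 pnatr_eq0 => /eqP.
apply: e2a_inj; rewrite -[_ * omul x y]/(emul _ _) e2aM e2a_omul.
rewrite mulrA -(mulrA (o2a x)) [o2a y * o2a x]w1C ?o2a_in //.
by rewrite mulrN mulrA xx mul0r oppr0 mul0r /e2a raddf0.
Qed.

(* The data of a pair (G, g) entering the construction of its supergroup, in  *)
(* a basis of g = g_0 + g_1 indexed by hE + hO:                               *)
(* - hbr a b is the bracket of the basis vectors a and b;                     *)
(* - hexp n Z is exp(n Z), for n a nilpotent element of A_0 and Z in g_0;     *)
(* - hAd g is the matrix of Ad(g) on A_0 (x) g_1, i.e. Ad(g) sends Y_i to the *)
(*   sum of the hAd g j i Y_j;                                                *)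
(* - htan Z is the tangent vector Z of G(C) at 1, in the coordinates of G.    *)
Record shcp (R : realType) := SHCP {
  hE : finType;
  hO : finType;
  hbr : hE + hO -> hE + hO -> {ffun hE + hO -> (CC R)^o};
  hG : supergroup R;
  hexp : forall A, even_of A -> {ffun hE -> (CC R)^o} -> hG A;
  hAd : forall A, hG A -> hO -> hO -> even_of A;
  htan : {ffun hE -> (CC R)^o} -> {ffun sg_ix hG -> @weilC R};
  hexp_map : forall A B (f : weil_hom A B) n Z, n * n = 0 ->
    sg_map f (@hexp A n Z) = @hexp B (emap f n) Z;
  hAd_map : forall A B (f : weil_hom A B) g i j,
    @hAd B (sg_map f g) i j = emap f (@hAd A g i j) }.
Arguments hexp {R} s {A} n Z.
Arguments hAd {R} s {A} g i j.

Section GP.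
Variables (R : realType) (P : shcp R).

Definition hbr11 (i j : hO P) : {ffun hE P -> (CC R)^o} :=
  [ffun e => hbr (inr i) (inr j) (inl e)].

(* inl g is the generator g in G(A), and inr (i, eta) is (1 + eta Y_i); all   *)
(* the relations of G(A) follow from gp_rel_grp.                              *)
Definition gp_gen (A : weil R) : choiceType := (hG P A + hO P * odd_of A)%type.

Inductive gp_rel (A : weil R) : seq (gp_gen A) -> seq (gp_gen A) -> Prop :=
| gp_rel_grp (g h : hG P A) : gp_rel [:: inl g; inl h] [:: inl (g * h)%g]
| gp_rel_Ad (g : hG P A) i eta : gp_rel [:: inr (i, eta); inl g]
    (inl g :: [seq inr (j, eact (hAd P (g^-1)%g j i) eta) | j <- enum (hO P)])
| gp_rel_sq i eta eta' : gp_rel [:: inr (i, eta); inr (i, eta')]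
    [:: inl (hexp P (omul eta' eta) (2^-1 *: hbr11 i i)); inr (i, eta + eta')]
| gp_rel_comm i j eta eta' : gp_rel [:: inr (i, eta); inr (j, eta')]
    [:: inl (hexp P (omul eta' eta) (hbr11 i j)); inr (j, eta'); inr (i, eta)].

Definition gp_pt (A : weil R) : groupType := presg (@gp_rel A).

Definition gp_grp A (g : hG P A) : gp_pt A := pgen (@gp_rel A) (inl g).
Definition gp_odd A (i : hO P) (eta : odd_of A) : gp_pt A :=
  pgen (@gp_rel A) (inr (i, eta)).

Definition gp_genmap A B (f : weil_hom A B) (x : gp_gen A) : gp_gen B :=
  match x with
  | inl g => inl (sg_map f g)
  | inr (i, eta) => inr (i, omap f eta)
  end.

Lemma gp_rel_map A B (f : weil_hom A B) u v :
  gp_rel u v -> gp_rel (map (gp_genmap f) u) (map (gp_genmap f) v).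
Proof.
case=> [g h|g i eta|i eta eta'|i j eta eta'] /=.
- by rewrite sg_mapM; constructor.
- rewrite -map_comp.
  rewrite (@eq_map _ _ _ (fun j =>
    inr (j, eact (hAd P ((sg_map f g)^-1)%g j i) (omap f eta)))); first by constructor.
  by move=> j; rewrite /= omap_act -hAd_map sg_mapV.
- by rewrite hexp_map ?omul_sq // emap_omul raddfD; constructor.
- by rewrite hexp_map ?omul_sq // emap_omul; constructor.
Qed.

Definition gp_map A B (f : weil_hom A B) : gp_pt A -> gp_pt B :=
  pres_map (@gp_rel B) (gp_genmap f).

Lemma gp_map_grp A B (f : weil_hom A B) g :
  gp_map f (gp_grp g) = gp_grp (sg_map f g).
Proof. by rewrite /gp_map (pres_map_gen (@gp_rel_map A B f)). Qed.

Lemma gp_map_odd A B (f : weil_hom A B) i eta :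
  gp_map f (gp_odd i eta) = gp_odd i (omap f eta).
Proof. by rewrite /gp_map (pres_map_gen (@gp_rel_map A B f)). Qed.

Definition gp_oddprod A (xi : {ffun hO P -> odd_of A}) : gp_pt A :=
  (\prod_(i <- enum (hO P)) gp_odd i (xi i))%g.

Lemma gp_mapM A B (f : weil_hom A B) :
  {morph gp_map f : x y / (x * y)%g >-> (x * y)%g}.
Proof. exact: (pres_mapM (@gp_rel_map A B f)). Qed.

Lemma gp_map_oddprod A B (f : weil_hom A B) (xi : {ffun hO P -> odd_of A}) :
  gp_map f (gp_oddprod xi) = gp_oddprod [ffun i => omap f (xi i)].
Proof.
rewrite /gp_oddprod; elim: (enum _) => [|i s IHs].
  rewrite !big_nil; apply: (mulgI (gp_map f 1%g)).
  by rewrite -gp_mapM !mulg1.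
by rewrite !big_cons gp_mapM IHs gp_map_odd ffunE.
Qed.

(* The global splitting G(A) x A_1^I -> G_P(A) is what defines the            *)
(* supermanifold structure of G_P, hence the coordinates below.               *)
Definition GP : supergroup R.
refine (@Supergroup R gp_pt gp_map gp_mapM _ _ (sg_ix (hG P) + hO P)%type
  (fun A u p => exists2 g : hG P A, sg_coord g [ffun c => p (inl c)] &
     exists2 xi : {ffun hO P -> odd_of A}, (forall i, p (inr i) = o2a (xi i)) &
       u = (gp_grp g * gp_oddprod xi)%g) _).
- move=> A f fid x; have [u ->] := wrepr x.
  rewrite /gp_map (pres_mapE (@gp_rel_map A A f)); congr wclass.
  rewrite /wmap map_id_in // => -[b [g|[i eta]]] _ /=; first by rewrite sg_map_id.
  by congr (_, inr (_, _)); apply: subvs_inj; rewrite -!/(o2a _) o2a_map fid.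
- move=> A B D f g h hgf x; have [u ->] := wrepr x.
  rewrite /gp_map /= !(pres_mapE (@gp_rel_map _ _ _)); congr wclass.
  rewrite /wmap -map_comp; apply: eq_map => -[b [z|[i eta]]] /=.
    by rewrite (sg_map_comp hgf).
  by congr (_, inr (_, _)); apply: subvs_inj; rewrite -!/(o2a _) !o2a_map hgf.
- move=> A B f u p [g cg [xi pxi ->]]; exists (sg_map f g).
    have := sg_coord_map f cg.
    by congr sg_coord; apply/ffunP => c; rewrite !ffunE.
  exists [ffun i => omap f (xi i)]; first by move=> i; rewrite !ffunE pxi o2a_map.
  by rewrite gp_mapM gp_map_grp gp_map_oddprod.
Defined.

End GP.

Section LieSubSupergroup.
Variables (R : realType) (P : shcp R).

Lemma gp_grpM A (g h : hG P A) : gp_grp (g * h)%g = (gp_grp g * gp_grp h)%g.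
Proof.
rewrite -[RHS]/(pres_mul _ _) pres_mulE.
by apply/wclassP; exact: (wrel_sym (wrel_rel (gp_rel_grp g h))).
Qed.

Lemma gp_grp1 A : gp_grp (1 : hG P A)%g = 1%g.
Proof. by apply: (mulgI (gp_grp (1 : hG P A)%g)); rewrite -gp_grpM !mulg1. Qed.

Lemma gp_grpV A (g : hG P A) : gp_grp (g^-1)%g = ((gp_grp g)^-1)%g.
Proof. by apply: (mulgI (gp_grp g)); rewrite -gp_grpM !mulgV gp_grp1. Qed.

(* the subsupergroup attached to a subgroup functor of G *)
Definition gp_even (S : subsg (hG P)) : subsg (GP P).
refine (@SubSG R (GP P) (fun A => [set gp_grp g | g in S A]%classic) _ _ _ _).
- by move=> A; exists 1%g; [exact: ss1 | exact: gp_grp1].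
- move=> A _ _ [g Sg <-] [h Sh <-]; exists (g * h)%g; first exact: ssM.
  exact: gp_grpM.
- move=> A _ [g Sg <-]; exists (g^-1)%g; first exact: ssV.
  exact: gp_grpV.
- move=> A B f _ [g Sg <-]; exists (sg_map f g); first exact: ss_map.
  by rewrite /= gp_map_grp.
Defined.

Definition full_sub (G : supergroup R) : subsg G.
by refine (@SubSG R G (fun A => setT) _ _ _ _).
Defined.

(* the underlying Lie group G, as a subsupergroup of G_P *)
Definition gp_rd : subsg (GP P) := gp_even (full_sub (hG P)).

Definition odd_gens (A : weil R) : set (GP P A) :=
  fun x => exists i (eta : odd_of A), x = gp_odd i eta.

Fact odd_gens_map (A B : weil R) (f : weil_hom A B) (x : GP P A) :
  odd_gens x -> odd_gens (sg_map f x).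
Proof.
by case=> i [eta ->]; exists i, (omap f eta); rewrite /= gp_map_odd.
Qed.

Definition gp_1 : subsg (GP P) := gen_sub odd_gens_map.

Local Notation g0 := {ffun hE P -> (CC R)^o}.
Local Notation g1 := {ffun hO P -> (CC R)^o}.
Local Notation lsa := {ffun hE P + hO P -> (CC R)^o}.

Definition lbr (u v : lsa) : lsa := \sum_a \sum_b (u a * v b) *: hbr a b.
Definition ev_incl (Z : g0) : lsa := [ffun c => if c is inl e then Z e else 0].
Definition od_incl (Y : g1) : lsa := [ffun c => if c is inr o then Y o else 0].
Definition ev_part (v : lsa) : g0 := [ffun e => v (inl e)].

Definition sub_lsa (k : {vspace lsa}) :=
  (forall v, v \in k -> ev_incl (ev_part v) \in k) /\
  (forall u v, u \in k -> v \in k -> lbr u v \in k).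

Definition Ad1 (g : hG P weilC) (Y : g1) : g1 :=
  [ffun j => \sum_i (e2a (hAd P g j i) : CC R) * Y i].

Section Body.
Variable G : supergroup R.

Definition crow (p : {ffun sg_ix G -> @weilC R}) : 'rV[CC R]_#|sg_ix G| :=
  \row_k (p (enum_val k) : CC R).

Definition subgroup (K : set (G weilC)) :=
  [/\ K 1%g, forall x y, K x -> K y -> K (x * y)%g & forall x, K x -> K (x^-1)%g].

Definition closed_in (K : set (G weilC)) := exists2 F : set 'rV[CC R]_#|sg_ix G|,
  closed F & forall g p, sg_coord g p -> (K g <-> F (crow p)).

Definition connected_in (K : set (G weilC)) :=
  connected [set crow p | p in [set p | exists2 g, K g & sg_coord g p]]%classic.

End Body.

(* K is a complex submanifold of G near 1, with tangent space k0: it is the   *)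
(* zero locus of holomorphic functions whose differentials are independent on *)
(* T_1 G and have common kernel k0. For a subgroup K, this is enough for K to *)
(* be a submanifold everywhere, by translation.                               *)
Definition submanifold_at1 (K : set (hG P weilC)) (k0 : set g0) :=
  exists2 p1 : {ffun sg_ix (hG P) -> weilC}, sg_coord (1%g : hG P weilC) p1 &
  exists (r : nat) (F : 'I_r -> 'rV[CC R]_#|sg_ix (hG P)| -> CC R),
  [/\ \forall x \near crow p1, forall l, differentiable (F l) x,
      \forall x \near crow p1, forall (g : hG P weilC) p, sg_coord g p ->
        crow p = x -> (K g <-> forall l, F l x = 0),
      forall w : 'I_r -> CC R, exists Z : g0,
        forall l, 'd (F l) (crow p1) (crow (htan Z)) = w l
    & forall Z : g0, k0 Z <->
        forall l, 'd (F l) (crow p1) (crow (htan Z)) = 0].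

(* The closed Lie subsupergroup of G_P attached to the pair (K, k): K is a    *)
(* closed Lie subgroup of G, k a Lie subsuperalgebra of g with k_0 = Lie(K)   *)
(* and k_1 stable under K. The A_0-points of K are generated by K and the     *)
(* exp(n Z) with n in N(A)_0 and Z in k_0; (1 + eta Y), for Y in k_1 with     *)
(* coordinates v_i, is the product of the (1 + v_i eta Y_i).                  *)
Definition lie_subsg_of (K : set (hG P weilC)) (k : {vspace lsa})
    (S : forall A, set (GP P A)) :=
  [/\ subgroup K /\ closed_in K,
      submanifold_at1 K [set Z | ev_incl Z \in k]%classic,
      sub_lsa k,
      forall g Y, K g -> od_incl Y \in k -> od_incl (Ad1 g Y) \in k
    & forall A (x : GP P A), S A x <-> generated (fun y =>
        [\/ exists2 g, K g & y = gp_grp (sg_map (scal_hom A) g),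
            exists n Z, [/\ e2a n \in wN A, ev_incl Z \in k & y = gp_grp (hexp P n Z)]
          | exists (eta : odd_of A) v, od_incl v \in k /\
              y = gp_oddprod [ffun i => v i *: eta]]) x].

Definition closed_lie_subsg (S : forall A, set (GP P A)) :=
  exists K k, lie_subsg_of K k S.

Definition simple_supergroup := forall K k (S : forall A, set (GP P A)),
  lie_subsg_of K k S -> connected_in K -> normal S ->
  (forall A x, S A x -> x = 1%g) \/ (forall A x, S A x).

End LieSubSupergroup.

Definition semidirect (R : realType) (X : supergroup R) (K N : subsg X) :=
  [/\ normal N,
      forall A (x : X A), K A x -> N A x -> x = 1%g,
      forall A (x : X A), exists k n, [/\ K A k, N A n & x = (k * n)%g]
    & exists h : forall A, X A -> sg_prod (sg_sub K) (sg_sub N) A,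
        let m A (u : sg_prod (sg_sub K) (sg_sub N) A) : X A := (val u.1 * val u.2)%g in
        forall A, [/\ cancel (m A) (h A), cancel (h A) (m A),
          holo (@sg_coord R (sg_prod (sg_sub K) (sg_sub N)) A) (@sg_coord R X A) (m A)
        & holo (@sg_coord R X A) (@sg_coord R (sg_prod (sg_sub K) (sg_sub N)) A) (h A)]].

Definition split_exact (R : realType) (N X Q : supergroup R)
    (i : lie_hom N X) (p : lie_hom X Q) :=
  [/\ forall A, injective (i A),
      forall A x, p A x = 1%g <-> exists n, x = i A n
    & exists s : lie_hom Q X, forall A, cancel (s A) (p A)].

(* Finite-dimensional representations of G, in a basis indexed by rix *)
Record rep (R : realType) (G : supergroup R) := Rep {
  rix : finType;
  rmx : forall A, G A -> rix -> rix -> even_of A;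
  rmx1 : forall A i j, @rmx A 1%g i j = (i == j)%:R;
  rmxM : forall A (g h : G A) i j,
    rmx (g * h)%g i j = \sum_k rmx g i k * rmx h k j;
  rmx_map : forall A B (f : weil_hom A B) (g : G A) i j,
    rmx (sg_map f g) i j = emap f (rmx g i j) }.

Section Rep.
Variable R : realType.

Definition triv_rep (G : supergroup R) : rep G.
refine (@Rep R G unit (fun _ _ _ _ => 1) _ _ _).
- by move=> A [] [].
- by move=> A g h i j; rewrite (big_pred1 tt) ?mulr1 // => -[].
- by move=> A B f g i j; rewrite rmorph1.
Defined.

Definition box : rep (@SL2 R).
refine (@Rep R SL2 'I_2 (fun A g i j => val g i j) _ _ _).
- by move=> A i j; rewrite mxE.
- by move=> A g h i j; rewrite mxE.
- by move=> A B f g i j; rewrite /= mxE.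
Defined.

Definition dsum (G : supergroup R) (M N : rep G) : rep G.
refine (@Rep R G (rix M + rix N)%type (fun A g i j =>
  match i, j with
  | inl i, inl j => rmx g i j
  | inr i, inr j => rmx g i j
  | _, _ => 0
  end) _ _ _).
- by move=> A [i|i] [j|j]; rewrite ?rmx1.
- move=> A g h [i|i] [j|j]; rewrite big_sumType /= ?rmxM.
  + by rewrite [X in _ + X]big1 ?addr0 // => k _; rewrite mul0r.
  + rewrite big1 ?add0r => [|k _]; last by rewrite mulr0.
    by rewrite big1 // => k _; rewrite mul0r.
  + rewrite big1 ?add0r => [|k _]; last by rewrite mul0r.
    by rewrite big1 // => k _; rewrite mulr0.
  + by rewrite [X in X + _]big1 ?add0r // => k _; rewrite mul0r.
- by move=> A B f g [i|i] [j|j]; rewrite ?rmx_map ?rmorph0.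
Defined.

Definition outer (G H : supergroup R) (M : rep G) (N : rep H) : rep (sg_prod G H).
refine (@Rep R (sg_prod G H) (rix M * rix N)%type
  (fun A g i j => rmx g.1 i.1 j.1 * rmx g.2 i.2 j.2) _ _ _).
- by move=> A [i i'] [j j']; rewrite /= !rmx1 -natrM mulnb.
- move=> A g h [i i'] [j j']; rewrite /= !rmxM.
  rewrite big_distrlr /= pair_big /=.
  by apply: eq_bigr => k _; rewrite mulrACA.
- by move=> A B f g i j; rewrite /= !rmx_map rmorphM.
Defined.

(* A module M as a purely odd Abelian supergroup A |-> A_1 (x) M, and the     *)
(* action of G on it                                                          *)
Definition odd_module (G : supergroup R) (M : rep G) : supergroup R :=
  odd_affine (rix M).

Definition rep_act (G : supergroup R) (M : rep G) (A : weil R) (g : G A)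
    (v : odd_module M A) : odd_module M A :=
  [ffun i => \sum_j eact (rmx g i j) (v j)] : {ffun rix M -> odd_of A}.

End Rep.
Arguments box {R}.

(* (i, None) stands for H_{2 eps_i}, and (i, Some s) for X_{+- 2 eps_i}       *)
Definition ev_gen : finType := ('I_3 * option bool)%type.
(* (s, Some i) stands for X_{+- beta_i}, and (s, None) for X_{+- theta}       *)
Definition od_gen : finType := (bool * option 'I_3)%type.
Definition gen : finType := (ev_gen + od_gen)%type.

Definition i1 : 'I_3 := @Ordinal 3 0 isT.
Definition i2 : 'I_3 := @Ordinal 3 1 isT.
Definition i3 : 'I_3 := @Ordinal 3 2 isT.

Section Gx.
Variable R : realType.

(* C[x_1, x_2, x_3] / (x_1 + x_2 + x_3), as the polynomial ring C[x_1][x_2]   *)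
Definition Cx : comNzRingType := {poly {poly CC R}}.
Definition cst (c : CC R) : Cx := c%:P%:P.
Definition xv (i : 'I_3) : Cx :=
  match val i with 0%N => 'X%:P | 1%N => 'X | _ => - ('X%:P + 'X) end.
Definition tau : Cx := xv i1 * xv i2 * xv i3.

Definition gx := {ffun gen -> Cx^o}.
Definition bas (c : gen) : gx := [ffun d => (d == c)%:R].
Definition gH (i : 'I_3) : gx := bas (inl (i, None)).
Definition gX (s : bool) (i : 'I_3) : gx := bas (inl (i, Some s)).
Definition gB (s : bool) (i : 'I_3) : gx := bas (inr (s, Some i)).
Definition gT (s : bool) : gx := bas (inr (s, None)).
Definition gHtheta : gx := cst 2^-1 *: (gH i1 + gH i2 + gH i3).

Definition sgn (s : bool) : Cx := if s then 1 else -1.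
Definition third (i j k : 'I_3) := [&& i != j, k != i & k != j].

Definition br00 (a b : ev_gen) : gx :=
  let: (i, u) := a in let: (j, v) := b in
  if i != j then 0 else
  match u, v with
  | None, Some s => (sgn s * 2 * xv i) *: gX s j
  | Some s, None => - ((sgn s * 2 * xv i) *: gX s i)
  | Some true, Some false => xv i *: gH i
  | Some false, Some true => - (xv i *: gH i)
  | _, _ => 0
  end.

Definition br01 (a : ev_gen) (b : od_gen) : gx :=
  let: (i, u) := a in
  match u, b with
  | None, (s, Some j) => (sgn s * (-1) ^+ (i == j) * xv i) *: gB s j
  | None, (s, None) => (sgn s * xv i) *: gT s
  | Some true, (true, Some j) => ((i == j)%:R * xv i) *: gT true
  | Some true, (false, Some j) => \sum_(k | third i j k) xv i *: gB true k
  | Some false, (true, Some j) => \sum_(k | third i j k) xv i *: gB false k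
  | Some false, (false, Some j) => ((i == j)%:R * xv i) *: gT false
  | Some true, (true, None) => 0
  | Some true, (false, None) => xv i *: gB false i
  | Some false, (true, None) => xv i *: gB true i
  | Some false, (false, None) => 0
  end.

Definition br11 (a b : od_gen) : gx :=
  match a, b with
  | (true, Some i), (true, Some j) => \sum_(k | third i j k) gX true k
  | (false, Some i), (false, Some j) => - \sum_(k | third i j k) gX false k
  | (true, Some i), (false, Some j) | (false, Some j), (true, Some i) =>
      if i == j then gH i - gHtheta else 0
  | (true, Some i), (true, None) | (true, None), (true, Some i) => 0
  | (true, Some i), (false, None) | (false, None), (true, Some i) => gX false i
  | (false, Some i), (true, None) | (true, None), (false, Some i) => - gX true i
  | (false, Some i), (false, None) | (false, None), (false, Some i) => 0
  | (true, None), (true, None) | (false, None), (false, None) => 0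
  | (true, None), (false, None) | (false, None), (true, None) => gHtheta
  end.

Definition gx_br (a b : gen) : gx :=
  match a, b with
  | inl a, inl b => br00 a b
  | inl a, inr b => br01 a b
  | inr a, inl b => - br01 b a
  | inr a, inr b => br11 a b
  end.

Definition gx_bracket (u v : gx) : gx := \sum_a \sum_b (u a * v b) *: gx_br a b.

(* g(x)_tau is free on the hat_bas c, and hat_coef are its structure constants *)
(* in that basis: see gx_bracket_hat.                                          *)
Definition is_odd (c : gen) : bool := if c is inr _ then true else false.
Definition hat_bas (c : gen) : gx := if is_odd c then tau *: bas c else bas c.
Definition hat_coef (a b c : gen) : Cx :=
  (if is_odd a && is_odd b then tau ^+ 2 else 1) * gx_br a b c.

Lemma bas_parity c d : is_odd c != is_odd d -> bas c d = 0.
Proof.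
move=> h; rewrite ffunE; suff -> : (d == c) = false by exact: mulr0n.
by apply: contraNF h => /eqP ->; exact: eqxx.
Qed.

Lemma gx_br_parity a b c :
  is_odd c != is_odd a (+) is_odd b -> gx_br a b c = 0.
Proof.
have gZ k (v : gx) : v c = 0 -> (k *: v) c = 0 by move=> v0; rewrite ffunE v0 scaler0.
have gN (v : gx) : v c = 0 -> (- v) c = 0 by move=> v0; rewrite ffunE v0 oppr0.
have gD (u v : gx) : u c = 0 -> v c = 0 -> (u + v) c = 0.
  by move=> u0 v0; rewrite ffunE u0 v0 addr0.
have g0 : (0 : gx) c = 0 by rewrite ffunE.
have gS (Q : pred 'I_3) (F : 'I_3 -> gx) :
    (forall k, F k c = 0) -> (\sum_(k | Q k) F k) c = 0.
  by move=> F0; rewrite sum_ffunE big1.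
case: a b => [[i u]|[s u]] [[j v]|[t v]] /=; rewrite ?negbK => odc.
- have h0 k w : bas (inl (k, w)) c = 0.
    by apply: bas_parity => /=; move: odc; case: (is_odd c).
  case: ifP => _; first exact: g0.
  by case: u v => [[]|] [[]|]; do ?[exact: g0 | exact: h0 | apply: gN | apply: gZ].
- have h0 w : bas (inr w) c = 0.
    by apply: bas_parity => /=; move: odc; case: (is_odd c).
  by case: u t v => [[]|] [] [j|];
    do ?[exact: g0 | exact: h0 | apply: gN | apply: gZ | apply: gS => k].
- have h0 w : bas (inr w) c = 0.
    by apply: bas_parity => /=; move: odc; case: (is_odd c).
  by apply: gN; case: v s u => [[]|] [] [i|];
    do ?[exact: g0 | exact: h0 | apply: gN | apply: gZ | apply: gS => k].
- have h0 k : bas (inl k) c = 0.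
    by apply: bas_parity => /=; move: odc; case: (is_odd c).
  have hT : gHtheta c = 0 by apply: gZ; apply: (gD); [apply: (gD)|]; exact: h0.
  by case: s t u v => [] [] [i|] [j|]; try (case: ifP => _);
    do ?[exact: g0 | exact: h0 | exact: hT | apply: gN | apply: gD | apply: gS => k].
Qed.

Lemma gx_bracket_hat a b :
  gx_bracket (hat_bas a) (hat_bas b) = \sum_c hat_coef a b c *: hat_bas c.
Proof.
pose w (c : gen) : Cx := if is_odd c then tau else 1.
have hatE c : hat_bas c = w c *: bas c.
  by rewrite /hat_bas /w; case: ifP => _; rewrite ?scale1r.
have -> : gx_bracket (hat_bas a) (hat_bas b) = (w a * w b) *: gx_br a b.
  rewrite /gx_bracket (bigD1 a) //= (bigD1 b) //= !big1 ?addr0.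
  + by rewrite !hatE !ffunE !eqxx /GRing.scale /= !mulr1.
  + move=> d /negPf dab; rewrite big1 // => e _; rewrite !hatE !ffunE.
    by rewrite dab scaler0 mul0r scale0r.
  + move=> e /negPf eb; rewrite !hatE !ffunE eb scaler0 mulr0 scale0r //.
apply/ffunP => c; rewrite ffunE sum_ffunE (bigD1 c) //= big1 ?addr0; last first.
  by move=> d /negPf dc; rewrite hatE !ffunE eq_sym dc !scaler0.
rewrite hatE !ffunE eqxx /GRing.scale /= mulr1 /hat_coef.
have [od|od] := eqVneq (is_odd c) (is_odd a (+) is_odd b); last first.
  by rewrite gx_br_parity // mulr0 mulr0 mul0r.
rewrite /w od; case: (is_odd a); case: (is_odd b) => /=;
  by rewrite ?mulr1 ?mul1r ?expr2 // mulrC.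
Qed.

End Gx.

Section GHat.
Variables (R : realType) (sigma : 'I_3 -> CC R).

(* Reduction modulo I_sigma: see ev_sigma_ker. *)
Definition ev_sigma (p : Cx R) : CC R := (p.[(sigma i2)%:P]).[sigma i1].

Lemma ev_sigma_ker : \sum_i sigma i = 0 -> forall p : Cx R,
  ev_sigma p = 0 <->
  exists q : 'I_3 -> Cx R, p = \sum_i q i * (xv R i - cst (sigma i)).
Proof.
have sum3 (V : nmodType) (F : 'I_3 -> V) : \sum_i F i = F i1 + F i2 + F i3.
  rewrite !big_ord_recr big_ord0 /= add0r.
  by congr (F _ + F _ + F _); apply: val_inj.
rewrite sum3 => s0 p.
have s3 : sigma i3 = - (sigma i1 + sigma i2) by apply/eqP; rewrite -addr_eq0 addrC s0.
split=> [p0|[q ->]].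
  have /factor_theorem [r pr] : root (p - (p.[(sigma i2)%:P])%:P) (sigma i2)%:P.
    by rewrite /root hornerD hornerN hornerC subrr.
  have /factor_theorem [t pt] : root (p.[(sigma i2)%:P]) (sigma i1).
    by rewrite /root; apply/eqP.
  exists (fun i => if i == i1 then t%:P else if i == i2 then r else 0).
  rewrite sum3 /= mul0r addr0 /xv /= /cst -!polyCB -polyCM -pt -pr addrC.
  by rewrite subrK.
rewrite /ev_sigma sum3 /xv /= /cst s3 !(hornerD, hornerM, hornerN, hornerX, hornerC).
by ring.
Qed.

(* Since g(x)_tau is free, ghat(sigma) is free on the classes of the hat_bas  *)
(* c, with structure constants reduced modulo I_sigma.                        *)
Definition ghat_br (a b : gen) : {ffun ev_gen + od_gen -> (CC R)^o} :=
  [ffun c => ev_sigma (hat_coef R a b c)].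

End GHat.

Section NilpotentExp.
Variables (R : realType) (A : weil R).

(* some m with n ^+ m = 0, for a nilpotent n *)
Definition nilidx (n : even_of A) : nat := xget 0%N [set m | n ^+ m = 0]%classic.

Lemma nilidx_sum (n : even_of A) (c : nat -> CC R) : n * n = 0 ->
  \sum_(k < nilidx n) c k *: n ^+ k = c 0%N *: 1 + c 1%N *: n.
Proof.
move=> nn; have : n ^+ nilidx n = 0.
  by rewrite /nilidx; case: xgetP => [m _ //|/(_ 2%N)]; rewrite /= expr2 nn.
case: (nilidx n) => [/eqP|[|m _]].
- by rewrite expr0 oner_eq0.
- by rewrite expr1 => ->; rewrite big_ord_recr big_ord0 /= add0r scaler0 addr0.
- rewrite !big_ord_recl big1 ?addr0 ?expr0 ?expr1 // => k _.
  by rewrite !exprS /= !mulrA nn mul0r scaler0.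
Qed.

(* exp(n Z), for n nilpotent and Z a complex number or matrix *)
Definition nexp (n : even_of A) (z : CC R) : even_of A :=
  \sum_(k < nilidx n) (z ^+ k / k`!%:R) *: n ^+ k.
Definition nexpmx (n : even_of A) (Z : 'M[CC R]_2) : 'M[even_of A]_2 :=
  \matrix_(i, j) \sum_(k < nilidx n) ((Z ^+ k) i j / k`!%:R) *: n ^+ k.

Lemma nexp_sq n z : n * n = 0 -> nexp n z = 1 + z *: n.
Proof.
move=> nn; rewrite /nexp (nilidx_sum (fun k => z ^+ k / k`!%:R)) //.
by rewrite expr0 expr1 !divr1 scale1r.
Qed.

Lemma nexpmx_sq n Z i j : n * n = 0 ->
  nexpmx n Z i j = (i == j)%:R + Z i j *: n.
Proof.
move=> nn; rewrite mxE (nilidx_sum (fun k => (Z ^+ k) i j / k`!%:R)) //.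
rewrite expr0 expr1 !divr1 mxE.
by case: (i == j); rewrite ?scale1r ?scale0r.
Qed.

End NilpotentExp.

Lemma det_mx2 (K : comNzRingType) (M : 'M[K]_2) :
  \det M = M ord0 ord0 * M ord_max ord_max - M ord0 ord_max * M ord_max ord0.
Proof.
rewrite (expand_det_row _ ord0) !big_ord_recl big_ord0 addr0 /cofactor.
rewrite !det_mx11 !mxE /= expr0 expr1 mul1r mulN1r mulrN.
by congr (_ * M _ _ - M _ _ * M _ _); apply: val_inj.
Qed.

Section Factor.
Variable R : realType.

Local Notation sl2c s zp zh zm :=
  (s *: \matrix_(i < 2, j < 2) if i == j then (if i == ord0 then zh else - zh)
                               else (if i == ord0 then zp else zm)).

(* b tells whether sigma_i = 0. The element of a_i with coordinates zp, zh,   *)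
(* zm on X_{2 eps_i}, H_{2 eps_i}, X_{-2 eps_i} is s (zp e + zh h + zm f) in  *)
(* sl_2, where s = sigma_i, if b is false.                                    *)
Definition factor (b : bool) : supergroup R := if b then T3 else SL2.

Definition T3_exp (A : weil R) (n : even_of A) (zp zh zm : CC R) : T3 A :=
  ((zp *: n,
    insubd (unitg_one _ : {u : even_of A * even_of A | u.1 * u.2 == 1})
      (nexp n zh, nexp n (- zh))),
   zm *: n).

Definition SL2_exp (A : weil R) (s : CC R) (n : even_of A) (zp zh zm : CC R) :
    SL2 A :=
  insubd (sl2_one _ : {M : 'M[even_of A]_2 | \det M == 1})
    (nexpmx n (sl2c s zp zh zm)).

Definition factor_exp (b : bool) (s : CC R) (A : weil R) (n : even_of A)
    (zp zh zm : CC R) : factor b A :=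
  match b return factor b A with
  | true => T3_exp n zp zh zm
  | false => SL2_exp s n zp zh zm
  end.

Definition factor_tan (b : bool) (s zp zh zm : CC R) :
    {ffun sg_ix (factor b) -> @weilC R} :=
  match b return {ffun sg_ix (factor b) -> @weilC R} with
  | true => [ffun c => match c with
             | inl (inl _) => zp
             | inl (inr true) => zh
             | inl (inr false) => - zh
             | inr _ => zm
             end : @weilC R]
  | false => [ffun c => (sl2c s zp zh zm) c.1 c.2 : @weilC R]
  end.

(* For the matrices E, F of the actions of e, f on a multiple of the          *)
(* tautological module, M acts as M00 EF + M01 E + M10 F + M11 FE.            *)
Definition SL2_Ad (I : finType) (E F : I -> I -> CC R) (A : weil R) (g : SL2 A)
    (i j : I) : even_of A :=
  let mm (X Y : I -> I -> CC R) := \sum_k X i k * Y k j in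
  let M : 'M[even_of A]_2 := val g in
  mm E F *: M ord0 ord0 + E i j *: M ord0 ord_max
  + F i j *: M ord_max ord0 + mm F E *: M ord_max ord_max.

Definition factor_Ad (b : bool) (I : finType) (E F : I -> I -> CC R)
    (A : weil R) : factor b A -> I -> I -> even_of A :=
  match b return factor b A -> I -> I -> even_of A with
  | true => fun _ i j => (i == j)%:R
  | false => SL2_Ad E F (A := A)
  end.

Lemma factor_exp_map b s (A B : weil R) (f : weil_hom A B) n zp zh zm :
  n * n = 0 ->
  sg_map f (factor_exp b s n zp zh zm) = factor_exp b s (emap f n) zp zh zm.
Proof.
move=> nn; have nn' : emap f n * emap f n = 0 by rewrite -rmorphM nn raddf0.
case: b => /=.
  rewrite /T3_exp; congr (_, _, _); rewrite ?linearZ //=.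
  apply: val_inj; rewrite /= !val_insubd /=.
  have unit1 (D : weil R) (m : even_of D) : m * m = 0 ->
      nexp m zh * nexp m (- zh) == 1.
    move=> mm; rewrite !nexp_sq // mulrDl !mulrDr !mul1r mulr1.
    rewrite -scalerAl -scalerAr mm !scaler0 addr0 scaleNr addrNK.
    by [].
  by rewrite !unit1 //= !nexp_sq // !(rmorphD, rmorph1) /= !linearZ.
apply: val_inj; rewrite /= !val_insubd.
have det1 (D : weil R) (m : even_of D) : m * m = 0 ->
    \det (nexpmx m (sl2c s zp zh zm)) == 1.
  move=> mm; rewrite det_mx2 !nexpmx_sq // !mxE /=.
  rewrite !(mulr0n, mulr1n, add0r) mulrN scaleNr mulrDl !mulrDr !mul1r mulr1.
  rewrite !mulrN -!scalerAl -!scalerAr mm !scaler0 subr0 oppr0 addr0.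
  by rewrite addrNK.
rewrite !det1 //; apply/matrixP => i j; rewrite mxE !nexpmx_sq //.
by rewrite rmorphD rmorph_nat /= linearZ.
Qed.

Lemma factor_Ad_map b (I : finType) (E F : I -> I -> CC R) (A B : weil R)
    (f : weil_hom A B) (g : factor b A) i j :
  factor_Ad E F (sg_map f g) i j = emap f (factor_Ad E F g i j).
Proof.
case: b g => g /=; first by rewrite rmorph_nat.
by rewrite /SL2_Ad /= !mxE !raddfD /= !linearZ.
Qed.

End Factor.

Section GHatGroup.
Variables (R : realType) (sigma : 'I_3 -> CC R).

Definition Ahat (i : 'I_3) : supergroup R := factor R (sigma i == 0).
Definition Ghat : supergroup R := sg_bigprod Ahat.

Local Notation g0 := {ffun ev_gen -> (CC R)^o}.

Definition Ghat_exp (A : weil R) (n : even_of A) (Z : g0) : Ghat A :=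
  [ffun i => factor_exp (sigma i == 0) (sigma i) n
    (Z (i, Some true)) (Z (i, None)) (Z (i, Some false))] : big_pt Ahat A.

Definition Ghat_tan (Z : g0) : {ffun sg_ix Ghat -> @weilC R} :=
  [ffun c : {i : 'I_3 & sg_ix (Ahat i)} =>
    factor_tan (sigma (tag c) == 0) (sigma (tag c)) (Z (tag c, Some true))
      (Z (tag c, None)) (Z (tag c, Some false)) (tagged c)].

(* The matrix of ad(X_{+- 2 eps_i}) / sigma_i on the odd part of ghat(sigma), *)
(* i.e. of the action of e (resp. f) in the i-th copy of sl_2.                *)
Definition ad_ef (s : bool) (i : 'I_3) (c b : od_gen) : CC R :=
  (sigma i)^-1 * ghat_br sigma (inl (i, Some s)) (inr b) (inr c).

(* If sigma_i = 0, then A_i acts trivially, since so does its Lie algebra. *)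
Definition Ghat_Ad_i (A : weil R) (g : Ghat A) (i : 'I_3) :
    od_gen -> od_gen -> even_of A :=
  factor_Ad (ad_ef true i) (ad_ef false i) ((g : big_pt Ahat A) i).

Definition Ghat_Ad (A : weil R) (g : Ghat A) (a d : od_gen) : even_of A :=
  \sum_b \sum_c Ghat_Ad_i g i1 a b * Ghat_Ad_i g i2 b c * Ghat_Ad_i g i3 c d.

Fact Ghat_exp_map (A B : weil R) (f : weil_hom A B) n (Z : g0) : n * n = 0 ->
  sg_map f (Ghat_exp n Z) = Ghat_exp (emap f n) Z.
Proof.
by move=> nn; apply/ffunP => i; rewrite !ffunE factor_exp_map.
Qed.

Fact Ghat_Ad_map (A B : weil R) (f : weil_hom A B) (g : Ghat A) a d :
  Ghat_Ad (sg_map f g) a d = emap f (Ghat_Ad g a d).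
Proof.
rewrite raddf_sum; apply: eq_bigr => b _; rewrite /= raddf_sum.
apply: eq_bigr => c _; rewrite /= !rmorphM.
by rewrite /Ghat_Ad_i /= /big_map !ffunE !factor_Ad_map.
Qed.

Definition Ghat_pair : shcp R :=
  @SHCP R ev_gen od_gen (ghat_br sigma) Ghat Ghat_exp Ghat_Ad Ghat_tan
    Ghat_exp_map Ghat_Ad_map.

Definition GGhat : supergroup R := GP Ghat_pair.

Definition Ahat_in (i : 'I_3) : subsg Ghat.
refine (@SubSG R Ghat
  (fun A (g : big_pt Ahat A) => forall j, j != i -> g j = 1%g) _ _ _ _).
- by move=> A j _; rewrite ffunE.
- by move=> A x y x1 y1 j ji; rewrite ffunE x1 // y1 // mulg1.
- move=> A x x1 j ji; rewrite ffunE x1 //.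
  by apply: (mulgI 1%g); rewrite mulgV mulg1.
- by move=> A B f x x1 j ji; rewrite ffunE x1 // sg_map1.
Defined.

Definition Ahat_sub (i : 'I_3) : subsg GGhat := gp_even (P := Ghat_pair) (Ahat_in i).

End GHatGroup.

(* Main.v *)
(* In the basis of weights, the odd part of ghat(sigma) is the outer tensor     *)
(* product of the three tautological sl_2-modules, A_i acting trivially if      *)
(* sigma_i = 0, and the bracket of two odd elements is divisible by             *)
(* tau(sigma)^2. If some sigma_i is 0, then the odd elements therefore          *)
(* anticommute, and the points of G_P over any A are the semidirect product of  *)
(* G(A) and the additive group of A_1 (x) g_1: the relations hold in that       *)
(* product, which yields an inverse of the obvious map.                         *)
(* If no sigma_i is 0, let (K, k) be the pair of a normal connected closed      *)
(* subsupergroup. Over the test algebra C[eps] (x) C[eta], odd elements have    *)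
(* zero product, so the semidirect decomposition holds there whatever sigma is. *)
(* Conjugation then shows that k_1 is stable under G and contains [k_0, g_1].   *)
(* Since g_1 is irreducible and generates g, and g_0 acts faithfully on g_1,    *)
(* either k is everything, and K contains a neighbourhood of 1, hence all of G; *)
(* or k = 0. In that case K commutes with all exp(eps Z), so it consists of     *)
(* triples of matrices 1 or -1, and K = 1 by connectedness.                     *)

Require Import Defs.
From HB Require Import structures.
From mathcomp Require Import all_boot all_order all_algebra all_field complex.
From mathcomp Require Import generic_quotient boolp classical_sets reals.
From mathcomp Require Import functions topology normedtype derive ring.

Set Implicit Arguments.
Unset Strict Implicit.
Unset Printing Implicit Defensive.

Import Order.TTheory GRing.Theory Num.Theory.
Import numFieldNormedType.Exports.
Import Defs.
Local Open Scope ring_scope.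

(** * Arithmetic of Weil superalgebras and affine maps in coordinates *)

(** Label the eight odd basis vectors by sign triples, so that g_1 becomes a tensor product of three
    two-dimensional spaces. The computation that carries everything is [Ghat_AdE]: Ad(g) is the
    tensor product of three 2x2 matrices, the l-th one being the component of g in SL_2, or the
    identity when sigma_l = 0. The other structural fact is [ghat_br11]: brackets of odd vectors are
    divisible by (sigma_1 sigma_2 sigma_3)^2.

    When some sigma_l is 0, odd vectors have zero brackets, so the defining relations of the
    supergroup hold in the group of pairs (g, xi) twisted by Ad ([sd_gen_rel]), and [to_sdK] and
    [of_sdK] identify the two groups. In this model the odd subsupergroup is the kernel of the
    projection to G ([G1P]), conjugation acts on it through Ad ([conj_oddprod]), and its module
    structure is [Ghat_AdE] again ([rmx_Ghat_Ad]). A factor with sigma_i = 0 is Abelian and acts by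
    the identity, hence is central; if all parameters vanish, the product is not twisted at all.
    That the factor is a closed Lie subsupergroup uses that its A-points are generated by complex
    points and exponentials of nilpotents ([Ghat_gen]).

    When no sigma_l is 0, let S be normal and attached to (K, k). Over C[eps] (x) C[eta] products of
    odd elements vanish, so the same model is available there. Conjugating 1 + eta Y by complex
    points shows that k_1 is stable under G ([k_Ad_odd]); conjugating exp(eps Z) by 1 + eta Y shows
    that k_1 contains [k_0, g_1] ([k_bracket_odd]). A nonzero k_1 is all of g_1 by irreducibility
    ([k_odd_full]) and then generates g ([k_full_of_odd]); in that case K contains a neighbourhood
    of 1, hence all elementary matrices, hence G ([K_full]). If k_1 = 0, faithfulness gives k_0 = 0
    ([adZ_faithful]). Conjugates of points of K by exp(eps Z) are then free of eps, so each
    component commutes with e and f and is a scalar of square 1 ([K_scalar]), and connectedness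
    leaves only 1 ([K_trivial]). *)

Section WeilArithmetic.
Variables (R : realType) (A : weil R).
Implicit Types (a b : even_of A) (x y : odd_of A).

Lemma o2a_inj : injective (@o2a R A).
Proof. exact: subvs_inj. Qed.

Lemma e2a0 : e2a (0 : even_of A) = 0.
Proof. exact: raddf0. Qed.

Lemma o2a0 : o2a (0 : odd_of A) = 0.
Proof. exact: raddf0. Qed.

Lemma e2aB a b : e2a (a - b) = e2a a - e2a b.
Proof. exact: raddfB. Qed.

Lemma e2aZ c a : e2a (c *: a) = c *: e2a a.
Proof. exact: linearZ. Qed.

Lemma e2a_1 : e2a (1 : even_of A) = 1.
Proof. exact: e2a1. Qed.

Lemma e2a_mul a b : e2a (a * b) = e2a a * e2a b.
Proof. exact: e2aM. Qed.

Lemma o2aD x y : o2a (x + y) = o2a x + o2a y.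
Proof. exact: raddfD. Qed.

Lemma o2aZ c x : o2a (c *: x) = c *: o2a x.
Proof. exact: linearZ. Qed.

Lemma eactD a x y : eact a (x + y) = eact a x + eact a y.
Proof. by apply: o2a_inj; rewrite !(o2aD, o2a_act) mulrDr. Qed.

Lemma eact0 a : eact a 0 = 0.
Proof. by apply: o2a_inj; rewrite o2a_act o2a0 mulr0. Qed.

Lemma eactDl a b x : eact (a + b) x = eact a x + eact b x.
Proof. by apply: o2a_inj; rewrite !(o2aD, o2a_act, e2aD) mulrDl. Qed.

Lemma eact0l x : eact 0 x = 0.
Proof. by apply: o2a_inj; rewrite o2a_act e2a0 o2a0 mul0r. Qed.

Lemma eact1 x : eact 1 x = x.
Proof. by apply: o2a_inj; rewrite o2a_act e2a_1 mul1r. Qed.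

Lemma eactM a b x : eact (a * b) x = eact a (eact b x).
Proof. by apply: o2a_inj; rewrite !o2a_act e2a_mul mulrA. Qed.

Lemma eact_suml (I : finType) (F : I -> even_of A) x :
  eact (\sum_i F i) x = \sum_i eact (F i) x.
Proof. exact: (big_morph (fun a => eact a x) (fun a b => eactDl a b x) (eact0l x)). Qed.

Lemma eact_sumr (I : finType) a (F : I -> odd_of A) :
  eact a (\sum_i F i) = \sum_i eact a (F i).
Proof. exact: (big_morph _ (eactD a) (eact0 a)). Qed.

Lemma omul0l x : omul 0 x = 0.
Proof. by apply: e2a_inj; rewrite e2a_omul o2a0 e2a0 mul0r. Qed.

End WeilArithmetic.

(** * Maps that copy coordinates or fix them *)

Section CoordinateAffine.
Variables (R : realType) (A : weil R).

Definition pull (I J : finType) (r : J -> option I) (q0 : J -> A)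
    (p : {ffun I -> A}) : {ffun J -> A} :=
  [ffun j => if r j is Some i then p i else q0 j].

(** Every map whose holomorphy is at stake below copies source coordinates and sets the remaining
    target coordinates to constants, so differentiability reduces to bookkeeping. *)
Definition aff (X Y : supergroup R) (f : X A -> Y A) :=
  exists r q0, forall x p, sg_coord x p -> sg_coord (f x) (pull r q0 p).

Lemma wnorm0 : wnorm (0 : A) = 0.
Proof. by rewrite /wnorm big1 // => i _; rewrite raddf0 normr0. Qed.

Lemma pnorm0 (I : finType) : pnorm (0 : {ffun I -> A}) = 0.
Proof. by rewrite /pnorm big1 // => i _; rewrite ffunE wnorm0. Qed.

Lemma pnorm_ge0 (I : finType) (p : {ffun I -> A}) : 0 <= pnorm p.
Proof. by apply: sumr_ge0 => i _; apply: sumr_ge0 => j _; exact: normr_ge0. Qed.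

(** The error term of the differential vanishes identically: the linear part copies the same
    coordinates and replaces the constants by 0. Any radius works, here 1. *)
Lemma aff_holo (X Y : supergroup R) (f : X A -> Y A) :
  aff f -> holo (@sg_coord R X A) (@sg_coord R Y A) f.
Proof.
move=> [r [q0 fa]] x p cx; exists (pull r q0 p); first exact: fa.
exists (fun u => [ffun j => if r j is Some i then u i else 0]).
  split=> [u v|a u a0]; apply/ffunP => j; rewrite !ffunE; case: (r j) => [i|];
    by rewrite ?ffunE ?addr0 ?mulr0.
move=> e e0; exists 1 => // x' p' cx' _; exists (pull r q0 p'); first exact: fa.
rewrite (_ : _ - _ = 0) ?pnorm0 ?mulr_ge0 ?pnorm_ge0 // ?ltW //.
apply/ffunP => j; rewrite !ffunE; case: (r j) => [i|]; last by rewrite !subrr.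
by rewrite !ffunE subrr.
Qed.

Lemma aff_ext (X Y : supergroup R) (f g : X A -> Y A) : f =1 g -> aff f -> aff g.
Proof.
by move=> fg [r [q0 fa]]; exists r, q0 => x p /fa; rewrite fg.
Qed.

Lemma aff_id (X : supergroup R) : aff (@id (X A)).
Proof.
exists Some, (fun=> 0) => x p cx; congr (sg_coord _ _): cx.
by apply/ffunP => j; rewrite ffunE.
Qed.

Lemma aff_comp (X Y Z : supergroup R) (f : X A -> Y A) (g : Y A -> Z A) :
  aff f -> aff g -> aff (g \o f).
Proof.
move=> [r [q0 fa]] [s [q1 ga]].
exists (fun k => obind r (s k)),
  (fun k => if s k is Some j then q0 j else q1 k) => x p /fa/ga.
congr (sg_coord _ _); apply/ffunP => k; rewrite !ffunE.
by case: (s k) => //= j; rewrite ffunE.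
Qed.

Lemma aff_cst (X Y : supergroup R) (y : Y A) (q : {ffun sg_ix Y -> A}) :
  sg_coord y q -> aff (fun _ : X A => y).
Proof.
move=> cy; exists (fun=> None), q => x p _; congr (sg_coord _ _): cy.
by apply/ffunP => k; rewrite ffunE.
Qed.

Lemma aff_fst (X Y : supergroup R) : aff (fst : sg_prod X Y A -> X A).
Proof.
exists (fun i => Some (inl i)), (fun=> 0) => x p [cx _].
by congr (sg_coord _ _): cx; apply/ffunP => i; rewrite !ffunE.
Qed.

Lemma aff_snd (X Y : supergroup R) : aff (snd : sg_prod X Y A -> Y A).
Proof.
exists (fun i => Some (inr i)), (fun=> 0) => x p [_ cx].
by congr (sg_coord _ _): cx; apply/ffunP => i; rewrite !ffunE.
Qed.

Lemma aff_pair (X Y Z : supergroup R) (f : X A -> Y A) (g : X A -> Z A) :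
  aff f -> aff g -> aff (fun x => (f x, g x) : sg_prod Y Z A).
Proof.
move=> [r [q0 fa]] [s [q1 ga]].
exists (fun k => match k with inl i => r i | inr i => s i end),
  (fun k => match k with inl i => q0 i | inr i => q1 i end) => x p cx.
by split; [move: (fa _ _ cx) | move: (ga _ _ cx)]; congr (sg_coord _ _);
  apply/ffunP => i; rewrite !ffunE.
Qed.

Lemma aff_proj (I : finType) (F : I -> supergroup R) (i : I) :
  aff (fun x : sg_bigprod F A => (x : big_pt F A) i).
Proof.
exists (fun c => Some (Tagged (fun i => sg_ix (F i) : Type) c)), (fun=> 0) => x p cx.
by congr (sg_coord _ _): (cx i); apply/ffunP => c; rewrite !ffunE.
Qed.

Lemma aff_big (X : supergroup R) (I : finType) (F : I -> supergroup R)
    (f : X A -> sg_bigprod F A) :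
  (forall i, aff (fun x => (f x : big_pt F A) i)) -> aff f.
Proof.
move=> /fin_all_exists [r] /fin_all_exists [q0 fa].
exists (fun c : {i : I & sg_ix (F i)} => r (tag c) (tagged c)),
  (fun c => q0 (tag c) (tagged c)) => x p cx i.
by congr (sg_coord _ _): (fa i x p cx); apply/ffunP => c; rewrite !ffunE.
Qed.

Lemma aff_val (X : supergroup R) (S : subsg X) :
  aff (fun x : sg_sub S A => val x : X A).
Proof.
exists Some, (fun=> 0) => x p cx; congr (sg_coord _ _): cx.
by apply/ffunP => j; rewrite ffunE.
Qed.

Lemma aff_sub (X Y : supergroup R) (S : subsg Y) (f : X A -> sg_sub S A) :
  aff (fun x => val (f x) : Y A) -> aff f.
Proof. by []. Qed.

Lemma aff_reindex (I J : finType) (r : J -> I) :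
  aff ((fun v => [ffun j => v (r j)] : {ffun J -> odd_of A}) :
         odd_affine I A -> odd_affine J A).
Proof.
by exists (fun j => Some (r j)), (fun=> 0) => x p cx j; rewrite !ffunE.
Qed.

End CoordinateAffine.

Section CoordinatesOfOne.
Variable R : realType.

(** [sg_coord] is a relation, so a constant map is affine only once its value is known to have
    coordinates. *)
Definition coord1 (X : supergroup R) :=
  forall A : weil R, exists q, sg_coord (1%g : X A) q.

Lemma aff_1 (X Y : supergroup R) A :
  coord1 Y -> aff (fun _ : X A => 1%g : Y A).
Proof. by move=> /(_ A) [q]; exact: aff_cst. Qed.

Lemma coord1_prod (X Y : supergroup R) : coord1 X -> coord1 Y -> coord1 (sg_prod X Y).
Proof.
move=> X1 Y1 A; have [q cq] := X1 A; have [q' cq'] := Y1 A.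
exists [ffun k => match k with inl i => q i | inr i => q' i end].
by split; [congr (sg_coord _ _): cq | congr (sg_coord _ _): cq'];
  apply/ffunP => i; rewrite !ffunE.
Qed.

Lemma coord1_Ga : coord1 (@Ga R).
Proof. by move=> A; exists [ffun=> 0]; rewrite /= ffunE; exact: esym (e2a0 A). Qed.

Lemma coord1_Gm : coord1 (@Gm R).
Proof. by move=> A; exists [ffun=> 1]; rewrite /= !ffunE e2a_1. Qed.

Lemma coord1_T3 : coord1 (@T3 R).
Proof.
exact: (coord1_prod (coord1_prod coord1_Ga coord1_Gm) coord1_Ga).
Qed.

Lemma coord1_SL2 : coord1 (@SL2 R).
Proof.
by move=> A; exists [ffun ij => e2a ((1%:M : 'M[even_of A]_2) ij.1 ij.2)] => i j;
  rewrite !ffunE.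
Qed.

Lemma coord1_odd (I : finType) : coord1 (@odd_affine R I).
Proof. by move=> A; exists [ffun=> 0] => i; rewrite !ffunE; exact: esym (o2a0 A). Qed.

Lemma coord1_big (I : finType) (F : I -> supergroup R) :
  (forall i, coord1 (F i)) -> coord1 (sg_bigprod F).
Proof.
move=> F1 A; have /fin_all_exists [q cq] := fun i => F1 i A.
exists [ffun c : {i : I & sg_ix (F i)} => q (tag c) (tagged c)] => i; rewrite ffunE.
by congr (sg_coord _ _): (cq i); apply/ffunP => c; rewrite !ffunE.
Qed.

End CoordinatesOfOne.

Section Isomorphisms.
Variables (R : realType).

Lemma lie_hom_of (G H : supergroup R) (f : forall A, G A -> H A) :
    (forall A, {morph f A : x y / (x * y)%g >-> (x * y)%g}) ->
    (forall A B (u : weil_hom A B) x, f B (sg_map u x) = sg_map u (f A x)) ->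
    (forall A, aff (f A)) ->
  {l : lie_hom G H | forall A, l A =1 f A}.
Proof.
move=> fM fN fA; exists (LieHom fM fN (fun A => aff_holo (fA A))).
by [].
Qed.

(** Multiplicativity and naturality of g follow from those of f by bijectivity; only the coordinate
    condition has to be checked in both directions. *)
Lemma lie_isom_of (G H : supergroup R) (f : forall A, G A -> H A)
    (g : forall A, H A -> G A) :
    (forall A, {morph f A : x y / (x * y)%g >-> (x * y)%g}) ->
    (forall A B (u : weil_hom A B) x, f B (sg_map u x) = sg_map u (f A x)) ->
    (forall A, cancel (f A) (g A)) -> (forall A, cancel (g A) (f A)) ->
    (forall A, aff (f A)) -> (forall A, aff (g A)) ->
  {l : lie_hom G H | lie_isom l & forall A, l A =1 f A}.
Proof.
move=> fM fN fK gK fA gA.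
have gM A : {morph g A : x y / (x * y)%g >-> (x * y)%g}.
  by move=> x y; apply: (can_inj (fK A)); rewrite fM !gK.
have gN A B (u : weil_hom A B) x : g B (sg_map u x) = sg_map u (g A x).
  by apply: (can_inj (fK B)); rewrite fN !gK.
have [l lf] := lie_hom_of fM fN fA; have [m mg] := lie_hom_of gM gN gA.
exists l => //; exists m => A; split=> x; rewrite lf mg; [exact: fK | exact: gK].
Qed.

End Isomorphisms.

Lemma ord3P (i : 'I_3) : [\/ i = i1, i = i2 | i = i3].
Proof.
by case: i => [[|[|[|//]]]] ilt; [constructor 1 | constructor 2 | constructor 3];
  apply: val_inj.
Qed.

Lemma sum3 (V : nmodType) (F : 'I_3 -> V) : \sum_i F i = F i1 + F i2 + F i3.
Proof.
rewrite !big_ord_recr big_ord0 /= add0r.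
by congr (F _ + F _ + F _); apply: val_inj.
Qed.

Lemma sum_eq0 (V : nmodType) (I : finType) (F : I -> V) :
  (forall i, F i = 0) -> \sum_i F i = 0.
Proof. by move=> F0; rewrite big1. Qed.

Lemma sum_sumType (V : nmodType) (I J : finType) (F : I + J -> V) :
  \sum_c F c = \sum_i F (inl i) + \sum_j F (inr j).
Proof. exact: big_sumType. Qed.

Lemma sum_unique (V : nmodType) (I : finType) (i0 : I) (F : I -> V) :
  (forall i, i != i0 -> F i = 0) -> \sum_i F i = F i0.
Proof. by move=> F0; rewrite (bigD1 i0) //= big1 // addr0. Qed.

Lemma prod3 (K : comNzRingType) (F : 'I_3 -> K) : \prod_i F i = F i1 * F i2 * F i3.
Proof.
rewrite !big_ord_recr big_ord0 /= mul1r.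
by congr (F _ * F _ * F _); apply: val_inj.
Qed.

Lemma prod3_distinct (K : comNzRingType) (i j k : 'I_3) (F : 'I_3 -> K) :
  i != j -> i != k -> j != k -> \prod_l F l = F i * F j * F k.
Proof.
move=> ij ik jk; rewrite prod3.
by case: (ord3P i) ij ik => ->; case: (ord3P j) jk => ->; case: (ord3P k) => -> //= *; ring.
Qed.

(** * The structure constants of ghat(sigma) in terms of weights *)

Section Weights.

(* The odd part of ghat(sigma) is the outer tensor product of three copies of *)
(* the tautological module. The l-th tensor factor of the basis vector a is   *)
(* the lowest weight vector when minus a l holds, and the highest one         *)
(* otherwise: theta = (+,+,+), beta_1 = (-,+,+), - beta_1 = (+,-,-), etc.     *)
Definition minus (a : od_gen) (l : 'I_3) : bool := ~~ a.1 (+) (a.2 == Some l).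
Definition bit (b : bool) : 'I_2 := if b then ord_max else ord0.
Definition wt (a : od_gen) : {ffun 'I_3 -> bool} := [ffun l => minus a l].

Lemma wt_inj : injective wt.
Proof.
move=> [s o] [t p] /ffunP e; have := (e i1, e i2, e i3); rewrite !ffunE /minus /=.
case: o {e} => [i|]; case: p => [j|]; try case: (ord3P i) => ->;
  try case: (ord3P j) => ->; by case: s; case: t => -[[]].
Qed.

Lemma wt_bij : bijective wt.
Proof.
apply: inj_card_bij; first exact: wt_inj.
by rewrite card_ffun card_prod card_option card_bool !card_ord.
Qed.

(** The default value is never reached, because [wt] is onto. *)
Definition unwt (f : {ffun 'I_3 -> bool}) : od_gen :=
  odflt (true, None) [pick a | wt a == f].

Lemma unwtK : cancel unwt wt.
Proof.
move=> f; rewrite /unwt; case: pickP => [a /eqP //|].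
by have [g gK wK] := wt_bij => /(_ (g f)); rewrite wK eqxx.
Qed.

(** In the l-th copy of sl_2, e and f send a basis vector either to 0 or to its flip. *)
Definition flip (l : 'I_3) (a : od_gen) : od_gen :=
  unwt [ffun m => (m == l) (+) minus a m].

Lemma minus_inj a b : (forall l, minus a l = minus b l) -> a = b.
Proof. by move=> e; apply: wt_inj; apply/ffunP => l; rewrite !ffunE. Qed.

Lemma minus_unwt f l : minus (unwt f) l = f l.
Proof. by have /ffunP/(_ l) := unwtK f; rewrite ffunE. Qed.

Lemma minus_flip l a m : minus (flip l a) m = (m == l) (+) minus a m.
Proof. by rewrite minus_unwt ffunE. Qed.

Lemma flipK l : involutive (flip l).
Proof. by move=> a; apply: minus_inj => m; rewrite !minus_flip addKb. Qed.

Lemma flip_neq l a : (flip l a == a) = false.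
Proof.
by apply/eqP => /(congr1 (minus^~ l)); rewrite minus_flip eqxx; case: minus.
Qed.

Definition agree (l : 'I_3) (a b : od_gen) : bool :=
  [forall m, (m != l) ==> (minus a m == minus b m)].

Lemma agreeP l a b :
  reflect (forall m, m != l -> minus a m = minus b m) (agree l a b).
Proof.
apply: (iffP forallP) => [h m ml|h m]; first by have := h m; rewrite ml => /eqP.
by apply/implyP => /h ->.
Qed.

Lemma agreeE l a b : agree l a b = (a == b) || (a == flip l b).
Proof.
apply/agreeP/orP => [h|[/eqP -> //|/eqP -> m /negPf ml]]; last first.
  by rewrite minus_flip ml.
have [e|ne] := eqVneq (minus a l) (minus b l); [left|right]; apply/eqP/minus_inj => m.
  by have [->|/h] := eqVneq m l.
rewrite minus_flip; have [->|/h //] := eqVneq m l.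
by move: ne; case: minus; case: minus.
Qed.

Lemma bit_eq b c : (bit b == bit c) = (b == c).
Proof. by case: b; case: c. Qed.

Lemma bitK (i : 'I_2) : bit (i != ord0) = i.
Proof. by case: i => [[|[|//]]] ilt; apply: val_inj. Qed.

Lemma sum_bit (V : nmodType) (F : 'I_2 -> V) :
  \sum_i F i = \sum_(b : bool) F (bit b).
Proof.
rewrite (reindex bit) //; exists (fun i => i != ord0) => i _; last exact: bitK.
by case: i.
Qed.

(** Distributivity of a product over sums. It turns a matrix product of tensor products into the
    tensor product of the matrix products. *)
Lemma sum_tensor (K : comNzRingType) (F : 'I_3 -> 'I_2 -> K) :
  \sum_a \prod_l F l (bit (minus a l)) = \prod_l \sum_k F l k.
Proof.
under [RHS]eq_bigr => l _ do rewrite sum_bit.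
rewrite bigA_distr_bigA /= (reindex wt) /=; last first.
  by apply: onW_bij; exact: wt_bij.
by apply: eq_bigr => a _; apply: eq_bigr => l _; rewrite ffunE.
Qed.

Lemma prod_agree (K : comNzRingType) (a b : od_gen) :
  (\prod_l (minus a l == minus b l)%:R : K) = (a == b)%:R.
Proof.
have [->|ab] := eqVneq a b; first by rewrite big1 // => l _; rewrite eqxx.
have [l /negPf abl] : exists l, minus a l != minus b l.
  have [l abl|e] := pickP (fun l => minus a l != minus b l); first by exists l.
  case/eqP: ab; apply: minus_inj => l.
  by have /negbFE/eqP := e l.
by rewrite (bigD1 l) //= abl mul0r.
Qed.

(** One sign triple is turned into another by correcting the three signs one at a time. This is the
    combinatorial core of irreducibility. *)
Lemma flip_connected (Q : od_gen -> Prop) :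
  (forall l a, Q a -> Q (flip l a)) -> forall a b, Q a -> Q b.
Proof.
move=> Qf a b Qa.
pose c l x := if minus x l == minus b l then x else flip l x.
have Qc l x : Q x -> Q (c l x).
  by rewrite /c; case: ifP => // _; exact: Qf.
have -> : b = c i1 (c i2 (c i3 a)).
  have cE l x m : minus (c l x) m = if m == l then minus b l else minus x m.
    rewrite /c; case: (eqVneq m l) => [->|ml].
      case: ifPn => [/eqP //|]; rewrite minus_flip eqxx.
      by case: minus; case: minus.
    by case: ifP => // _; rewrite minus_flip (negPf ml).
  by apply: minus_inj => m; rewrite !cE; case: (ord3P m) => ->.
by do 3!apply: (Qc).
Qed.

End Weights.

Section StructureConstants.
Variables (R : realType) (sigma : 'I_3 -> CC R).
Hypothesis sigmaV : \sum_i sigma i = 0.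

Lemma ev_sigmaM p q : ev_sigma sigma (p * q) = ev_sigma sigma p * ev_sigma sigma q.
Proof. by rewrite /ev_sigma !hornerM. Qed.

Lemma ev_sigmaN p : ev_sigma sigma (- p) = - ev_sigma sigma p.
Proof. by rewrite /ev_sigma !hornerN. Qed.

Lemma ev_sigma0 : ev_sigma sigma 0 = 0.
Proof. by rewrite /ev_sigma !horner0. Qed.

Lemma ev_sigma1 : ev_sigma sigma 1 = 1.
Proof. by rewrite /ev_sigma !hornerC. Qed.

Lemma ev_sigma_nat n : ev_sigma sigma n%:R = n%:R.
Proof.
by elim: n => [|n IH]; rewrite ?ev_sigma0 // -natr1 /ev_sigma !hornerD -/(ev_sigma _ _)
  IH -[_ + _]/(_ + ev_sigma sigma 1) ev_sigma1 natr1.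
Qed.

Lemma ev_sigma_xv i : ev_sigma sigma (xv R i) = sigma i.
Proof.
have s3 : sigma i3 = - (sigma i1 + sigma i2).
  by apply/eqP; rewrite -addr_eq0 addrC -sum3 sigmaV.
by case: (ord3P i) => ->; rewrite /ev_sigma /xv /= ?s3
  !(hornerN, hornerD, hornerX, hornerC).
Qed.

(** In terms of signs the whole bracket table collapses: the l-th sign is flipped if it can be
    raised (s true) or lowered (s false), and the result is 0 otherwise. *)
Lemma br01_ef l s b : br01 R (l, Some s) b =
  if minus b l == s then xv R l *: bas R (inr (flip l b)) else 0.
Proof.
have someE (x y : 'I_3) : (Some x == Some y) = (y == x).
  by apply/eqP/eqP => [[]|->].
have flipE c : (forall m, minus c m = (m == l) (+) minus b m) -> flip l b = c.
  by move=> e; apply: minus_inj => m; rewrite minus_flip e.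
case: b flipE => t [j|] flipE; last first.
  rewrite (flipE (t, Some l)) => [|m]; last first.
    by clear flipE; rewrite /minus /= !someE; case: t; case: (m == l).
  by clear flipE; case: s; case: t.
have [lj|lj] := eqVneq l j.
  rewrite {}lj in flipE *; rewrite (flipE (t, None)) => [|m]; last first.
    by clear flipE; rewrite /minus /= !someE; case: t; case: (m == j).
  have F k : third j j k = false by rewrite /third eqxx.
  clear flipE; rewrite /br01; case: s; case: t; rewrite /minus /= ?someE eqxx //.
  - by rewrite mul1r.
  - by rewrite big_pred0.
  - by rewrite big_pred0.
  - by rewrite mul1r.
(* For l different from j, the sum in the bracket has exactly one term, at the third index. *)
have [k tk] : exists k, third l j k.
  by case: (ord3P l) lj => ->; case: (ord3P j) => -> //= _;
    [exists i3|exists i2|exists i3|exists i1|exists i2|exists i1].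
have tE m : third l j m = (m == k).
  by move: tk lj; case: (ord3P l) => ->; case: (ord3P j) => ->; case: (ord3P k) => ->;
    case: (ord3P m) => ->.
rewrite (flipE (~~ t, Some k)) => [|m]; last first.
  move: tk {flipE tE}; case: (ord3P l) => ->; case: (ord3P j) => ->; case: (ord3P k) => -> //;
    by case: (ord3P m) => ->; case: t.
have F (G : 'I_3 -> gx R) : \sum_(m | third l j m) G m = G k.
  by rewrite (eq_bigl (pred1 k)) ?big_pred1_eq.
clear flipE tE; rewrite /br01; case: s; case: t; rewrite /minus /= someE (negPf lj) ?F //.
- by rewrite mul0r scale0r.
- by rewrite mul0r scale0r.
Qed.

Lemma br01_h l b : br01 R (l, None) b =
  if minus b l then (- xv R l) *: bas R (inr b) else xv R l *: bas R (inr b).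
Proof.
case: b => [t [j|]]; rewrite /br01 /minus /=; last first.
  by case: t; rewrite /= ?mulN1r ?mul1r.
have -> : (Some j == Some l) = (l == j) by apply/eqP/eqP => [[]|->].
case: t; case: (l == j) => /=.
- by rewrite mul1r mulN1r.
- by rewrite !mul1r.
- by rewrite mulN1r opprK mul1r.
- by rewrite mulr1 mulN1r.
Qed.

Lemma hat_coef01 u b c : hat_coef R (inl u) (inr b) c = br01 R u b c.
Proof. exact: mul1r. Qed.

Lemma ghat_br_ef l s a b :
  ghat_br sigma (inl (l, Some s)) (inr b) (inr a) =
  sigma l * ((minus b l == s) && (a == flip l b))%:R.
Proof.
rewrite ffunE hat_coef01 br01_ef.
case: eqP => _; last by rewrite ffunE ev_sigma0 mulr0.
by rewrite !ffunE ev_sigmaM ev_sigma_xv ev_sigma_nat.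
Qed.

Lemma ghat_br_h l a b :
  ghat_br sigma (inl (l, None)) (inr b) (inr a) =
  sigma l * ((-1) ^+ minus b l * (a == b)%:R).
Proof.
rewrite ffunE hat_coef01 br01_h.
case: minus; rewrite !ffunE ev_sigmaM ?ev_sigmaN ev_sigma_xv ev_sigma_nat.
  by rewrite expr1 mulN1r mulrN mulNr.
by rewrite expr0 mul1r.
Qed.

Lemma ghat_br01_parity u b e : ghat_br sigma (inl u) (inr b) (inl e) = 0.
Proof. by rewrite ffunE /hat_coef gx_br_parity // mulr0 ev_sigma0. Qed.

End StructureConstants.

(** * The adjoint action as a tensor product of 2x2 matrices *)

Section FactorMatrix.
Variable R : realType.

(* The action on the tautological module of sl_2, where T3 acts trivially. *)
Definition factor_mx (b : bool) (A : weil R) : factor R b A -> 'M[even_of A]_2 :=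
  match b return factor R b A -> 'M[even_of A]_2 with
  | true => fun _ => 1%:M
  | false => fun g => val (g : sl2g (even_of A))
  end.

Lemma factor_mxM b A (g h : factor R b A) :
  factor_mx (g * h)%g = factor_mx g *m factor_mx h.
Proof. by case: b g h => g h //=; rewrite mulmx1. Qed.

Lemma factor_mx1 b A : factor_mx (1%g : factor R b A) = 1%:M.
Proof. by case: b. Qed.

(** The element s (zp e + zh h + zm f) of sl_2. It is 0 for s = 0, in accordance with the trivial
    action of an Abelian factor, which allows uniform formulas. *)
Definition slmx (s zp zh zm : CC R) : 'M[CC R]_2 :=
  s *: \matrix_(i < 2, j < 2) if i == j then (if i == ord0 then zh else - zh)
                              else (if i == ord0 then zp else zm).

Lemma nexp_inv (A : weil R) (n : even_of A) z :
  n * n = 0 -> nexp n z * nexp n (- z) = 1.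
Proof.
move=> nn; rewrite !nexp_sq // mulrDl !mulrDr !mul1r mulr1.
by rewrite -scalerAl -scalerAr nn !scaler0 addr0 scaleNr addrNK.
Qed.

Lemma det_nexpmx (A : weil R) (n : even_of A) s zp zh zm :
  n * n = 0 -> \det (nexpmx n (slmx s zp zh zm)) = 1.
Proof.
move=> nn; rewrite det_mx2 !nexpmx_sq // !mxE /=.
rewrite !(mulr0n, mulr1n, add0r) mulrN scaleNr mulrDl !mulrDr !mul1r mulr1.
rewrite !mulrN -!scalerAl -!scalerAr nn !scaler0 subr0 oppr0 addr0.
by rewrite addrNK.
Qed.

Lemma factor_mx_exp (b : bool) (s : CC R) (A : weil R) (n : even_of A) zp zh zm i j :
    (b -> s = 0) -> n * n = 0 ->
  factor_mx (factor_exp b s n zp zh zm) i j =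
    (i == j)%:R + slmx s zp zh zm i j *: n.
Proof.
case: b => bs nn; first by rewrite bs // !mxE mul0r scale0r addr0.
by rewrite /= /SL2_exp val_insubd /= det_nexpmx // eqxx nexpmx_sq.
Qed.

Lemma nexp0z (A : weil R) (n : even_of A) k : n ^+ k = 0 -> nexp n 0 = 1.
Proof.
move=> nk; have : n ^+ nilidx n = 0.
  by rewrite /nilidx; case: xgetP => [m _ //|/(_ k)].
(* [nilidx n] cannot be 0, since n ^+ 0 = 1; so the sum does contain its constant term. *)
rewrite /nexp; case: (nilidx n) => [/eqP|m _]; first by rewrite expr0 oner_eq0.
rewrite big_ord_recl big1 => [|j _]; last by rewrite expr0n /= mul0r scale0r.
by rewrite !expr0 divr1 scale1r addr0.
Qed.

Lemma nexpmx0 (A : weil R) (n : even_of A) k : n ^+ k = 0 -> nexpmx n 0 = 1%:M.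
Proof.
move=> nk; have nm : n ^+ nilidx n = 0.
  by rewrite /nilidx; case: xgetP => [m _ //|/(_ k)].
apply/matrixP => i j; rewrite !mxE.
move: nm; case: (nilidx n) => [/eqP|m _]; first by rewrite expr0 oner_eq0.
rewrite big_ord_recl big1 => [|l _]; last by rewrite expr0n /= mxE mul0r scale0r.
by rewrite !expr0 mxE divr1 addr0; case: eqP; rewrite ?scale1r ?scale0r.
Qed.

Lemma slmx0 s : slmx s 0 0 0 = 0.
Proof.
by apply/matrixP => i j; rewrite !mxE oppr0; do ![case: ifP => _]; rewrite mulr0.
Qed.

Lemma factor_exp0 b s (A : weil R) (n : even_of A) k :
  n ^+ k = 0 -> factor_exp b s n 0 0 0 = 1%g.
Proof.
move=> nk; case: b => /=.
  rewrite /T3_exp !scale0r; congr (_, _, _).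
  by apply: val_inj; rewrite /= val_insubd oppr0 (nexp0z nk) /= mulr1 eqxx.
apply: val_inj; rewrite /= val_insubd -/(slmx _ _ _ _) slmx0 (nexpmx0 nk).
by rewrite det1 eqxx.
Qed.

End FactorMatrix.

Section Adjoint.
Variables (R : realType) (sigma : 'I_3 -> CC R).
Hypothesis sigmaV : \sum_i sigma i = 0.

Definition Ahat_mx A (g : Ghat sigma A) (l : 'I_3) : 'M[even_of A]_2 :=
  factor_mx ((g : big_pt (Ahat sigma) A) l).

Lemma ad_efE s l a b : sigma l != 0 ->
  ad_ef sigma s l a b = ((minus b l == s) && (a == flip l b))%:R.
Proof. by move=> l0; rewrite /ad_ef ghat_br_ef // mulKf. Qed.

(** The combination EF, E, F, FE weighted by the entries of a 2x2 matrix is that matrix acting in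
    the l-th tensor factor and by the identity elsewhere; [agree] expresses the latter. *)
Lemma Ghat_Ad_iE A (g : Ghat sigma A) l a b :
  Ghat_Ad_i g l a b =
    (agree l a b)%:R * Ahat_mx g l (bit (minus a l)) (bit (minus b l)).
Proof.
rewrite /Ghat_Ad_i /Ahat_mx agreeE.
have l0 : sigma l == 0 \/ sigma l != 0 by case: (sigma l == 0); [left|right].
have EF : sigma l != 0 -> forall s a b,
    ad_ef sigma s l a b = ((minus b l == s) && (a == flip l b))%:R.
  by move=> ? *; exact: ad_efE.
(* The type of [g l] depends on the boolean [sigma l == 0], so [g l] is generalised before the case
   analysis. *)
move: EF (g l) => {l0}; rewrite /Ahat; case: (sigma l == 0) => [_|/(_ isT) EF] gl /=.
  rewrite mxE bit_eq; have [->|ab] := eqVneq a b; first by rewrite eqxx mulr1.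
  have [->|] := eqVneq a (flip l b); last by rewrite mul0r.
  by rewrite minus_flip eqxx; case: minus; rewrite mulr0.
(* EF and FE are the projections onto the vectors with l-th sign plus and minus, while E^2 = F^2 =
   0. *)
have mm s t : \sum_k ad_ef sigma s l a k * ad_ef sigma t l k b =
    ((minus b l == t) && (s == ~~ t) && (a == b))%:R.
  rewrite (sum_unique (i0 := flip l b)) => [|k /negPf kb]; last first.
    by rewrite !EF kb andbF mulr0.
  rewrite !EF flipK eqxx minus_flip eqxx andbT -natrM mulnb; congr ((nat_of_bool _)%:R).
  by case: s; case: t; case: minus; rewrite /= ?andbT ?andbF.
rewrite /SL2_Ad !mm !EF /=.
have [->|ab] := eqVneq a b.
  rewrite [b == _]eq_sym flip_neq !andbF !andbT !scale0r !addr0 mul1r.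
  by case: minus; rewrite /= ?scale0r ?scale1r ?add0r ?addr0.
rewrite !andbF !scale0r add0r addr0 /=.
have [->|] := eqVneq a (flip l b); last by rewrite !andbF !scale0r mul0r addr0.
rewrite !andbT minus_flip eqxx mul1r.
by case: minus; rewrite /= ?scale0r ?scale1r ?add0r ?addr0.
Qed.

(** The three operators act on different tensor factors, so only one pair of intermediate vectors
    contributes to the double sum: b takes its first sign from d, c its first two, and the other
    signs come from a. *)
Lemma Ghat_AdE A (g : Ghat sigma A) a d :
  Ghat_Ad g a d = \prod_l Ahat_mx g l (bit (minus a l)) (bit (minus d l)).
Proof.
pose mix f : od_gen := unwt [ffun l => if f l then minus d l else minus a l].
pose b := mix (pred1 i1); pose c := mix (fun l => l != i3).
have bE l : minus b l = if l == i1 then minus d l else minus a l.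
  by rewrite minus_unwt ffunE.
have cE l : minus c l = if l != i3 then minus d l else minus a l.
  by rewrite minus_unwt ffunE.
rewrite /Ghat_Ad (sum_unique (i0 := b)); first rewrite (sum_unique (i0 := c)); first last.
- move=> e eb; apply: big1 => f _; rewrite !Ghat_Ad_iE.
  have [ae|] := boolP (agree i1 a e); last by rewrite !mul0r.
  have [ef|] := boolP (agree i2 e f); last by rewrite mul0r mulr0 mul0r.
  have [fd|] := boolP (agree i3 f d); last by rewrite mul0r mulr0.
  case/eqP: eb; apply: minus_inj => l; rewrite bE.
  move/agreeP: ae => ae; move/agreeP: ef => ef; move/agreeP: fd => fd.
  by case: (ord3P l) => -> /=; [rewrite ef // fd | rewrite ae | rewrite ae].
- move=> f fc; rewrite !Ghat_Ad_iE.
  have [ae|] := boolP (agree i1 a b); last by rewrite !mul0r.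
  have [ef|] := boolP (agree i2 b f); last by rewrite mul0r mulr0 mul0r.
  have [fd|] := boolP (agree i3 f d); last by rewrite mul0r mulr0.
  case/eqP: fc; apply: minus_inj => l; rewrite cE.
  move/agreeP: ef => ef; move/agreeP: fd => fd.
  by case: (ord3P l) => -> /=; [rewrite fd | rewrite fd | rewrite -ef // bE].
have a1 : agree i1 a b by apply/agreeP => m /negPf m1; rewrite bE m1.
have a2 : agree i2 b c.
  by apply/agreeP => m m2; rewrite bE cE; case: (ord3P m) m2 => ->.
have a3 : agree i3 c d by apply/agreeP => m m3; rewrite cE m3.
by rewrite !Ghat_Ad_iE a1 a2 a3 !mul1r prod3 !(bE, cE).
Qed.

Lemma Ahat_mxM A (g h : Ghat sigma A) l :
  Ahat_mx (g * h)%g l = Ahat_mx g l *m Ahat_mx h l.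
Proof. by rewrite /Ahat_mx ffunE factor_mxM. Qed.

Lemma Ahat_mx1 A l : Ahat_mx (1%g : Ghat sigma A) l = 1%:M.
Proof. by rewrite /Ahat_mx ffunE factor_mx1. Qed.

Lemma Ghat_AdM A (g h : Ghat sigma A) a d :
  Ghat_Ad (g * h)%g a d = \sum_c Ghat_Ad g a c * Ghat_Ad h c d.
Proof.
rewrite Ghat_AdE.
under eq_bigr => l _ do rewrite Ahat_mxM mxE.
rewrite -sum_tensor; apply: eq_bigr => c _.
by rewrite !Ghat_AdE -big_split.
Qed.

Lemma Ghat_Ad1 A a d : Ghat_Ad (1%g : Ghat sigma A) a d = (a == d)%:R.
Proof.
rewrite Ghat_AdE -prod_agree; apply: eq_bigr => l _.
by rewrite Ahat_mx1 mxE bit_eq.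
Qed.

(** The matrix of ad(Z) on g_1, as a sum over the tensor factors; [adZ_ghat_br] compares it with the
    structure constants. *)
Definition adZ (Z : {ffun ev_gen -> (CC R)^o}) (a b : od_gen) : CC R :=
  \sum_l (agree l a b)%:R *
    slmx (sigma l) (Z (l, Some true)) (Z (l, None)) (Z (l, Some false))
      (bit (minus a l)) (bit (minus b l)).

Lemma Ahat_mx_exp A (n : even_of A) Z l i j : n * n = 0 ->
  Ahat_mx (Ghat_exp sigma n Z) l i j = (i == j)%:R +
    slmx (sigma l) (Z (l, Some true)) (Z (l, None)) (Z (l, Some false)) i j *: n.
Proof.
move=> nn; rewrite /Ahat_mx ffunE factor_mx_exp //.
by move=> /eqP.
Qed.

Lemma agree_prod (K : comNzRingType) (a b : od_gen) l :
  (\prod_(m | m != l) (minus a m == minus b m)%:R : K) = (agree l a b)%:R.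
Proof.
have [/agreeP ab|] := boolP (agree l a b).
  by rewrite big1 // => m /ab ->; rewrite eqxx.
rewrite negb_forall => /existsP[m]; rewrite negb_imply => /andP[ml /negPf ab].
by rewrite (bigD1 m) //= ab mul0r.
Qed.

Lemma prod_sq0 (K : comNzRingType) (x y : 'I_3 -> K) n : n * n = 0 ->
  \prod_l (x l + y l * n) =
    \prod_l x l + (\sum_l y l * \prod_(m | m != l) x m) * n.
Proof.
move=> nn; rewrite sum3 !(prod3 x, prod3 (fun l => x l + _)).
do 3!rewrite [\prod_(m | m != _) _]big_mkcond prod3 /=.
(* The terms of degree at least 2 in n, divided by n^2, are added with the factor n * n = 0; the
   identity is then polynomial. *)
rewrite -[RHS]addr0 -(mulr0 (y i1 * y i2 * x i3 + y i1 * x i2 * y i3 +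
  x i1 * y i2 * y i3 + y i1 * y i2 * y i3 * n)) -nn.
by ring.
Qed.

(** To first order a tensor product of matrices 1 + n M_l differs from the identity by the sum of
    the M_l, each acting in its own factor. *)
Lemma Ghat_Ad_exp A (n : even_of A) Z a d : n * n = 0 ->
  Ghat_Ad (Ghat_exp sigma n Z) a d = (a == d)%:R + adZ Z a d *: n.
Proof.
move=> nn; rewrite Ghat_AdE.
under eq_bigr => l _ do rewrite Ahat_mx_exp // bit_eq -[n in X in _ + X]mul1r scalerAl.
rewrite prod_sq0 // prod_agree; congr (_ + _).
under eq_bigr => l _ do rewrite agree_prod -scalerAl mul1r.
rewrite mulr_suml /adZ scaler_suml; apply: eq_bigr => l _.
by rewrite -scalerAl !mulr_natl -scalerMnl scalerMnr.
Qed.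

Lemma sum_ev (V : nmodType) (F : ev_gen -> V) : \sum_p F p =
  \sum_l (F (l, None) + (F (l, Some true) + F (l, Some false))).
Proof.
transitivity (\sum_l \sum_o F (l, o)).
  by rewrite pair_bigA; apply: eq_bigr => -[].
apply: eq_bigr => l _.
rewrite (bigD1 None) //= (bigD1 (Some true)) //= (bigD1 (Some false)) //=.
by rewrite big1 ?addr0 // => -[[]|].
Qed.

Lemma lbrE (u v : {ffun ev_gen + od_gen -> (CC R)^o}) c :
  lbr (P := Ghat_pair sigma) u v c =
  \sum_a \sum_b u a * v b * ghat_br sigma a b c :> CC R.
Proof.
rewrite /lbr sum_ffunE; apply: eq_bigr => a _; rewrite sum_ffunE.
by apply: eq_bigr => b _; rewrite ffunE.
Qed.

Lemma lbr_even_odd (Z : {ffun ev_gen -> (CC R)^o}) (Y : {ffun od_gen -> (CC R)^o}) c :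
  lbr (P := Ghat_pair sigma) (ev_incl (P := Ghat_pair sigma) Z)
      (od_incl (P := Ghat_pair sigma) Y) c =
  \sum_p \sum_b Z p * Y b * ghat_br sigma (inl p) (inr b) c :> CC R.
Proof.
rewrite lbrE sum_sumType [X in _ + X]sum_eq0 ?addr0 => [|d]; last first.
  by rewrite sum_eq0 // => e; rewrite ffunE !mul0r.
apply: eq_bigr => u _; rewrite sum_sumType [X in X + _]sum_eq0 ?add0r => [|d]; last first.
  by rewrite [X in _ * X * _]ffunE mulr0 mul0r.
by apply: eq_bigr => b _; rewrite !ffunE.
Qed.

Lemma adZ_ghat_br (Z : {ffun ev_gen -> (CC R)^o}) a b :
  adZ Z a b = \sum_p Z p * ghat_br sigma (inl p) (inr b) (inr a).
Proof.
rewrite sum_ev; apply: eq_bigr => l _; rewrite ghat_br_h // !ghat_br_ef // !mxE.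
rewrite agreeE bit_eq; have [->|ab] := eqVneq a b.
  rewrite [b == _]eq_sym flip_neq eqxx !andbF !mulr0 !addr0 mul1r mulrCA.
  by case: minus; rewrite /= ?expr1 ?expr0 !mulr1 ?mulrN1.
have [->|_] := eqVneq a (flip l b); last first.
  by rewrite !andbF !mulr0 !addr0 mul0r.
rewrite minus_flip eqxx !andbT mul1r !mulr0 add0r.
by case: minus; rewrite /= !mulr0 mulr1 ?addr0 ?add0r mulrC.
Qed.

Lemma lbr_adZ (Z : {ffun ev_gen -> (CC R)^o}) (Y : {ffun od_gen -> (CC R)^o}) :
  lbr (P := Ghat_pair sigma) (ev_incl (P := Ghat_pair sigma) Z)
      (od_incl (P := Ghat_pair sigma) Y) =
  od_incl (P := Ghat_pair sigma) [ffun a => \sum_b adZ Z a b * Y b].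
Proof.
apply/ffunP => -[e|a]; rewrite lbr_even_odd [RHS]ffunE.
  rewrite sum_eq0 // => p; rewrite sum_eq0 // => b.
  by rewrite ghat_br01_parity mulr0.
rewrite ffunE; under [RHS]eq_bigr => b _ do rewrite adZ_ghat_br mulr_suml.
rewrite exchange_big /=; apply: eq_bigr => p _.
by apply: eq_bigr => b _; rewrite mulrAC.
Qed.

End Adjoint.

(** * The presented groups and their semidirect decomposition *)

Section PresentedLift.
Variables (T : choiceType) (rel : seq T -> seq T -> Prop) (H : groupType).
Variable f : T -> H.
Hypothesis frel : forall u v, rel u v ->
  (\prod_(x <- u) f x = \prod_(x <- v) f x)%g.

Definition wval (w : seq (bool * T)) : H :=
  (\prod_(a <- w) if a.1 then f a.2 else (f a.2)^-1)%g.

Definition pres_lift (x : presg rel) : H := wval (repr x).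

Lemma wval_rel u v : wrel rel u v -> wval u = wval v.
Proof.
elim=> {u v} [//|u v _ -> //|u v w _ -> _ -> //|u u' v v' _ uu _ vv|b x|u v /frel uv].
- by rewrite /wval !big_cat; congr (_ * _)%g.
- by rewrite /wval !big_cons big_nil mulg1; case: b; rewrite /= ?mulgV ?mulVg.
- by rewrite /wval /pos !bigop.big_map.
Qed.

Lemma pres_liftE u : pres_lift (wclass rel u) = wval u.
Proof. exact/wval_rel/wrel_repr. Qed.

Lemma pres_liftM : {morph pres_lift : x y / (x * y)%g >-> (x * y)%g}.
Proof.
move=> x y; have [u ->] := wrepr x; have [v ->] := wrepr y.
by rewrite -[(_ * _)%g in LHS]/(pres_mul _ _) pres_mulE !pres_liftE /wval big_cat.
Qed.

Lemma pres_lift_gen x : pres_lift (pgen rel x) = f x.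
Proof. by rewrite pres_liftE /wval big_seq1. Qed.

End PresentedLift.

Lemma presg_ind (T : choiceType) (rel : seq T -> seq T -> Prop)
    (S : presg rel -> Prop) :
    S 1%g -> (forall x y, S x -> S y -> S (x * y)%g) ->
    (forall x, S x -> S (x^-1)%g) -> (forall x, S (pgen rel x)) ->
  forall x, S x.
Proof.
move=> S1 SM SV SG x; have [u ->] := wrepr x.
elim: u => [|[b t] u IHu]; first exact: S1.
rewrite -cat1s -pres_mulE; apply: (SM) => //.
case: b; first exact: SG.
by have := SV _ (SG t); rewrite -[(_^-1)%g]/(pres_inv _) pres_invE.
Qed.

Section Relations.
Variables (R : realType) (P : shcp R) (A : weil R).

Lemma pgen_cat (T : choiceType) (rel : seq T -> seq T -> Prop) (u : seq T) :
  wclass rel (pos u) = (\prod_(x <- u) pgen rel x)%g.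
Proof.
elim: u => [|x u IHu]; first by rewrite big_nil.
by rewrite big_cons -IHu -[RHS]/(pres_mul _ _) pres_mulE.
Qed.

Lemma gp_relE u v : gp_rel u v ->
  (\prod_(x <- u) pgen (@gp_rel R P A) x = \prod_(x <- v) pgen (@gp_rel R P A) x)%g.
Proof. by move=> uv; rewrite -!pgen_cat; apply/wclassP/wrel_rel. Qed.

Lemma gp_oddD i (eta eta' : odd_of A) : (gp_odd i eta * gp_odd i eta' =
  gp_grp (hexp P (omul eta' eta) (2^-1 *: hbr11 i i)) * gp_odd i (eta + eta') :> gp_pt P A)%g.
Proof. by have := gp_relE (gp_rel_sq i eta eta'); rewrite !big_cons !big_nil !mulg1. Qed.

Lemma gp_oddC i j (eta eta' : odd_of A) : (gp_odd i eta * gp_odd j eta' =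
  gp_grp (hexp P (omul eta' eta) (hbr11 i j)) * (gp_odd j eta' * gp_odd i eta)
  :> gp_pt P A)%g.
Proof. by have := gp_relE (gp_rel_comm i j eta eta'); rewrite !big_cons !big_nil !mulg1. Qed.

Lemma gp_odd_grp i (eta : odd_of A) (g : hG P A) : (gp_odd i eta * gp_grp g =
  gp_grp g * gp_oddprod [ffun j => eact (hAd P (g^-1) j i) eta])%g.
Proof.
have := gp_relE (gp_rel_Ad g i eta).
rewrite !big_cons big_nil mulg1 bigop.big_map => ->; congr (_ * _)%g.
by apply: eq_bigr => j _; rewrite ffunE.
Qed.

Lemma gp_ind (S : gp_pt P A -> Prop) :
    S 1%g -> (forall x y, S x -> S y -> S (x * y)%g) ->
    (forall x, S x -> S (x^-1)%g) ->
    (forall g, S (gp_grp g)) -> (forall i eta, S (gp_odd i eta)) ->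
  forall x, S x.
Proof.
move=> S1 SM SV SG SO; apply: presg_ind => // -[g|[i eta]]; [exact: SG|exact: SO].
Qed.

Hypothesis hexp0 : forall Z, hexp P (0 : even_of A) Z = 1%g.

(** With both parameters 0, the square relation makes this element idempotent. *)
Lemma gp_odd0 i : gp_odd i (0 : odd_of A) = 1%g :> gp_pt P A.
Proof.
have := gp_oddD i 0 0; rewrite omul0l hexp0 gp_grp1 mul1g addr0.
by move/(canRL (mulgK _)); rewrite mulgV.
Qed.

Lemma gp_oddprod0 : gp_oddprod (0 : {ffun hO P -> odd_of A}) = 1%g.
Proof. by rewrite /gp_oddprod big1 // => i _; rewrite ffunE gp_odd0. Qed.

Lemma gp_oddprod_single i (eta : odd_of A) :
  gp_oddprod [ffun j => if j == i then eta else 0] = gp_odd i eta :> gp_pt P A.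
Proof.
rewrite /gp_oddprod.
have: uniq (enum (hO P)) := enum_uniq _; have: i \in enum (hO P) by rewrite mem_enum.
elim: (enum _) => //= j s IHs; rewrite in_cons big_cons ffunE => is_ /andP[js us].
have [ji|ji] := eqVneq j i; last first.
  by rewrite gp_odd0 mul1g IHs //; move: is_; rewrite eq_sym (negPf ji).
rewrite big_seq big1 ?mulg1 ?ji // => k ks; rewrite ffunE.
case: eqP => [ki|_]; last exact: gp_odd0.
by move: js; rewrite ji -ki ks.
Qed.

(* If the brackets of odd elements do not contribute over A, then the odd part *)
(* of G_P(A) is the additive group of A_1 (x) g_1. *)
Hypothesis hexp11 : forall (x y : odd_of A) i j,
  hexp P (omul x y) (hbr11 i j) = 1%g /\ hexp P (omul x y) (2^-1 *: hbr11 i i) = 1%g.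

Lemma gp_odd_commute i j (eta eta' : odd_of A) :
  commute (gp_odd i eta : gp_pt P A) (gp_odd j eta').
Proof.
by rewrite /commute gp_oddC (hexp11 _ _ _ _).1 gp_grp1 mul1g.
Qed.

Lemma gp_oddprodD (xi eta : {ffun hO P -> odd_of A}) :
  gp_oddprod (xi + eta) = (gp_oddprod xi * gp_oddprod eta)%g.
Proof.
rewrite -prodgM_commute => [|i j _ _]; last exact: gp_odd_commute.
apply: eq_bigr => i _; rewrite ffunE gp_oddD (hexp11 _ _ _ i).2 //.
by rewrite gp_grp1 mul1g.
Qed.

End Relations.

(** * The semidirect product model of the points *)

Section Semidirect.
Variables (R : realType) (sigma : 'I_3 -> CC R).
Hypothesis sigmaV : \sum_i sigma i = 0.
Notation GP0 := (Ghat_pair sigma).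

Lemma factor_exp_0n b s (A : weil R) zp zh zm :
  factor_exp b s (0 : even_of A) zp zh zm = 1%g.
Proof.
have z0 : (0 : even_of A) * 0 = 0 by rewrite mulr0.
case: b => /=.
  rewrite /T3_exp !scaler0; congr (_, _, _).
  by apply: val_inj; rewrite /= val_insubd /= nexp_inv // eqxx !nexp_sq // !scaler0 !addr0.
apply: val_inj; rewrite /= val_insubd -/(slmx _ _ _ _) det_nexpmx // eqxx.
by apply/matrixP => i j; rewrite nexpmx_sq // scaler0 addr0 mxE.
Qed.

Lemma Ghat_exp_0n (A : weil R) Z : Ghat_exp sigma (0 : even_of A) Z = 1%g.
Proof. by apply/ffunP => i; rewrite !ffunE factor_exp_0n. Qed.

Lemma Ghat_exp_n0 (A : weil R) (n : even_of A) k :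
  n ^+ k = 0 -> Ghat_exp sigma n 0 = 1%g.
Proof. by move=> nk; apply/ffunP => i; rewrite !ffunE (factor_exp0 _ _ nk). Qed.

Section Points.
Variable A : weil R.
Notation odd_pt := {ffun od_gen -> odd_of A}.

Definition Ad_act (g : Ghat sigma A) (xi : odd_pt) : odd_pt :=
  [ffun a => \sum_b eact (Ghat_Ad g a b) (xi b)].

Lemma Ad_actM g h xi : Ad_act (g * h)%g xi = Ad_act g (Ad_act h xi).
Proof.
apply/ffunP => a; rewrite !ffunE.
under eq_bigr => b _ do rewrite Ghat_AdM // eact_suml.
rewrite exchange_big; apply: eq_bigr => c _; rewrite ffunE eact_sumr.
by apply: eq_bigr => b _; rewrite eactM.
Qed.

Lemma Ad_act1 xi : Ad_act 1%g xi = xi.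
Proof.
apply/ffunP => a; rewrite !ffunE (sum_unique (i0 := a)) => [|b ba].
  by rewrite Ghat_Ad1 // eqxx eact1.
by rewrite Ghat_Ad1 // eq_sym (negPf ba) eact0l.
Qed.

Lemma Ad_actD g xi eta : Ad_act g (xi + eta) = Ad_act g xi + Ad_act g eta.
Proof.
apply/ffunP => a; rewrite !ffunE -big_split; apply: eq_bigr => b _.
by rewrite ffunE eactD.
Qed.

Lemma Ad_act0 g : Ad_act g 0 = 0.
Proof. by apply: (addrI (Ad_act g 0)); rewrite -Ad_actD !addr0. Qed.

Lemma Ad_actN g xi : Ad_act g (- xi) = - Ad_act g xi.
Proof. by apply/(addrI (Ad_act g xi)); rewrite -Ad_actD !subrr Ad_act0. Qed.

(** The equation on sigma is an argument of the type because the group laws declared on it rest on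
    the multiplicativity of Ad, which is proved from that equation. *)
Definition sdg of \sum_i sigma i = 0 : Type := (Ghat sigma A * odd_pt)%type.
HB.instance Definition _ := Choice.copy (sdg sigmaV) (Ghat sigma A * odd_pt)%type.

Definition sd_one : sdg sigmaV := (1%g, 0).
(** A pair (g, xi) stands for g followed by the odd product of xi; moving the second group element
    to the left across the first odd part applies the Ad of its inverse. *)
Definition sd_mul (x y : sdg sigmaV) : sdg sigmaV :=
  ((x.1 * y.1)%g, Ad_act (y.1^-1)%g x.2 + y.2).
Definition sd_inv (x : sdg sigmaV) : sdg sigmaV :=
  ((x.1^-1)%g, - Ad_act x.1 x.2).

Fact sd_mulA : associative sd_mul.
Proof.
move=> [g x] [h y] [k z]; congr (_, _); rewrite /= ?mulgA //.
by rewrite invgM Ad_actD Ad_actM addrA.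
Qed.
Fact sd_mul1 : left_id sd_one sd_mul.
Proof. by move=> [g x]; congr (_, _); rewrite /= ?mul1g // Ad_act0 add0r. Qed.
Fact sd_mulr1 : right_id sd_one sd_mul.
Proof. by move=> [g x]; congr (_, _); rewrite /= ?mulg1 // invg1 Ad_act1 addr0. Qed.
Fact sd_mulV : left_inverse sd_one sd_inv sd_mul.
Proof.
move=> [g x]; congr (_, _); rewrite /= ?mulVg //.
by rewrite Ad_actN -Ad_actM mulVg Ad_act1 addNr.
Qed.
Fact sd_mulrV : right_inverse sd_one sd_inv sd_mul.
Proof. by move=> [g x]; congr (_, _); rewrite /= ?mulgV // invgK subrr. Qed.
HB.instance Definition _ := isGroup.Build (sdg sigmaV)
  sd_mulA sd_mul1 sd_mulr1 sd_mulV sd_mulrV.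

Hypothesis hexp11 : forall (x y : odd_of A) i j,
  hexp GP0 (omul x y) (hbr11 i j) = 1%g /\ hexp GP0 (omul x y) (2^-1 *: hbr11 i i) = 1%g.

Definition sd_gen (x : gp_gen GP0 A) : sdg sigmaV :=
  match x with
  | inl g => (g, 0)
  | inr (i, eta) => (1%g, [ffun j => if j == i then eta else 0])
  end.

Lemma sd_odd_prod (I : Type) (r : seq I) (F : I -> odd_pt) :
  (\prod_(i <- r) ((1%g, F i) : sdg sigmaV))%g = (1%g, \sum_(i <- r) F i).
Proof.
elim: r => [|i r IH]; first by rewrite !big_nil.
rewrite !big_cons IH; congr (_, _); rewrite /= ?mulg1 //.
by rewrite invg1 Ad_act1.
Qed.

Lemma sum_single (F : odd_pt) :
  \sum_(i <- enum (hO GP0)) [ffun j => if j == i then F i else 0] = F.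
Proof.
rewrite big_enum /=; apply/ffunP => a; rewrite sum_ffunE (sum_unique (i0 := a)).
  by rewrite ffunE eqxx.
by move=> i ia; rewrite ffunE eq_sym (negPf ia).
Qed.

(** The exponentials in the square and commutation relations are 1 by [hexp11], so these reduce to
    additivity and commutativity; the Ad relation is built into the twisted product. *)
Lemma sd_gen_rel u v : gp_rel u v ->
  (\prod_(x <- u) sd_gen x = \prod_(x <- v) sd_gen x)%g.
Proof.
have mulE (x y : sdg sigmaV) : (x * y)%g = sd_mul x y by [].
case=> [g h|g i eta|i eta eta'|i j eta eta'].
- rewrite !big_cons !big_nil !mulg1 /= mulE /sd_mul /=.
  by rewrite Ad_act0 addr0.
- rewrite !big_cons big_nil mulg1 bigop.big_map /= sd_odd_prod.
  set y : odd_pt := \sum_(_ <- _) _.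
  have {y} -> : y = [ffun j => eact (Ghat_Ad (g^-1)%g j i) eta].
    rewrite -[RHS]sum_single; apply: eq_bigr => j _; apply/ffunP => k.
    by rewrite !ffunE.
  rewrite !mulE /sd_mul /= mul1g mulg1 invg1 Ad_act1 addr0 add0r.
  congr (_, _); apply/ffunP => a; rewrite !ffunE (sum_unique (i0 := i)).
    by rewrite ffunE eqxx.
  by move=> b bi; rewrite ffunE (negPf bi) eact0.
- have /= e := (hexp11 eta' eta i i).2.
  rewrite !big_cons big_nil !mulg1 /= e !mulE /sd_mul /=.
  rewrite !mulg1 !invg1 !Ad_act1 add0r; congr (_, _).
  by apply/ffunP => a; rewrite !ffunE; case: eqP; rewrite ?addr0.
- have /= e := (hexp11 eta' eta i j).1.
  rewrite !big_cons big_nil !mulg1 /= e !mulE /sd_mul /=.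
  by rewrite !mulg1 !invg1 !Ad_act1 !add0r addrC.
Qed.

Definition to_sd : gp_pt GP0 A -> sdg sigmaV := pres_lift sd_gen.

Lemma to_sdM : {morph to_sd : x y / (x * y)%g >-> (x * y)%g}.
Proof. exact: pres_liftM sd_gen_rel. Qed.

Lemma to_sd1 : to_sd 1%g = 1%g.
Proof. by apply: (mulgI (to_sd 1%g)); rewrite -to_sdM !mulg1. Qed.

Lemma to_sdV x : to_sd (x^-1)%g = ((to_sd x)^-1)%g.
Proof. by apply: (mulgI (to_sd x)); rewrite -to_sdM !mulgV to_sd1. Qed.

Lemma to_sd_grp g : to_sd (gp_grp (P := GP0) g) = (g, 0).
Proof. by rewrite /to_sd /gp_grp (pres_lift_gen sd_gen_rel). Qed.

Lemma to_sd_odd i eta :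
  to_sd (gp_odd (P := GP0) i eta) = (1%g, [ffun j => if j == i then eta else 0]).
Proof. by rewrite /to_sd /gp_odd (pres_lift_gen sd_gen_rel). Qed.

Lemma to_sd_oddprod xi : to_sd (gp_oddprod (P := GP0) xi) = (1%g, xi).
Proof.
rewrite /gp_oddprod (big_morph _ to_sdM to_sd1).
under eq_bigr => i _ do rewrite to_sd_odd.
by rewrite sd_odd_prod sum_single.
Qed.

Definition of_sd (x : sdg sigmaV) : gp_pt GP0 A := (gp_grp (P := GP0) x.1 * gp_oddprod (P := GP0) x.2)%g.

Lemma of_sdK : cancel of_sd to_sd.
Proof.
move=> [g xi]; rewrite /of_sd to_sdM to_sd_grp to_sd_oddprod.
by congr (_, _); rewrite /= ?mulg1 // Ad_act0 add0r.
Qed.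

Lemma hexp0_Ghat Z : hexp GP0 (0 : even_of A) Z = 1%g.
Proof. exact: Ghat_exp_0n. Qed.

(** The relation holds for one generator; it extends to all xi because both Ad and the odd product
    are additive in xi. *)
Lemma gp_oddprod_grp xi (g : Ghat sigma A) :
  (gp_oddprod (P := GP0) xi * gp_grp (P := GP0) g =
   gp_grp (P := GP0) g * gp_oddprod (P := GP0) (Ad_act (g^-1)%g xi))%g.
Proof.
have single i eta : (gp_odd (P := GP0) i eta * gp_grp (P := GP0) g =
  gp_grp (P := GP0) g * gp_oddprod (P := GP0)
    (Ad_act (g^-1)%g [ffun j => if j == i then eta else 0]))%g.
  rewrite gp_odd_grp; congr (_ * gp_oddprod _)%g; apply/ffunP => a.
  rewrite !ffunE (sum_unique (i0 := i)); first by rewrite ffunE eqxx.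
  by move=> b bi; rewrite ffunE (negPf bi) eact0.
rewrite -{2}[xi]sum_single {1}/gp_oddprod.
elim: (enum _) => [|i s IH].
  by rewrite !big_nil Ad_act0 gp_oddprod0 ?mul1g ?mulg1 //; exact: hexp0_Ghat.
rewrite !big_cons -mulgA IH mulgA single -mulgA Ad_actD gp_oddprodD //.
Qed.

Lemma of_sdM : {morph of_sd : x y / (x * y)%g >-> (x * y)%g}.
Proof.
move=> [g x] [h y]; rewrite /of_sd /= gp_grpM gp_oddprodD //.
by rewrite !mulgA; congr (_ * _)%g; rewrite -!mulgA gp_oddprod_grp.
Qed.

(** The composite is a morphism by [of_sdM], so it is enough to look at the generators. *)
Lemma to_sdK : cancel to_sd of_sd.
Proof.
have of1 : of_sd 1%g = 1%g by apply: (mulgI (of_sd 1%g)); rewrite -of_sdM !mulg1.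
have h0 := hexp0_Ghat.
apply: gp_ind => [|x y xK yK|x xK|g|i eta].
- by rewrite to_sd1 of1.
- by rewrite to_sdM of_sdM xK yK.
- apply: (mulgI x); rewrite -{1}xK -of_sdM -to_sdM !mulgV to_sd1 //.
- by rewrite to_sd_grp /of_sd /= gp_oddprod0 ?mulg1.
- by rewrite to_sd_odd /of_sd /= gp_grp1 mul1g gp_oddprod_single.
Qed.

End Points.
End Semidirect.

(** * Generation of the points of G by constants and exponentials *)

Section TruncatedExponential.
Variables (K : numFieldType) (T : comAlgType K).

(** The polynomials truncating exp(z X) and exp(-z X) have product 1 modulo X^m: by the binomial
    formula the coefficient of X^k is (z - z)^k / k! for k < m. *)
Lemma trunc_expV (n : T) (m : nat) (z : K) : n ^+ m = 0 ->
  (\sum_(k < m) (z ^+ k / k`!%:R) *: n ^+ k) *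
  (\sum_(k < m) ((- z) ^+ k / k`!%:R) *: n ^+ k) = 1.
Proof.
move=> nm; pose p w : {poly K} := \poly_(k < m) (w ^+ k / k`!%:R).
have evp w : \sum_(k < m) (w ^+ k / k`!%:R) *: n ^+ k = horner_alg n (p w).
  rewrite /p poly_def rmorph_sum; apply: eq_bigr => k _ /=.
  by rewrite linearZ /= rmorphXn /= horner_algX mulr_algl.
rewrite !evp -rmorphM; case: m nm @p {evp} => [|m] nm p.
  by move/eqP: nm; rewrite expr0 oner_eq0.
(* The part of degree at least m.+1 (the truncation order after the case analysis) dies when n is
   substituted. *)
have -> : p z * p (- z) = 1 + drop_poly m.+1 (p z * p (- z)) * 'X^(m.+1).
  rewrite -{1}(poly_take_drop m.+1 (p z * p (- z))); congr (_ + _).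
  apply/polyP => k; rewrite coef_take_poly coef1; case: ltnP => [km|]; last by case: k.
  rewrite coefM.
  have E (j : 'I_k.+1) : (p z)`_j * (p (- z))`_(k - j) =
      (k`!%:R)^-1 * ((z ^+ j * (- z) ^+ (k - j)) *+ 'C(k, j)).
    rewrite !coef_poly (leq_ltn_trans _ km) 1?leq_ord //.
    rewrite (leq_ltn_trans (leq_subr _ _) km).
    have jk : (j <= k)%N by rewrite -ltnS.
    have f0 i : (i`!%:R : K) != 0 by rewrite pnatr_eq0 -lt0n fact_gt0.
    rewrite -(bin_fact jk) !natrM -mulr_natr !invfM mulrACA.
    have C0 : ('C(k, j)%:R : K) != 0 by rewrite pnatr_eq0 -lt0n bin_gt0.
    by field; rewrite C0 !f0.
  rewrite (eq_bigr _ (fun j _ => E j)) -mulr_sumr.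
  under eq_bigr => j _ do rewrite mulrC.
  by rewrite -exprDn addNr expr0n; case: k {km E} => [|k]; rewrite ?mulr0 // invr1 mulr1.
by rewrite rmorphD rmorph1 rmorphM rmorphXn /= horner_algX nm mulr0 addr0.
Qed.

(** A truncated geometric series. *)
Lemma nilp_inv (n : T) m : n ^+ m = 0 -> {v | (1 + n) * v = 1}.
Proof.
move=> nm; exists (\sum_(i < m) (- n) ^+ i).
have := subrX1 (- n) m; rewrite exprNn nm mulr0 sub0r => e.
by apply: oppr_inj; rewrite e -mulNr opprD addrC.
Qed.

End TruncatedExponential.

Section Nilpotents.
Variables (R : realType) (A : weil R).
Implicit Types (a n m : even_of A).

Definition wnil n : Prop := e2a n \in wN A.

Lemma wnil_exp n : wnil n -> exists k, n ^+ k = 0.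
Proof.
move=> nN; have [k Nk] := wN_nil A; exists k.
apply: e2a_inj; rewrite e2a0; apply/eqP; rewrite -memv0 -Nk {Nk}.
elim: k => [|k IH]; first by rewrite expr0 expv0 e2a_1 memv_line.
by rewrite exprS expvSl e2a_mul memv_mul.
Qed.

Lemma wnilMl a n : wnil n -> wnil (a * n).
Proof. by move=> nN; rewrite /wnil e2a_mul; have [] := wN_ideal (e2a a) nN. Qed.

Lemma wnilD n m : wnil n -> wnil m -> wnil (n + m).
Proof. by move=> nN mN; rewrite /wnil e2aD memvD. Qed.

Lemma wnilB n m : wnil n -> wnil m -> wnil (n - m).
Proof. by move=> nN mN; rewrite /wnil e2aB memvB. Qed.

Lemma wnil0 : wnil 0.
Proof. by rewrite /wnil e2a0 mem0v. Qed.

Lemma wnil_scal c : wnil (c *: 1) -> c = 0.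
Proof.
rewrite /wnil e2aZ e2a_1 => cN.
have: c *: 1 \in (<[1]> :&: wN A)%VS by rewrite memv_cap cN memvZ ?memv_line.
by rewrite wN_dir memv0 scaler_eq0 oner_eq0 orbF => /eqP.
Qed.

Lemma even_split a : exists c n, wnil n /\ a = c *: 1 + n.
Proof.
have: e2a a \in (<[1]> + wN A)%VS by rewrite wN_full memvf.
case/memv_addP => u /vlineP[c ->] [v vN e].
exists c, (a - c *: 1); split; last by rewrite addrC subrK.
by rewrite /wnil e2aB e2aZ e2a_1 e addrC addKr.
Qed.

(** The complex part of a, i.e. its image modulo the nilpotent ideal; it exists by [even_split]. *)
Definition body a : CC R := xget 0 [set c | wnil (a - c *: 1)]%classic.

Lemma bodyP a : wnil (a - body a *: 1).
Proof.
have [c [n [nN ->]]] := even_split a; rewrite /body; case: xgetP => [c' _ //|].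
by move=> /(_ c)[]; rewrite /= addrC addKr.
Qed.

Lemma body_unique a c : wnil (a - c *: 1) -> body a = c.
Proof.
move=> ac; apply: subr0_eq; apply: wnil_scal.
have := wnilB ac (bodyP a); rewrite scalerBl; congr wnil.
by rewrite opprB addrC addrA subrK.
Qed.

Lemma body1 : body 1 = 1.
Proof. by apply: body_unique; rewrite scale1r subrr; exact: wnil0. Qed.

Lemma bodyB a b : body (a - b) = body a - body b.
Proof.
apply: body_unique; have := wnilB (bodyP a) (bodyP b).
by congr wnil; rewrite scalerBl !opprB addrACA [RHS]addrACA [- b + _]addrC.
Qed.

Lemma bodyM a b : body (a * b) = body a * body b.
Proof.
apply: body_unique; have := wnilD (wnilMl b (bodyP a)) (wnilMl (body a *: 1) (bodyP b)).
congr wnil; have -> : (body a * body b) *: 1 = (body a *: 1) * (body b *: 1) :> even_of A.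
  by rewrite -scalerAl mul1r scalerA.
move: (body a *: 1) (body b *: 1) => x y; ring.
Qed.

Lemma nexpV n z : wnil n -> nexp n z * nexp n (- z) = 1.
Proof.
move=> /wnil_exp [k nk]; apply: trunc_expV.
by rewrite /nilidx; case: xgetP => [m _ //|/(_ k)].
Qed.

Lemma nexp_taylor n : wnil n -> exists r, nexp n 1 = 1 + n + n * n * r.
Proof.
move=> /wnil_exp [k nk]; have: n ^+ nilidx n = 0.
  by rewrite /nilidx; case: xgetP => [m _ //|/(_ k)].
rewrite /nexp; case: (nilidx n) => [/eqP|[|m _]]; first by rewrite expr0 oner_eq0.
  rewrite expr1 => ->; exists 0; rewrite big_ord_recl big_ord0 /= !expr0 divr1 scale1r.
  by rewrite mulr0 !addr0.
exists (\sum_(i < m) (1 ^+ i.+2 / i.+2`!%:R) *: n ^+ i).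
rewrite !big_ord_recl /= !expr0 !expr1 !divr1 !scale1r -addrA; congr (_ + (_ + _)).
rewrite mulr_sumr; apply: eq_bigr => i _.
by rewrite -scalerAr /bump /= !add1n !exprS [n * (n * _)]mulrA.
Qed.

(* Since 1 + m = exp(m) (1 + m') with m' a multiple of m^2, induction on the  *)
(* nilpotency order writes 1 + m as a product of exponentials.                *)
Lemma unip_exp_ind (S : even_of A -> even_of A -> Prop) :
    S 1 1 ->
    (forall u v u' v', u * v = 1 -> u' * v' = 1 ->
       S u v -> S u' v' -> S (u * u') (v * v')) ->
    (forall n, wnil n -> S (nexp n 1) (nexp n (-1))) ->
  forall n v, wnil n -> (1 + n) * v = 1 -> S (1 + n) v.
Proof.
move=> S1 SM SE n v nN; have [k nk] := wnil_exp nN.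
have {nk} : n ^+ k.+1 = 0 by rewrite exprS nk mulr0.
elim: k n nN v => [|k IH] n nN v nk nv.
  by move: nv; rewrite -[n]expr1 nk addr0 mul1r => ->.
have [r er] := nexp_taylor nN; have := SE n nN.
move: (nexpV 1 nN) er; move: (nexp n 1) (nexp n (-1)) => e e' eV er Se.
(* Since e = 1 + n + n^2 r and e' is its inverse, this n' satisfies 1 + n' = e' (1 + n). *)
pose n' := - (e' * n * r) * n.
have e1 : 1 + n' = e' * (1 + n).
  have -> : n' = e' * (1 + n) - e' * e by rewrite er /n'; ring.
  by rewrite [e' * e]mulrC eV addrC subrK.
have -> : 1 + n = e * (1 + n') by rewrite e1 mulrA eV mul1r.
have v1 : (1 + n') * (e * v) = 1.
  by rewrite e1 -mulrA [X in _ * X]mulrCA nv mulr1 mulrC.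
have -> : v = e' * (e * v) by rewrite mulrA [e' * e]mulrC eV mul1r.
apply: SM => //.
apply: IH => //; first exact: wnilMl.
have -> : n' = - (e' * r) * (n * n) by rewrite /n'; ring.
rewrite !exprMn.
(* As n' is a multiple of n^2, its power k + 1 contains n^(2k+2), and 2k + 2 is at least k + 2. *)
have -> : n ^+ k.+1 * n ^+ k.+1 = n ^+ k.+2 * n ^+ k by rewrite -!exprD addSnnS addnC.
by rewrite nk mul0r mulr0.
Qed.

End Nilpotents.

Section FactorGeneration.
Variables (R : realType) (A : weil R).

Lemma emap_scal c : emap (scal_hom A) (c *: 1 : even_of weilC) = c *: 1.
Proof. by rewrite linearZ rmorph1. Qed.

Lemma body_scal c : body (c *: 1 : even_of A) = c.
Proof. by apply: body_unique; rewrite subrr; exact: wnil0. Qed.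

Lemma body0_wnil (a : even_of A) : body a = 0 -> wnil a.
Proof. by move=> a0; have := bodyP a; rewrite a0 scale0r subr0. Qed.

Lemma body1_wnil (a : even_of A) : body a = 1 -> exists2 n, wnil n & a = 1 + n.
Proof.
move=> a1; exists (a - 1); last by rewrite addrC subrK.
by have := bodyP a; rewrite a1 scale1r.
Qed.

Definition mkT3 (B : weil R) (a : even_of B) (u : unitg (even_of B)) (b : even_of B) :
  T3 B := ((a : Ga B, u : Gm B), b : Ga B).

Lemma mkT3M (B : weil R) (a a' b b' : even_of B) u u' :
  (mkT3 a u b * mkT3 a' u' b')%g = mkT3 (a + a') (u * u')%g (b + b').
Proof. by []. Qed.

Definition mkGm (B : weil R) (u v : even_of B) : unitg (even_of B) :=
  insubd (unitg_one _ : {u : even_of B * even_of B | u.1 * u.2 == 1}) (u, v).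

Lemma val_mkGm (B : weil R) (u v : even_of B) : u * v = 1 -> val (mkGm u v) = (u, v).
Proof. by move=> uv; rewrite val_insubd /= uv eqxx. Qed.

Lemma mkGmM (B : weil R) (u v u' v' : even_of B) : u * v = 1 -> u' * v' = 1 ->
  (mkGm u v * mkGm u' v')%g = mkGm (u * u') (v * v').
Proof.
move=> uv uv'; apply: val_inj; rewrite [RHS]val_mkGm; last first.
  by rewrite mulrACA uv uv' mulr1.
by rewrite /= -/(mkGm u v) -/(mkGm u' v') !val_mkGm.
Qed.

Lemma mkGm1 (B : weil R) : mkGm 1 1 = 1%g :> unitg (even_of B).
Proof. by apply: val_inj; rewrite val_mkGm // mulr1. Qed.

Lemma mkGm_val (B : weil R) (u : unitg (even_of B)) : u = mkGm (val u).1 (val u).2.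
Proof.
by apply: val_inj; rewrite val_mkGm ?(eqP (valP u)) //; case: (val u).
Qed.

Lemma mkT3_scal c d e : d != 0 ->
  sg_map (scal_hom A) (mkT3 (c *: 1) (mkGm (d *: 1) (d^-1 *: 1)) (e *: 1)) =
  mkT3 (c *: 1) (mkGm (d *: 1) (d^-1 *: 1)) (e *: 1).
Proof.
move=> d0; have dV (B : weil R) : (d *: 1) * (d^-1 *: 1) = 1 :> even_of B.
  by rewrite -scalerAl mul1r scalerA mulfV // scale1r.
congr (_, _, _); rewrite /= ?emap_scal //.
by apply: val_inj; rewrite /= !val_mkGm //= !emap_scal.
Qed.

Lemma T3_expE (n : even_of A) zp zh zm :
  T3_exp n zp zh zm = mkT3 (zp *: n) (mkGm (nexp n zh) (nexp n (- zh))) (zm *: n).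
Proof. by []. Qed.

(** An additive coordinate is a complex number plus a nilpotent; a unit is its body times a
    unipotent element, which [unip_exp_ind] writes as a product of exponentials. *)
Lemma T3_gen (S : T3 A -> Prop) :
    (forall x y, S x -> S y -> S (x * y)%g) ->
    (forall x, S (sg_map (scal_hom A) x)) ->
    (forall n zp zh zm, wnil n -> S (T3_exp n zp zh zm)) ->
  forall x, S x.
Proof.
move=> SM SC SE.
have SCc c d e : d != 0 -> S (mkT3 (c *: 1) (mkGm (d *: 1) (d^-1 *: 1)) (e *: 1)).
  by move=> d0; rewrite -mkT3_scal.
have Sa a : S (mkT3 a 1%g 0).
  have [c [n [nN ->]]] := even_split a.
  have := SM _ _ (SCc c 1 0 (oner_neq0 _)) (SE n 1 0 0 nN).
  have [k nk] := wnil_exp nN.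
  rewrite T3_expE mkT3M oppr0 (nexp0z nk) invr1 !scale1r !scale0r mkGm1 mulg1.
  by rewrite addr0.
have Sb b : S (mkT3 0 1%g b).
  have [c [n [nN ->]]] := even_split b.
  have := SM _ _ (SCc 0 1 c (oner_neq0 _)) (SE n 0 0 1 nN).
  have [k nk] := wnil_exp nN.
  rewrite T3_expE mkT3M oppr0 (nexp0z nk) invr1 !scale1r !scale0r mkGm1 mulg1.
  by rewrite addr0.
pose S' u v := S (mkT3 0 (mkGm u v) 0).
have S'M u v u' v' : u * v = 1 -> u' * v' = 1 -> S' u v -> S' u' v' ->
    S' (u * u') (v * v').
  by move=> uv uv' h h'; have := SM _ _ h h'; rewrite mkT3M mkGmM // addr0.
have S'1 : S' 1 1 by rewrite /S' mkGm1.
have S'E n : wnil n -> S' (nexp n 1) (nexp n (-1)).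
  by move=> nN; have := SE n 0 1 0 nN; rewrite T3_expE !scale0r.
move=> [[a u] b].
have -> : ((a, u), b) = (mkT3 a 1 0 * (mkT3 0 u 0 * mkT3 0 1 b))%g :> T3 A.
  by rewrite !mkT3M mulg1 mul1g !add0r addr0.
apply: (SM) => //; apply: (SM) => //.
rewrite [u]mkGm_val; move/eqP: (valP u).
move: (val u).1 (val u).2 => {u} u v /= uv.
have bu : body u * body v = 1 by rewrite -bodyM uv body1.
have bu0 : body u != 0.
  by apply/eqP => b0; move/eqP: bu; rewrite b0 mul0r eq_sym oner_eq0.
have uE : (body u)^-1 *: u * (body u *: v) = 1.
  by rewrite -scalerAl -scalerAr scalerA mulVf // scale1r uv.
have [n nN en] : exists2 n, wnil n & (body u)^-1 *: u = 1 + n.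
  apply: body1_wnil; rewrite -[u in _ *: u]mul1r scalerAl bodyM body_scal.
  by rewrite mulVf.
have h : S' ((body u)^-1 *: u) (body u *: v).
  by rewrite en; apply: unip_exp_ind => //; rewrite -en.
have := SM _ _ (SCc 0 _ 0 bu0) h; rewrite !scale0r mkT3M mkGmM //; last first.
  by rewrite -scalerAl mul1r scalerA mulfV // scale1r.
by rewrite -!scalerAl !mul1r !scalerA mulfV // mulVf // !scale1r addr0.
Qed.

Definition mx2 (K : comNzRingType) (a b c d : K) : 'M[K]_2 :=
  \matrix_(i, j) if i == ord0 then (if j == ord0 then a else b)
                 else (if j == ord0 then c else d).

Lemma mx2E (K : comNzRingType) (M : 'M[K]_2) :
  M = mx2 (M ord0 ord0) (M ord0 ord_max) (M ord_max ord0) (M ord_max ord_max).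
Proof.
apply/matrixP => p q; rewrite !mxE -[p]bitK -[q]bitK.
by case: (p != ord0); case: (q != ord0).
Qed.

Lemma mx2M (K : comNzRingType) (a b c d a' b' c' d' : K) :
  mx2 a b c d *m mx2 a' b' c' d' =
  mx2 (a * a' + b * c') (a * b' + b * d') (c * a' + d * c') (c * b' + d * d').
Proof.
apply/matrixP => i j; rewrite !mxE !big_ord_recl big_ord0 addr0 !mxE /=.
by case: ifP => _; case: ifP => _.
Qed.

Lemma det_mx2E (K : comNzRingType) (a b c d : K) : \det (mx2 a b c d) = a * d - b * c.
Proof. by rewrite det_mx2 !mxE. Qed.

Lemma mx2_1 (K : comNzRingType) : mx2 1 0 0 1 = 1%:M :> 'M[K]_2.
Proof. by rewrite [RHS]mx2E !mxE. Qed.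

Lemma mx2_0 (K : comNzRingType) : mx2 0 0 0 0 = 0 :> 'M[K]_2.
Proof. by rewrite [RHS]mx2E !mxE. Qed.

Lemma mx2_LDU (K : comNzRingType) (u v q r t : K) :
  u * v = 1 -> u * t - q * r = 1 ->
  mx2 u q r t = mx2 1 0 (r * v) 1 *m (mx2 u 0 0 v *m mx2 1 (v * q) 0 1).
Proof.
move=> uv dt; rewrite !mx2M; congr mx2.
- by ring.
- by transitivity ((u * v) * q); [rewrite uv mul1r | ring].
- by transitivity (r * (u * v)); [rewrite uv mulr1 | ring].
transitivity (v * (u * t - q * r) + r * v * ((u * v) * q)); last by rewrite dt; ring.
transitivity ((u * v) * t - v * q * r + r * v * ((u * v) * q)); last by ring.
by rewrite uv; ring.
Qed.

Lemma mx2_split (K : comNzRingType) (a b c d x y z w : K) : x * w - y * z = 1 ->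
  mx2 a b c d = mx2 x y z w *m
    mx2 (w * a - y * c) (w * b - y * d) (x * c - z * a) (x * d - z * b).
Proof.
by move=> e; rewrite mx2M; congr mx2; rewrite -[LHS]mul1r -e; ring.
Qed.

Lemma det_mx2_split (K : comNzRingType) (a b c d x y z w : K) :
    x * w - y * z = 1 -> a * d - b * c = 1 ->
  \det (mx2 (w * a - y * c) (w * b - y * d) (x * c - z * a) (x * d - z * b)) = 1.
Proof.
move=> e e'; rewrite det_mx2E.
by transitivity ((x * w - y * z) * (a * d - b * c)); [ring | rewrite e e' mulr1].
Qed.

Definition mkSL2 (B : weil R) (M : 'M[even_of B]_2) : SL2 B :=
  insubd (sl2_one _ : {M : 'M[even_of B]_2 | \det M == 1}) M.

Lemma val_mkSL2 (B : weil R) (M : 'M[even_of B]_2) : \det M = 1 -> val (mkSL2 M) = M.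
Proof. by move=> dM; rewrite val_insubd dM eqxx. Qed.

Lemma mkSL2M (B : weil R) (M N : 'M[even_of B]_2) : \det M = 1 -> \det N = 1 ->
  (mkSL2 M * mkSL2 N)%g = mkSL2 (M *m N).
Proof.
move=> dM dN; apply: val_inj; rewrite [RHS]val_mkSL2; last by rewrite det_mulmx dM dN mulr1.
by rewrite /= -/(mkSL2 M) -/(mkSL2 N) !val_mkSL2.
Qed.

Lemma mkSL2_scal a b c d : a * d - b * c = 1 ->
  sg_map (scal_hom A) (mkSL2 (mx2 (a *: 1) (b *: 1) (c *: 1) (d *: 1))) =
  mkSL2 (mx2 (a *: 1) (b *: 1) (c *: 1) (d *: 1)).
Proof.
move=> e; have dV (B : weil R) :
    \det (mx2 (a *: 1) (b *: 1) (c *: 1) (d *: 1) : 'M[even_of B]_2) = 1.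
  by rewrite det_mx2E -!scalerAl !mul1r !scalerA -scalerBl e scale1r.
apply: val_inj; rewrite val_mkSL2 // [val _]/= -/(mkSL2 _) val_mkSL2 //.
by apply/matrixP => i j; rewrite !mxE; do ![case: ifP => _]; rewrite emap_scal.
Qed.

Lemma nilidxP (n : even_of A) : wnil n -> n ^+ nilidx n = 0.
Proof.
move=> /wnil_exp [k nk]; rewrite /nilidx; case: xgetP => [m _ //|/(_ k)].
by [].
Qed.

Lemma nexpmx_sq0 (n : even_of A) (Z : 'M[CC R]_2) i j : wnil n -> Z *m Z = 0 ->
  nexpmx n Z i j = (i == j)%:R + Z i j *: n.
Proof.
move=> /nilidxP nk ZZ; rewrite mxE; case: (nilidx n) nk => [/eqP|[|m _]].
- by rewrite expr0 oner_eq0.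
- rewrite expr1 => ->; rewrite scaler0 big_ord_recl big_ord0 /= !addr0 !expr0.
  by rewrite divr1 mxE scaler_nat.
- rewrite !big_ord_recl big1 ?addr0 => [|k _]; last first.
    by rewrite !exprS mulrA -[Z * Z]/(Z *m Z) ZZ mul0r mxE mul0r scale0r.
  by rewrite /= !expr0 !expr1 !divr1 mxE scaler_nat.
Qed.

Lemma nexpmx_diag (n : even_of A) :
  nexpmx n (mx2 1 0 0 (-1)) = mx2 (nexp n 1) 0 0 (nexp n (-1)).
Proof.
have Zk k : (mx2 1 0 0 (-1) : 'M[CC R]_2) ^+ k = mx2 1 0 0 ((-1) ^+ k).
  elim: k => [|k IH]; first by rewrite !expr0 mx2_1.
  rewrite exprS IH -[_ * _]/(_ *m _) mx2M exprS.
  by rewrite !mul0r !mulr0 !mul1r !addr0 add0r.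
apply/matrixP => i j; rewrite !mxE.
under eq_bigr => k _ do rewrite Zk mxE.
case: ifP => _; case: ifP => _ //.
- by apply: eq_bigr => k _; rewrite expr1n.
- by rewrite big1 // => k _; rewrite mul0r scale0r.
- by rewrite big1 // => k _; rewrite mul0r scale0r.
Qed.

Lemma slmxE (s zp zh zm : CC R) :
  slmx s zp zh zm = mx2 (s * zh) (s * zp) (s * zm) (- (s * zh)).
Proof. by rewrite [LHS]mx2E !mxE /= mulrN. Qed.

Lemma SL2_expE (s : CC R) (n : even_of A) zp zh zm :
  SL2_exp s n zp zh zm = mkSL2 (nexpmx n (slmx s zp zh zm)).
Proof. by []. Qed.

(** Modulo a complex matrix, a point of SL_2 is congruent to 1 up to nilpotents. Its LDU factors are
    then exponentials of f and e, and a diagonal matrix covered by [unip_exp_ind]. *)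
Lemma SL2_gen (s : CC R) (S : SL2 A -> Prop) : s != 0 ->
    (forall x y, S x -> S y -> S (x * y)%g) ->
    (forall x, S (sg_map (scal_hom A) x)) ->
    (forall n zp zh zm, wnil n -> S (SL2_exp s n zp zh zm)) ->
  forall x, S x.
Proof.
move=> s0 SM SC SE.
have Se n : wnil n -> S (mkSL2 (mx2 1 n 0 1)).
  (* The coordinate s^-1 compensates the factor s in the identification of the Lie algebra with
     sl_2. *)
  move=> nN; have := SE n s^-1 0 0 nN; rewrite SL2_expE slmxE !mulr0 mulfV // oppr0.
  have ZZ : mx2 0 1 0 0 *m mx2 0 1 0 0 = 0 :> 'M[CC R]_2.
    by rewrite mx2M !(mulr0, mul0r, mulr1, mul1r, addr0) mx2_0.
  congr (S (mkSL2 _)); rewrite  [LHS]mx2E !nexpmx_sq0 //.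
  by rewrite !mxE /= !scale0r scale1r !addr0 add0r.
have Sf n : wnil n -> S (mkSL2 (mx2 1 0 n 1)).
  move=> nN; have := SE n 0 0 s^-1 nN; rewrite SL2_expE slmxE !mulr0 mulfV // oppr0.
  have ZZ : mx2 0 0 1 0 *m mx2 0 0 1 0 = 0 :> 'M[CC R]_2.
    by rewrite mx2M !(mulr0, mul0r, mulr1, mul1r, addr0) mx2_0.
  congr (S (mkSL2 _)); rewrite  [LHS]mx2E !nexpmx_sq0 //.
  by rewrite !mxE /= !scale0r scale1r !addr0 add0r.
pose S' u v := S (mkSL2 (mx2 u 0 0 v)).
have det_diag (u v : even_of A) : u * v = 1 -> \det (mx2 u 0 0 v) = 1.
  by move=> uv; rewrite det_mx2E mulr0 subr0.
have S'M u v u' v' : u * v = 1 -> u' * v' = 1 -> S' u v -> S' u' v' ->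
    S' (u * u') (v * v').
  move=> uv uv' h h'; have := SM _ _ h h'; rewrite mkSL2M ?det_diag // mx2M.
  by rewrite !(mulr0, mul0r, addr0, add0r).
have S'E n : wnil n -> S' (nexp n 1) (nexp n (-1)).
  move=> nN; have := SE n 0 s^-1 0 nN; rewrite SL2_expE slmxE !mulr0 mulfV //.
  by rewrite nexpmx_diag.
have S'1 : S' 1 1.
  by have := S'E 0 (wnil0 _); rewrite !nexp_sq ?mulr0 // !scaler0 addr0.
have Su (p q r t : even_of A) : wnil p -> wnil q -> wnil r -> \det (mx2 (1 + p) q r t) = 1 ->
    S (mkSL2 (mx2 (1 + p) q r t)).
  move=> pN qN rN; rewrite det_mx2E => dt.
  have [k pk] := wnil_exp pN; have [v uv] := nilp_inv pk.
  have h1 : \det (mx2 1 0 (r * v) 1 : 'M[even_of A]_2) = 1.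
    by rewrite det_mx2E mulr1 mul0r subr0.
  have h2 : \det (mx2 1 (v * q) 0 1 : 'M[even_of A]_2) = 1.
    by rewrite det_mx2E mulr1 mulr0 subr0.
  have -> : mkSL2 (mx2 (1 + p) q r t) =
      (mkSL2 (mx2 1 0 (r * v) 1) * (mkSL2 (mx2 (1 + p) 0 0 v) * mkSL2 (mx2 1 (v * q) 0 1)))%g.
    rewrite (mx2_LDU uv dt) [in RHS]mkSL2M ?h2 ?det_diag // [in RHS]mkSL2M //.
    by rewrite det_mulmx h2 det_diag // mulr1.
  apply: (SM); first by apply: Sf; rewrite mulrC; exact: wnilMl.
  by apply: (SM); [exact: (@unip_exp_ind _ _ S') | apply: Se; exact: wnilMl].
move=> x; have xE : x = mkSL2 (val x).
  by apply: val_inj; rewrite val_mkSL2 //; apply/eqP/(valP x).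
have dx : \det (val x) = 1 by apply/eqP/(valP x).
rewrite {}xE; move: (val x) dx => {x} M; rewrite [M]mx2E.
move: (M ord0 ord0) (M ord0 ord_max) (M ord_max ord0) (M ord_max ord_max) => a b c d.
rewrite det_mx2E => dM.
have bd : body a * body d - body b * body c = 1 by rewrite -!bodyM -bodyB dM body1.
(* The matrix of the bodies has determinant 1; it is split off on the left. *)
pose k (z : even_of A) : even_of A := body z *: 1.
have kd : k a * k d - k b * k c = 1.
  by rewrite /k -!scalerAl !mul1r !scalerA -scalerBl bd scale1r.
have kb (z : even_of A) : body (k z) = body z by rewrite body_scal.
have bodyN z : body (- z) = - body z by rewrite -sub0r bodyB -(subrr 1) bodyB subrr sub0r.
have [p pN ep] : exists2 p, wnil p & k d * a - k b * c = 1 + p.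
  by apply: body1_wnil; rewrite bodyB !bodyM !kb -bd mulrC.
have qN : wnil (k d * b - k b * d).
  by apply: body0_wnil; rewrite bodyB !bodyM !kb mulrC subrr.
have rN : wnil (k a * c - k c * a).
  by apply: body0_wnil; rewrite bodyB !bodyM !kb mulrC subrr.
have dN := det_mx2_split kd dM.
rewrite (mx2_split a b c d kd) -mkSL2M ?det_mx2E //; last by rewrite -det_mx2E.
apply: (SM); first by rewrite -mkSL2_scal.
by move: dN; rewrite ep; exact: Su.
Qed.

Lemma factor_gen (b : bool) (s : CC R) (S : factor R b A -> Prop) : (~~ b -> s != 0) ->
    (forall x y, S x -> S y -> S (x * y)%g) ->
    (forall x, S (sg_map (scal_hom A) x)) ->
    (forall n zp zh zm, wnil n -> S (factor_exp b s n zp zh zm)) ->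
  forall x, S x.
Proof.
case: b S => S s0 SM SC SE; first exact: T3_gen.
exact: (SL2_gen (s0 isT)).
Qed.

End FactorGeneration.

Section GhatGeneration.
Variables (R : realType) (sigma : 'I_3 -> CC R).

Definition emb (A : weil R) (l : 'I_3) (x : Ahat sigma l A) : Ghat sigma A :=
  [ffun j => dfwith (fun j => 1%g : Ahat sigma j A) x j] : big_pt (Ahat sigma) A.

Lemma emb_in (A : weil R) l (x : Ahat sigma l A) : (emb x : big_pt _ A) l = x.
Proof. by rewrite ffunE dfwith_in. Qed.

Lemma emb_out (A : weil R) l (x : Ahat sigma l A) m :
  m != l -> (emb x : big_pt (Ahat sigma) A) m = 1%g.
Proof. by move=> ml; rewrite ffunE dfwith_out // eq_sym. Qed.

Lemma embM (A : weil R) l (x y : Ahat sigma l A) : emb (x * y)%g = (emb x * emb y)%g.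
Proof.
apply/ffunP => m; rewrite [RHS]ffunE.
have [->|ml] := eqVneq m l; first by rewrite !emb_in.
by rewrite !emb_out // mulg1.
Qed.

Lemma emb1 (A : weil R) l : emb (1%g : Ahat sigma l A) = 1%g.
Proof.
apply/ffunP => m; rewrite [RHS]ffunE.
by have [->|ml] := eqVneq m l; rewrite ?emb_in ?emb_out.
Qed.

Lemma emb_map (A B : weil R) (f : weil_hom A B) l (x : Ahat sigma l A) :
  sg_map f (emb x) = emb (sg_map f x).
Proof.
apply/ffunP => m; rewrite [LHS]ffunE.
have [->|ml] := eqVneq m l; first by rewrite !emb_in.
by rewrite !emb_out // sg_map1.
Qed.

Lemma emb_exp (A : weil R) l (n : even_of A) zp zh zm : wnil n ->
  emb (factor_exp (sigma l == 0) (sigma l) n zp zh zm : Ahat sigma l A) =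
  Ghat_exp sigma n [ffun c : ev_gen => if c.1 == l then
    match c.2 with Some true => zp | None => zh | Some false => zm end else 0].
Proof.
move=> /wnil_exp [k nk]; apply/ffunP => m; rewrite [RHS]ffunE !ffunE /=.
have [->|ml] := eqVneq m l; first by rewrite dfwith_in.
by rewrite dfwith_out 1?eq_sym // (factor_exp0 _ _ nk).
Qed.

Lemma Ghat_emb (A : weil R) (g : big_pt (Ahat sigma) A) :
  g = (emb (g i1) * (emb (g i2) * emb (g i3)))%g :> Ghat sigma A.
Proof.
apply/ffunP => m; rewrite ffunE [X in (_ * X)%g]ffunE.
by case: (ord3P m) => ->; rewrite emb_in !emb_out // ?mulg1 ?mul1g.
Qed.

(** This matches the description of the A-points of a closed Lie subsupergroup in [lie_subsg_of]. Q
    selects the factors allowed to be nontrivial: a single one for [Ahat_closed_lie], all of them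
    for [S_full]. *)
Lemma Ghat_gen (A : weil R) (Q : pred 'I_3) (S : Ghat sigma A -> Prop) :
    S 1%g -> (forall x y, S x -> S y -> S (x * y)%g) ->
    (forall g : big_pt (Ahat sigma) weilC, (forall l, ~~ Q l -> g l = 1%g) ->
       S (sg_map (scal_hom A) (g : Ghat sigma weilC))) ->
    (forall n (Z : {ffun ev_gen -> (CC R)^o}), wnil n ->
       (forall c, ~~ Q c.1 -> Z c = 0) -> S (Ghat_exp sigma n Z)) ->
  forall g : big_pt (Ahat sigma) A, (forall l, ~~ Q l -> g l = 1%g) -> S g.
Proof.
move=> S1 SM SC SE g g1.
have Sl l : S (emb (g l)).
  have [Ql|/g1 ->] := boolP (Q l); last by rewrite emb1.
  apply: (@factor_gen R A (sigma l == 0) (sigma l) (fun x => S (@emb A l x))) => //.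
  - by move=> x y; rewrite embM; exact: SM.
  - move=> x; rewrite -emb_map; apply: SC => m Qm; rewrite emb_out //.
    by apply: contraNneq Qm => ->.
  - move=> n zp zh zm nN; rewrite emb_exp //; apply: SE => // c Qc.
    by rewrite ffunE; case: eqP Qc => // -> /negP.
by rewrite [g]Ghat_emb; apply: (SM) => //; exact: SM.
Qed.

End GhatGeneration.

(** * Closed Lie subgroups *)

Section RowCoordinates.
Variables (K : numFieldType) (n : nat).

Lemma diff_coord_sub (k : 'I_n) (c : K) (x : 'rV[K]_n) :
  differentiable (fun N : 'rV[K]_n => N ord0 k - c) x /\
  'd (fun N : 'rV[K]_n => N ord0 k - c) x = (fun N : 'rV[K]_n => N ord0 k) :> (_ -> _).
Proof.
have lf : linear (fun N : 'rV[K]_n => N ord0 k) by move=> a u v; rewrite !mxE.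
pose fM := GRing.isLinear.Build _ _ _ _ _ lf.
pose f : {linear 'rV[K]_n -> K} := HB.pack (fun N : 'rV[K]_n => N ord0 k) fM.
have fc : continuous f by exact: coord_continuous.
have df := linear_differentiable x fc.
pose g : 'rV[K]_n -> K := f; have dg : differentiable g x by [].
have dc : differentiable (functions.cst c : 'rV[K]_n -> K) x by exact: differentiable_cst.
split; first exact: (differentiableB dg dc).
rewrite -[LHS]/('d (g - functions.cst c) x : _ -> _) diffB // diff_cst.
by rewrite /g diff_lin //; apply/funext => y /=; rewrite subr0.
Qed.

Lemma closed_coord (k : 'I_n) (c : K) :
  closed [set x : 'rV[K]_n | x ord0 k = c]%classic.
Proof.
apply: (@preimage_closed _ _ (fun x : 'rV[K]_n => x ord0 k) [set c]%classic).
  by move=> x _; exact: coord_continuous.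
exact/accessible_closed_set1/hausdorff_accessible/norm_hausdorff.
Qed.

End RowCoordinates.

Section FactorCoordinates.
Variable R : realType.

(* The coordinates of a factor which parametrize it near 1, indexed like the  *)
(* basis X_{2 eps_i}, H_{2 eps_i}, X_{-2 eps_i} of its Lie algebra. *)
Definition cc (b : bool) (u : option bool) : sg_ix (factor R b) :=
  match b return sg_ix (factor R b) with
  | true => match u with
            | Some true => inl (inl tt)
            | None => inl (inr true)
            | Some false => inr tt
            end
  | false => match u with
             | Some true => (ord0, ord_max)
             | None => (ord0, ord0)
             | Some false => (ord_max, ord0)
             end
  end.

Lemma factor_tan_cc b (s : CC R) zp zh zm u :
  factor_tan b s zp zh zm (cc b u) =
  (if b then 1 else s) * match u with Some true => zp | None => zh | Some false => zm end.
Proof.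
case: b => /=; last by case: u => [[]|]; rewrite ffunE !mxE.
by case: u => [[]|]; rewrite ffunE mul1r.
Qed.

Lemma coord_fun b (A : weil R) (x : factor R b A) p p' :
  sg_coord x p -> sg_coord x p' -> p = p'.
Proof.
case: b x p p' => /= [[[a u] c]|M] p p'.
  move=> [[ha [h1 h2]] hc] [[ha' [h1' h2']] hc']; apply/ffunP.
  rewrite !ffunE /= in ha h1 h2 hc ha' h1' h2' hc'.
  by move=> [[[]|[]]|[]]; rewrite ?ha ?ha' ?h1 ?h1' ?h2 ?h2' ?hc ?hc'.
by move=> h h'; apply/ffunP => -[i j]; rewrite h h'.
Qed.

(** The one coordinate left out is forced by u v = 1, respectively by the determinant. *)
Lemma factor_local b (x : factor R b weilC) p p1 :
    sg_coord x p -> sg_coord (1%g : factor R b weilC) p1 ->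
  (forall u, p (cc b u) = p1 (cc b u)) -> x = 1%g.
Proof.
case: b x p p1 => /= [[[a w] c]|M] p p1.
  move=> [[ha [h1 h2]] hc] [[ha' [h1' h2']] hc'] e.
  rewrite !ffunE /= in ha h1 h2 hc ha' h1' h2' hc'.
  have -> : a = 0 by apply: e2a_inj; rewrite e2a0; have := e (Some true); rewrite ha ha'.
  have -> : c = 0 by apply: e2a_inj; rewrite e2a0; have := e (Some false); rewrite hc hc'.
  congr (_, _, _); apply: val_inj => /=.
  have w1 : (val w).1 = 1.
    by apply: e2a_inj; rewrite e2a_1; have := e None; rewrite h1 h1' => ->; exact: e2a_1.
  have := eqP (valP w); rewrite w1 mul1r => w2.
  by rewrite [LHS]surjective_pairing w1 w2.
move=> h h' e; apply: val_inj => /=.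
have E i j : p (i, j) = p1 (i, j) -> val M i j = (1%:M : 'M[even_of weilC]_2) i j.
  by rewrite h h' => hh; apply: e2a_inj.
rewrite [LHS]mx2E -mx2_1.
have m00 := E _ _ (e None); have m01 := E _ _ (e (Some true)).
have m10 := E _ _ (e (Some false)).
have := eqP (valP M); rewrite [X in \det X]mx2E det_mx2E m00 m01 m10 !mxE /=.
by rewrite mul0r subr0 mul1r => ->.
Qed.

Lemma coord1_factor b : coord1 (factor R b).
Proof. by case: b; [exact: coord1_T3 | exact: coord1_SL2]. Qed.

End FactorCoordinates.

Section SupportedSubgroups.
Variables (R : realType) (sigma : 'I_3 -> CC R).
Notation GP0 := (Ghat_pair sigma).
Notation G0 := (Ghat sigma).
Notation lsa := {ffun ev_gen + od_gen -> (CC R)^o}.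

Lemma coord1_Ghat : coord1 G0.
Proof. by apply: coord1_big => l; exact: coord1_factor. Qed.

Definition ixc (c : ev_gen) : sg_ix G0 :=
  Tagged (fun l => sg_ix (Ahat sigma l) : Type) (cc R (sigma c.1 == 0) c.2).

Lemma Ghat_tan_ixc Z c :
  Ghat_tan sigma Z (ixc c) = (if sigma c.1 == 0 then 1 else sigma c.1) * Z c.
Proof. by rewrite ffunE /= factor_tan_cc; case: c => l [[]|]. Qed.

Lemma Ghat_local (g : big_pt (Ahat sigma) weilC) p p1 l :
    sg_coord (g : G0 weilC) p -> sg_coord (1%g : G0 weilC) p1 ->
  (forall u, p (ixc (l, u)) = p1 (ixc (l, u))) -> g l = 1%g.
Proof.
move=> cg c1 e; have := c1 l; rewrite ffunE => c1l.
by apply: (factor_local (cg l) c1l) => u; rewrite !ffunE; exact: e.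
Qed.

Lemma crowE (p : {ffun sg_ix G0 -> @weilC R}) c : crow p ord0 (enum_rank c) = p c.
Proof. by rewrite mxE enum_rankK. Qed.

Variable Q : pred 'I_3.

(** For [Q = pred1 i] this is the i-th factor and for [Q = pred0] the trivial group, the underlying
    groups of the two closed subsupergroups of the degenerate case. *)
Definition supp_grp : set (G0 weilC) :=
  fun g => forall l, ~~ Q l -> (g : big_pt (Ahat sigma) weilC) l = 1%g.

Lemma supp_grp_subgroup : subgroup supp_grp.
Proof.
split=> [l _|x y hx hy l Ql|x hx l Ql]; first by rewrite ffunE.
  by rewrite ffunE hx // hy // mulg1.
by rewrite ffunE hx // invg1.
Qed.

Lemma supp_grp_closed : closed_in supp_grp.
Proof.
have [p1 c1] := coord1_Ghat weilC.
exists (\bigcap_(c in [set c : sg_ix G0 | ~~ Q (tag c)])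
    [set x : 'rV[CC R]_#|sg_ix G0| | x ord0 (enum_rank c) = p1 c])%classic.
  by apply: closed_bigI => c _; exact: closed_coord.
move=> g p cg; split=> [Kg c /= Qc|h l Ql].
  rewrite crowE; case: c Qc => l c /= Ql.
  have := cg l; rewrite (Kg l Ql) => h; have := c1 l; rewrite ffunE => h1.
  by have /ffunP/(_ c) := coord_fun h h1; rewrite !ffunE.
apply: (Ghat_local cg c1) => u; have := h (ixc (l, u)) Ql.
by rewrite /= crowE.
Qed.

(** The equations are the local parameters of the factors outside Q, minus their values at 1. They
    cut out the group globally, so every neighbourhood statement holds everywhere. *)
Lemma supp_grp_submanifold : submanifold_at1 (P := GP0) supp_grp
  [set Z : {ffun ev_gen -> (CC R)^o} | forall c, ~~ Q c.1 -> Z c = 0]%classic.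
Proof.
have [p1 c1] := coord1_Ghat weilC; exists p1 => //.
pose I := {c : ev_gen | ~~ Q c.1}.
pose ix (l : 'I_#|{: I}|) := val (enum_val l : I).
pose F (l : 'I_#|{: I}|) (x : 'rV[CC R]_#|sg_ix G0|) : CC R :=
  x ord0 (enum_rank (ixc (ix l))) - p1 (ixc (ix l)).
have dF l x := diff_coord_sub (enum_rank (ixc (ix l))) (p1 (ixc (ix l)) : CC R) x.
have s0 (c : ev_gen) : (if sigma c.1 == 0 then 1 else sigma c.1) != 0 :> CC R.
  by case: ifPn => // _; exact: oner_neq0.
have dFE l (Z : {ffun ev_gen -> (CC R)^o}) : 'd (F l) (crow p1) (crow (Ghat_tan sigma Z)) =
    (if sigma (ix l).1 == 0 then 1 else sigma (ix l).1) * Z (ix l).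
  by have [_ ->] := dF l (crow p1); rewrite crowE Ghat_tan_ixc.
have nearT (P : 'rV[CC R]_#|sg_ix G0| -> Prop) :
    (forall x, P x) -> \forall x \near crow p1, P x.
  by move=> h; apply: (@filterE _ _ (nbhs_filter (crow p1))).
exists #|{: I}|, F; split.
- by apply: nearT => x l; have [] := dF l x.
- apply: nearT => x g p cg <-; split=> [Kg l|h l Ql].
    rewrite /F crowE; apply/eqP; rewrite subr_eq0; apply/eqP.
    have Ql : ~~ Q (ix l).1 := valP (enum_val l).
    have := cg (ix l).1; rewrite (Kg _ Ql) => h; have := c1 (ix l).1; rewrite ffunE => h1.
    by have /ffunP/(_ (cc R (sigma (ix l).1 == 0) (ix l).2)) := coord_fun h h1; rewrite !ffunE.
  apply: (Ghat_local cg c1) => u.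
  have Qu : ~~ Q (l, u).1 by [].
  have := h (enum_rank (Sub (l, u) Qu : I)).
  rewrite /F /ix enum_rankK /= crowE => hu.
  exact: (@subr0_eq (CC R) _ _ hu).
(* The differentials are nonzero multiples of distinct coordinates of Z, so a preimage of w is
   obtained by rescaling. *)
- move=> w; exists [ffun c => if insub c is Some x then
      (if sigma c.1 == 0 then 1 else sigma c.1)^-1 * w (enum_rank (x : I)) else 0].
  move=> l; rewrite dFE ffunE /ix valK enum_valK mulrA mulfV ?mul1r //.
- move=> Z; split=> [Z0 l|h c Qc]; first by rewrite dFE Z0 ?mulr0 //; exact: (valP (enum_val l)).
  have := h (enum_rank (Sub c Qc : I)); rewrite dFE /ix enum_rankK /= => hz.
  by move: hz (s0 c); case: ifP => _; [rewrite mul1r | move=> hz sc; apply: (mulfI sc); rewrite mulr0].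
Qed.

Definition supp_vs (D : pred (ev_gen + od_gen)) : {vspace lsa} :=
  lker (linfun (fun v : lsa => [ffun c => if D c then 0 else v c] : lsa)).

Lemma supp_vsP D (v : lsa) : reflect (forall c, ~~ D c -> v c = 0) (v \in supp_vs D).
Proof.
have lf : linear (fun v : lsa => [ffun c => if D c then 0 else v c] : lsa).
  by move=> a x y; apply/ffunP => c; rewrite !ffunE; case: (D c); rewrite ?ffunE ?scaler0 ?addr0.
pose fM := GRing.isLinear.Build _ _ _ _ _ lf.
pose f : {linear lsa -> lsa} := HB.pack (fun v : lsa => [ffun c => if D c then 0 else v c] : lsa) fM.
have lE : linfun (fun v : lsa => [ffun c => if D c then 0 else v c] : lsa) v =
    [ffun c => if D c then 0 else v c] by rewrite -[LHS]/(linfun f v) lfunE.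
rewrite memv_ker lE; apply: (iffP eqP) => [/ffunP h c Dc|h].
  by have := h c; rewrite !ffunE (negPf Dc).
by apply/ffunP => c; rewrite !ffunE; case: ifPn => // /h.
Qed.

End SupportedSubgroups.

(** * The degenerate cases *)

Section DegenerateBrackets.
Variables (R : realType) (sigma : 'I_3 -> CC R).
Hypothesis sigmaV : \sum_i sigma i = 0.
Notation GP0 := (Ghat_pair sigma).

Lemma ev_sigma_tau : ev_sigma sigma (tau R) = \prod_l sigma l.
Proof. by rewrite /tau !ev_sigmaM !ev_sigma_xv // prod3. Qed.

(** Each of the two odd vectors is tau times an element of g(x), and tau specialises to the product
    of the sigma_l. *)
Lemma ghat_br11 a b c :
  ghat_br sigma (inr a) (inr b) c = (\prod_l sigma l) ^+ 2 * ev_sigma sigma (br11 R a b c).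
Proof. by rewrite ffunE /hat_coef ev_sigmaM expr2 ev_sigmaM ev_sigma_tau -expr2. Qed.

Lemma ev_scale (x : Cx R) (v : gx R) c :
  ev_sigma sigma ((x *: v) c) = ev_sigma sigma x * ev_sigma sigma (v c).
Proof. by rewrite ffunE ev_sigmaM. Qed.

(** Every bracket inside the i-th copy of sl_2 carries the factor x_i. *)
Lemma ghat_br00_self i u v c : sigma i = 0 ->
  ghat_br sigma (inl (i, u)) (inl (i, v)) c = 0.
Proof.
move=> i0; rewrite ffunE.
have -> : hat_coef R (inl (i, u)) (inl (i, v)) c = br00 R (i, u) (i, v) c by exact: mul1r.
have z (w : gx R) : ev_sigma sigma ((xv R i *: w) c) = 0.
  by rewrite ev_scale ev_sigma_xv // i0 mul0r.
have z2 x (w : gx R) : ev_sigma sigma (((x * xv R i) *: w) c) = 0.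
  by rewrite ev_scale ev_sigmaM ev_sigma_xv // i0 mulr0 mul0r.
have zN (w : gx R) : ev_sigma sigma (w c) = 0 -> ev_sigma sigma ((- w) c) = 0.
  by move=> w0; rewrite ffunE ev_sigmaN w0 oppr0.
have z0 : ev_sigma sigma ((0 : gx R) c) = 0 by rewrite ffunE ev_sigma0.
rewrite /br00 eqxx; case: u => [[]|]; case: v => [[]|];
  do ?[exact: z0 | exact: z | exact: z2 | apply: zN].
Qed.

Section ZeroProduct.
Hypothesis sigma0 : exists l, sigma l = 0.

Lemma ghat_br11_0 a b c : ghat_br sigma (inr a) (inr b) c = 0.
Proof.
have [l l0] := sigma0.
by rewrite ghat_br11 (bigD1 l) //= l0 mul0r expr0n mul0r.
Qed.

Lemma hexp11_0 A (x y : odd_of A) i j :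
  hexp GP0 (omul x y) (hbr11 i j) = 1%g /\ hexp GP0 (omul x y) (2^-1 *: hbr11 i i) = 1%g.
Proof.
have h0 a b : @hbr11 R GP0 a b = 0.
  by apply/ffunP => c; rewrite !ffunE -[RHS](ghat_br11_0 a b (inl c)) ffunE.
have x0 : omul x y ^+ 2 = 0 by rewrite expr2 omul_sq.
by rewrite !h0 scaler0; split; exact: (Ghat_exp_n0 _ x0).
Qed.

End ZeroProduct.
End DegenerateBrackets.

Section FactorIsomorphisms.
Variable R : realType.

(** Defined for both values of b, the trivial map being the default. This avoids transport along an
    equation on b; invertibility is claimed only for the right value. *)
Definition to_T3 (b : bool) (A : weil R) : factor R b A -> T3 A :=
  match b return factor R b A -> T3 A with true => id | false => fun _ => 1%g end.
Definition of_T3 (b : bool) (A : weil R) : T3 A -> factor R b A :=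
  match b return T3 A -> factor R b A with true => id | false => fun _ => 1%g end.
Definition to_SL2 (b : bool) (A : weil R) : factor R b A -> SL2 A :=
  match b return factor R b A -> SL2 A with false => id | true => fun _ => 1%g end.
Definition of_SL2 (b : bool) (A : weil R) : SL2 A -> factor R b A :=
  match b return SL2 A -> factor R b A with false => id | true => fun _ => 1%g end.

Lemma to_T3M b A : {morph @to_T3 b A : x y / (x * y)%g >-> (x * y)%g}.
Proof. by case: b => x y //; rewrite /= mulg1. Qed.

Lemma to_SL2M b A : {morph @to_SL2 b A : x y / (x * y)%g >-> (x * y)%g}.
Proof. by case: b => x y //; rewrite /= mulg1. Qed.

Lemma to_T3_map b A B (f : weil_hom A B) x :
  to_T3 (sg_map f x : factor R b B) = sg_map f (to_T3 x).
Proof. by case: b x => x //; rewrite sg_map1. Qed.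

Lemma to_SL2_map b A B (f : weil_hom A B) x :
  to_SL2 (sg_map f x : factor R b B) = sg_map f (to_SL2 x).
Proof. by case: b x => x //; rewrite sg_map1. Qed.

Lemma aff_to_T3 b A : aff (@to_T3 b A).
Proof. by case: b; [exact: aff_id | exact: aff_1 (@coord1_T3 R)]. Qed.

Lemma aff_of_T3 b A : aff (@of_T3 b A).
Proof. by case: b; [exact: aff_id | exact: aff_1 (@coord1_SL2 R)]. Qed.

Lemma aff_to_SL2 b A : aff (@to_SL2 b A).
Proof. by case: b; [exact: aff_1 (@coord1_SL2 R) | exact: aff_id]. Qed.

Lemma aff_of_SL2 b A : aff (@of_SL2 b A).
Proof. by case: b; [exact: aff_1 (@coord1_T3 R) | exact: aff_id]. Qed.

Lemma to_T3K (b : bool) A : b -> cancel (@to_T3 b A) (@of_T3 b A).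
Proof. by case: b. Qed.

Lemma of_T3K (b : bool) A : b -> cancel (@of_T3 b A) (@to_T3 b A).
Proof. by case: b. Qed.

Lemma to_SL2K (b : bool) A : ~~ b -> cancel (@to_SL2 b A) (@of_SL2 b A).
Proof. by case: b. Qed.

Lemma of_SL2K (b : bool) A : ~~ b -> cancel (@of_SL2 b A) (@to_SL2 b A).
Proof. by case: b. Qed.

Lemma val_to_SL2 (b : bool) A (x : factor R b A) : ~~ b -> val (to_SL2 x) = factor_mx x.
Proof. by case: b x. Qed.

Lemma T3_isom (b : bool) : b ->
  {l : lie_hom (factor R b) T3 | lie_isom l & forall A, l A =1 @to_T3 b A}.
Proof.
move=> bT; apply: (lie_isom_of (g := @of_T3 b)).
- exact: to_T3M.
- exact: to_T3_map.
- by move=> A; exact: to_T3K.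
- by move=> A; exact: of_T3K.
- exact: aff_to_T3.
- exact: aff_of_T3.
Qed.

Lemma SL2_isom (b : bool) : ~~ b ->
  {l : lie_hom (factor R b) SL2 | lie_isom l & forall A, l A =1 @to_SL2 b A}.
Proof.
move=> bF; apply: (lie_isom_of (g := @of_SL2 b)).
- exact: to_SL2M.
- exact: to_SL2_map.
- by move=> A; exact: to_SL2K.
- by move=> A; exact: of_SL2K.
- exact: aff_to_SL2.
- exact: aff_of_SL2.
Qed.

End FactorIsomorphisms.

(** * The splitting when some sigma_l vanishes *)

Section Split.
Variables (R : realType) (sigma : 'I_3 -> CC R).
Hypothesis sigmaV : \sum_i sigma i = 0.
Hypothesis sigma0 : exists l, sigma l = 0.
Notation GP0 := (Ghat_pair sigma).
Notation hx := (hexp11_0 sigmaV sigma0).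
Notation SDC := (sg_prod (Ghat sigma) (odd_affine od_gen)).
Notation gg := (gp_grp (P := GP0)).
Notation gop := (gp_oddprod (P := GP0)).

(** The target is the product supermanifold G x C^(0|8), used only for its coordinates; its direct
    product law is not that of [sdg], see [sd_mulE]. *)
Definition sd A (x : GGhat sigma A) : SDC A := to_sd sigmaV x.
Definition ds A (x : SDC A) : GGhat sigma A := (gg x.1 * gop x.2)%g.

Lemma sdK A : cancel (@sd A) (@ds A).
Proof. exact: (to_sdK sigmaV (@hx A)). Qed.

Lemma dsK A : cancel (@ds A) (@sd A).
Proof. exact: (of_sdK (sigmaV := sigmaV) (@hx A)). Qed.

Lemma sd_mulE A (x y : GGhat sigma A) :
  sd (x * y)%g = (((sd x).1 * (sd y).1)%g, Ad_act ((sd y).1^-1)%g (sd x).2 + (sd y).2).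
Proof. exact: (to_sdM sigmaV (@hx A)). Qed.

Lemma sd_grp A g : sd (gg g : GGhat sigma A) = (g, 0).
Proof. exact: (to_sd_grp sigmaV (@hx A)). Qed.

Lemma sd_oddprod A xi : sd (gop xi : GGhat sigma A) = (1%g, xi).
Proof. exact: (to_sd_oddprod sigmaV (@hx A)). Qed.

Lemma gop_gg A xi g :
  (gop xi * gg g)%g = (gg g * gop (Ad_act (g^-1)%g xi))%g :> GGhat sigma A.
Proof. exact: (gp_oddprod_grp (@hx A)). Qed.

Lemma sd_map A B (f : weil_hom A B) (x : GGhat sigma A) : sd (sg_map f x) = sg_map f (sd x).
Proof.
rewrite -{1}[x]sdK; apply: (can_inj (@dsK B)); rewrite sdK.
rewrite /ds [LHS]gp_mapM gp_map_grp gp_map_oddprod.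
by [].
Qed.

(** The coordinates of the supergroup are by definition those of g and xi in its splitting, so the
    map is the identity in coordinates. *)
Lemma aff_sd A : aff (@sd A).
Proof.
exists Some, (fun=> 0) => x p [g cg [xi cxi ->]].
rewrite -[(_ * _)%g]/(ds (g, xi)) dsK; split.
  by congr (sg_coord _ _): cg; apply/ffunP => c; rewrite !ffunE.
by move=> a; rewrite !ffunE cxi.
Qed.

Lemma aff_ds A : aff (@ds A).
Proof.
exists Some, (fun=> 0) => -[g xi] p [cg cxi]; exists g.
  by congr (sg_coord _ _): cg; apply/ffunP => c; rewrite !ffunE.
by exists xi => // a; have := cxi a; rewrite !ffunE.
Qed.

Notation rd := (gp_rd GP0).
Notation G1 := (gp_1 GP0).

Lemma rdP A (x : GGhat sigma A) : rd A x <-> (sd x).2 = 0.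
Proof.
split=> [[g _ <-]|x0]; first by rewrite sd_grp.
exists (sd x).1 => //; rewrite -[RHS]sdK /ds x0 gp_oddprod0 ?mulg1 //.
exact: hexp0_Ghat.
Qed.

Lemma gen_oddprod A xi : @G1 A (gop xi).
Proof.
rewrite /gp_oddprod; elim: (enum _) => [|i s IH]; first by rewrite big_nil; exact: ss1.
rewrite big_cons; apply: ssM => // S _ _ _ SX.
by apply: SX; exists i, (xi i).
Qed.

(** The first component is multiplicative and trivial on odd generators; conversely an element with
    trivial first component is an odd product. *)
Lemma G1P A (x : GGhat sigma A) : G1 A x <-> (sd x).1 = 1%g.
Proof.
have sd1 : sd (1%g : GGhat sigma A) = (1%g, 0) by exact: (to_sd1 sigmaV (@hx A)).
split=> [h|x1].
  apply: (h (fun y => (sd y).1 = 1%g)); first by rewrite sd1.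
  - by move=> y z y1 z1; rewrite sd_mulE /= y1 z1 mulg1.
  - move=> y y1; have := sd_mulE y (y^-1)%g; rewrite mulgV sd1 => -[+ _].
    by rewrite y1 mul1g.
  - move=> y [i [eta ->]].
    by rewrite -(gp_oddprod_single _ i eta) ?sd_oddprod //; exact: hexp0_Ghat.
rewrite -[x]sdK /ds x1 gp_grp1 mul1g; exact: gen_oddprod.
Qed.

Lemma G1_normal : normal G1.
Proof.
move=> A g x /G1P x1; apply/G1P; rewrite !sd_mulE /= x1 mulg1.
have := sd_mulE g (g^-1)%g; rewrite mulgV.
by rewrite [X in X = _](to_sd1 sigmaV (@hx A)) => -[<- _].
Qed.

Lemma conj_oddprod A (g : Ghat sigma A) xi :
  (gg g * gop xi * (gg g)^-1)%g = gop (Ad_act g xi) :> GGhat sigma A.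
Proof. by rewrite -gp_grpV -mulgA gop_gg invgK mulgA -gp_grpM mulgV gp_grp1 mul1g. Qed.

Lemma G1_mul A xi eta : (gop xi * gop eta)%g = gop (xi + eta) :> GGhat sigma A.
Proof. by rewrite gp_oddprodD //; exact: (@hx A). Qed.

Definition rd_pt A (g : Ghat sigma A) : sg_sub rd A :=
  Sub (gg g) (asboolT (ex_intro2 (fun h => setT h) (fun h => gg h = gg g) g I erefl)).

Definition G1_pt A (xi : odd_affine od_gen A) : sg_sub G1 A :=
  Sub (gop xi) (asboolT (gen_oddprod xi)).

Lemma rd_ptK A (x : sg_sub rd A) : rd_pt (sd (val x)).1 = x.
Proof.
apply: val_inj => /=; have /rdP x0 : rd A (val x) := asboolW (valP x).
by rewrite -[RHS]sdK /ds x0 gp_oddprod0 ?mulg1 //; exact: hexp0_Ghat.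
Qed.

Lemma G1_ptK A (x : sg_sub G1 A) : G1_pt (sd (val x)).2 = x.
Proof.
apply: val_inj => /=; have /G1P x1 : G1 A (val x) := asboolW (valP x).
by rewrite -[RHS]sdK /ds x1 gp_grp1 mul1g.
Qed.

Lemma aff_gg A : aff (fun g : Ghat sigma A => gg g : GGhat sigma A).
Proof.
apply: (aff_ext (f := @ds A \o (fun g => (g, 0)))) => [g|].
  by rewrite /= /ds gp_oddprod0 ?mulg1 //; exact: hexp0_Ghat.
apply: aff_comp (@aff_ds A); apply: aff_pair; first exact: aff_id.
exact: (aff_1 (Y := odd_affine od_gen) _ _ (@coord1_odd R od_gen)).
Qed.

Lemma aff_gop A : aff (fun xi : odd_affine od_gen A => gop xi : GGhat sigma A).
Proof.
apply: (aff_ext (f := @ds A \o (fun xi => (1%g, xi)))) => [xi|].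
  by rewrite /= /ds gp_grp1 mul1g.
apply: aff_comp (@aff_ds A); apply: aff_pair; last exact: aff_id.
exact: (aff_1 _ _ (coord1_Ghat sigma)).
Qed.

Lemma split_semidirect : semidirect rd G1.
Proof.
split; first exact: G1_normal.
- move=> A x /rdP x2 /G1P x1; rewrite -[x]sdK /ds x1 x2 gp_grp1 mul1g.
  by rewrite gp_oddprod0 //; exact: hexp0_Ghat.
- move=> A x; exists (gg (sd x).1), (gop (sd x).2); split.
  + by exists (sd x).1.
  + exact: gen_oddprod.
  + by rewrite -[LHS]sdK.
exists (fun A x => (rd_pt (sd x).1, G1_pt (sd x).2)) => m A; split.
- move=> [k n]; rewrite /m /= -[k]rd_ptK -[n]G1_ptK /=.
  by rewrite -[(gg _ * gop _)%g]/(ds ((sd (val k)).1, (sd (val n)).2)) dsK.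
- by move=> x; rewrite /m /= -[RHS]sdK.
- apply: aff_holo; apply: (aff_ext (f := @ds A \o
    (fun u : sg_prod (sg_sub rd) (sg_sub G1) A => ((sd (val u.1)).1, (sd (val u.2)).2)))).
    by move=> [k n]; rewrite /m /= /ds /= -{2}[k]rd_ptK -{2}[n]G1_ptK.
  apply: aff_comp (@aff_ds A); apply: aff_pair.
    exact: (aff_comp (aff_comp (aff_comp (aff_fst A (sg_sub rd) (sg_sub G1))
      (aff_val A rd)) (@aff_sd A)) (aff_fst A (Ghat sigma) (odd_affine od_gen))).
  exact: (aff_comp (aff_comp (aff_comp (aff_snd A (sg_sub rd) (sg_sub G1))
    (aff_val A G1)) (@aff_sd A)) (aff_snd A (Ghat sigma) (odd_affine od_gen))).
- apply: aff_holo; apply: (aff_pair (Y := sg_sub rd) (Z := sg_sub G1)).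
    exact: (aff_comp (aff_comp (@aff_sd A) (aff_fst A _ _)) (@aff_gg A)).
  exact: (aff_comp (aff_comp (@aff_sd A) (aff_snd A _ _)) (@aff_gop A)).
Qed.

End Split.

Section LieSubsupergroups.
Variables (R : realType) (sigma : 'I_3 -> CC R).
Hypothesis sigmaV : \sum_i sigma i = 0.
Hypothesis sigma0 : exists l, sigma l = 0.
Notation GP0 := (Ghat_pair sigma).
Notation gg := (gp_grp (P := GP0)).
Notation gop := (gp_oddprod (P := GP0)).
Notation lsa := {ffun ev_gen + od_gen -> (CC R)^o}.

Lemma supp_vs_submanifold (Q : pred 'I_3) (D : pred (ev_gen + od_gen)) :
    (forall c, D (inl c) = Q c.1) ->
  submanifold_at1 (P := GP0) (supp_grp Q)
    [set Z : {ffun ev_gen -> (CC R)^o} | ev_incl (P := GP0) Z \in supp_vs R D]%classic.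
Proof.
move=> DQ; have := supp_grp_submanifold sigma Q; congr submanifold_at1.
apply/seteqP; split=> Z /= h.
  apply/supp_vsP => -[c|c] Dc; rewrite ffunE //.
  by apply: h; rewrite -DQ.
by move=> c Qc; have /supp_vsP/(_ (inl c)) := h; rewrite DQ ffunE; apply.
Qed.

Lemma ev_incl_part (D : pred (ev_gen + od_gen)) (v : lsa) :
  v \in supp_vs R D -> ev_incl (P := GP0) (ev_part (P := GP0) v) \in supp_vs R D.
Proof.
move/supp_vsP => h; apply/supp_vsP => -[c|c] Dc; rewrite ffunE // ffunE.
exact: h.
Qed.

Lemma scal_oddprod0 A (eta : odd_of A) (v : {ffun od_gen -> (CC R)^o}) :
  (forall a, v a = 0) -> gop [ffun i => (v i : CC R) *: eta] = 1%g.
Proof.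
move=> v0; rewrite (_ : [ffun i => _] = 0) ?gp_oddprod0 //; first exact: hexp0_Ghat.
by apply/ffunP => a; rewrite !ffunE v0 scale0r.
Qed.

(** The pair consists of the i-th factor and its Lie algebra, which has no odd part and is Abelian;
    the description of the A-points is [Ghat_gen]. *)
Lemma Ahat_closed_lie i : sigma i = 0 -> closed_lie_subsg (P := GP0) (Ahat_sub sigma i).
Proof.
move=> i0; pose Q := pred1 i.
pose D (c : ev_gen + od_gen) := if c is inl c then c.1 == i else false.
exists (supp_grp Q), (supp_vs R D); split.
- by split; [exact: supp_grp_subgroup | exact: supp_grp_closed].
- exact: supp_vs_submanifold.
- split=> [v|u v /supp_vsP hu /supp_vsP hv]; first exact: ev_incl_part.
  apply/supp_vsP => c _; rewrite lbrE sum_eq0 // => a; rewrite sum_eq0 // => b.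
  have [Da|/hu ->] := boolP (D a); last by rewrite !mul0r.
  have [Db|/hv ->] := boolP (D b); last by rewrite mulr0 mul0r.
  case: a b Da Db => [[a u']|//] [[b v']|//] /= /eqP -> /eqP ->.
  by rewrite ghat_br00_self // mulr0.
- move=> g Y _ /supp_vsP hY; apply/supp_vsP => -[c|c] _; rewrite ffunE //.
  rewrite ffunE sum_eq0 // => b; have := hY (inr b) isT; rewrite ffunE => ->.
  by rewrite mulr0.
move=> A x; split=> [[g gi <-]|].
  apply: (Ghat_gen (Q := Q) (S := fun g => generated _ (gg g))) => //.
  - by rewrite gp_grp1.
  - move=> y z hy hz S S1 SM SV SX; rewrite gp_grpM.
    by apply: (SM); [exact: hy | exact: hz].
  - move=> h h1 S _ _ _; apply; constructor 1; exists h => //.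
  - move=> n Z nN hZ S _ _ _; apply; constructor 2; exists n, Z; split=> //.
    by apply/supp_vsP => -[c|c] Dc; rewrite ffunE //; exact: hZ.
apply.
- exact: ss1.
- by move=> y z; exact: ssM.
- by move=> y; exact: ssV.
move=> y [[h hK ->]|[n [Z [nN /supp_vsP hZ ->]]]|[eta [v [/supp_vsP hv ->]]]].
- exists (sg_map (scal_hom A) h) => // j ji; rewrite ffunE hK //.
  exact: sg_map1.
- exists (Ghat_exp sigma n Z) => // j ji; rewrite ffunE.
  have Zj u : Z (j, u) = 0 by have := hZ (inl (j, u)); rewrite ffunE; apply.
  by rewrite !Zj; have [k /factor_exp0 ->] := wnil_exp nN.
- rewrite scal_oddprod0; first exact: ss1.
  by move=> a; have := hv (inr a) isT; rewrite ffunE.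
Qed.

(** The pair is ({1}, g_1), where g_1 is a subalgebra because all odd brackets vanish. *)
Lemma G1_closed_lie : closed_lie_subsg (P := GP0) (gp_1 GP0).
Proof.
exists (supp_grp pred0), (supp_vs R is_odd); split.
- by split; [exact: supp_grp_subgroup | exact: supp_grp_closed].
- exact: supp_vs_submanifold.
- split=> [v|u v /supp_vsP hu /supp_vsP hv]; first exact: ev_incl_part.
  apply/supp_vsP => c _; rewrite lbrE sum_eq0 // => a; rewrite sum_eq0 // => b.
  have [Da|/hu ->] := boolP (is_odd a); last by rewrite !mul0r.
  have [Db|/hv ->] := boolP (is_odd b); last by rewrite mulr0 mul0r.
  by case: a b Da Db => [//|a] [//|b] _ _; rewrite ghat_br11_0 // mulr0.
- by move=> g Y _ _; apply/supp_vsP => -[c|c] // _; rewrite ffunE.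
move=> A x; split=> h.
  apply: (h (generated _)) => {h x}.
  - by move=> S.
  - by move=> y z hy hz S S1 SM SV SX; apply: (SM); [exact: hy | exact: hz].
  - by move=> y hy S S1 SM SV SX; apply: (SV); exact: hy.
  move=> y [i [eta ->]] S _ _ _; apply; constructor 3.
  exists eta, [ffun j => (j == i)%:R]; split.
    by apply/supp_vsP => -[c|c] // _; rewrite ffunE.
  rewrite -(gp_oddprod_single _ i eta); last exact: hexp0_Ghat.
  congr gp_oddprod; apply/ffunP => j; rewrite !ffunE.
  by case: eqP; rewrite ?scale1r ?scale0r.
apply: (h (gp_1 GP0 A)) => {h x}.
- exact: ss1.
- by move=> y z; exact: ssM.
- by move=> y; exact: ssV.
move=> y [[h hK ->]|[n [Z [nN /supp_vsP hZ ->]]]|[eta [v [_ ->]]]].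
- rewrite (_ : h = 1%g) ?sg_map1 ?gp_grp1; first exact: ss1.
  by apply/ffunP => j; rewrite hK // ffunE.
- rewrite (_ : Z = 0); last first.
    by apply/ffunP => c; have := hZ (inl c) isT; rewrite !ffunE.
  have [k nk] := wnil_exp nN.
  by rewrite [hexp _ _ _](Ghat_exp_n0 _ nk) gp_grp1; exact: ss1.
- exact: gen_oddprod.
Qed.

End LieSubsupergroups.

Section OddPart.
Variables (R : realType) (sigma : 'I_3 -> CC R).
Hypothesis sigmaV : \sum_i sigma i = 0.
Hypothesis sigma0 : exists l, sigma l = 0.
Notation GP0 := (Ghat_pair sigma).
Notation gg := (gp_grp (P := GP0)).
Notation gop := (gp_oddprod (P := GP0)).
Notation sd := (sd sigmaV).

(** Stated for any relabelling of the odd basis: with J = ['I_8] it gives the affine superspace,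
    with the index set of M the module. *)
Lemma G1_isom (J : finType) (e : od_gen -> J) (e' : J -> od_gen) :
    cancel e e' -> cancel e' e ->
  {l : lie_hom (odd_affine J) (sg_sub (gp_1 GP0)) | lie_isom l &
    forall A (v : odd_affine J A),
      val (l A v) = gop [ffun a => (v : {ffun J -> odd_of A}) (e a)]}.
Proof.
move=> eK e'K.
pose r (A : weil R) (v : odd_affine J A) : odd_affine od_gen A :=
  [ffun a => (v : {ffun J -> odd_of A}) (e a)] : {ffun _ -> odd_of A}.
pose r' (A : weil R) (v : odd_affine od_gen A) : odd_affine J A :=
  [ffun a => (v : {ffun od_gen -> odd_of A}) (e' a)] : {ffun _ -> odd_of A}.
case: (@lie_isom_of R (odd_affine J) (sg_sub (gp_1 GP0)) (fun A v => G1_pt sigma (r A v))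
  (fun A x => r' A (sd (val x)).2)).
- move=> A x y; apply: val_inj; rewrite /= -[RHS]/(gop _ * gop _)%g (G1_mul sigmaV sigma0).
  by congr gp_oddprod; apply/ffunP => a; rewrite !ffunE.
- move=> A B u x; apply: val_inj; rewrite /= gp_map_oddprod; congr gp_oddprod.
  by apply/ffunP => a; rewrite !ffunE.
- by move=> A v; apply/ffunP => a; rewrite /r' ffunE sd_oddprod //= ffunE e'K.
- move=> A x; rewrite -[RHS](G1_ptK sigmaV sigma0); congr G1_pt.
  by apply/ffunP => a; rewrite !ffunE eK.
- move=> A; apply: (aff_sub (S := gp_1 GP0)).
  exact: (aff_comp (aff_reindex A e) (@aff_gop R sigma A)).
- move=> A; apply: (aff_comp (aff_comp (aff_comp (aff_val A (gp_1 GP0))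
    (@aff_sd R sigma sigmaV sigma0 A)) (aff_snd A _ _)) (aff_reindex A e')).
by move=> l li lE; exists l => // A v; rewrite lE.
Qed.

End OddPart.

(** * One vanishing parameter: the underlying group and its projection *)

Section OneZeroProjection.
Variables (R : realType) (sigma : 'I_3 -> CC R).
Hypothesis sigmaV : \sum_i sigma i = 0.
Variables i j k : 'I_3.
Hypotheses (ij : i != j) (ik : i != k) (jk : j != k).
Hypotheses (si : sigma i = 0) (sj : sigma j != 0) (sk : sigma k != 0).
Notation GP0 := (Ghat_pair sigma).
Notation gg := (gp_grp (P := GP0)).
Notation gop := (gp_oddprod (P := GP0)).
Notation rd := (gp_rd GP0).
Notation G1 := (gp_1 GP0).
Notation Q := (sg_prod (sg_prod T3 SL2) SL2 : supergroup R).
Notation sd := (sd sigmaV).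

Let sigma0 : exists l, sigma l = 0. Proof. by exists i. Qed.
Let si0 : sigma i == 0. Proof. exact/eqP. Qed.

Definition Qmap A (g : big_pt (Ahat sigma) A) : Q A :=
  ((to_T3 (g i), to_SL2 (g j)), to_SL2 (g k)).

Definition Qinv A (q : Q A) : Ghat sigma A :=
  (emb (of_T3 _ q.1.1 : Ahat sigma i A) *
    (emb (of_SL2 _ q.1.2 : Ahat sigma j A) * emb (of_SL2 _ q.2 : Ahat sigma k A)))%g.

Lemma QmapM A : {morph (@Qmap A : Ghat sigma A -> Q A) : x y / (x * y)%g >-> (x * y)%g}.
Proof. by move=> x y; rewrite /Qmap !ffunE to_T3M !to_SL2M. Qed.

Lemma Qmap1 A : Qmap (1%g : Ghat sigma A) = 1%g.
Proof. by apply: (mulgI (Qmap (1%g : Ghat sigma A))); rewrite -QmapM !mulg1. Qed.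

Lemma Qmap_map A B (f : weil_hom A B) (g : Ghat sigma A) :
  Qmap (sg_map f g) = sg_map f (Qmap g).
Proof. by rewrite /Qmap !ffunE to_T3_map !to_SL2_map. Qed.

Lemma Qinv_i A (q : Q A) : (Qinv q : big_pt _ A) i = of_T3 _ q.1.1.
Proof. by rewrite ffunE [X in (_ * X)%g]ffunE emb_in !emb_out // !mulg1. Qed.

Lemma Qinv_j A (q : Q A) : (Qinv q : big_pt _ A) j = of_SL2 _ q.1.2.
Proof.
rewrite ffunE [X in (_ * X)%g]ffunE emb_in emb_out 1?eq_sym // emb_out //.
by rewrite mulg1 mul1g.
Qed.

Lemma Qinv_k A (q : Q A) : (Qinv q : big_pt _ A) k = of_SL2 _ q.2.
Proof.
rewrite ffunE [X in (_ * X)%g]ffunE emb_in emb_out 1?eq_sym // emb_out 1?eq_sym //.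
by rewrite !mul1g.
Qed.

Lemma ijkP (l : 'I_3) : [\/ l = i, l = j | l = k].
Proof.
move: ij ik jk; case: (ord3P i) => ->; case: (ord3P j) => ->; case: (ord3P k) => -> //= _ _ _;
  case: (ord3P l) => ->; by [constructor 1 | constructor 2 | constructor 3].
Qed.

Lemma QmapK A : cancel (@Qmap A) (@Qinv A).
Proof.
move=> g; apply/ffunP => l.
case: (ijkP l) => ->; rewrite ?Qinv_i ?Qinv_j ?Qinv_k /= ?to_T3K ?to_SL2K //.
Qed.

Lemma QinvK A : cancel (@Qinv A) (@Qmap A).
Proof.
by move=> [[x y] z]; rewrite /Qmap Qinv_i Qinv_j Qinv_k of_T3K // !of_SL2K.
Qed.

Lemma Qmap_inj A : injective (@Qmap A : Ghat sigma A -> Q A).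
Proof. exact: can_inj (@QmapK A). Qed.

Lemma QinvM A : {morph (@Qinv A : Q A -> Ghat sigma A) : x y / (x * y)%g >-> (x * y)%g}.
Proof. by move=> x y; apply: Qmap_inj; rewrite QmapM !QinvK. Qed.

Lemma Qinv_map A B (f : weil_hom A B) (q : Q A) :
  Qinv (sg_map f q) = sg_map f (Qinv q).
Proof. by apply: Qmap_inj; rewrite Qmap_map !QinvK. Qed.

Lemma aff_Qmap A : aff (@Qmap A : Ghat sigma A -> Q A).
Proof.
apply: aff_pair; first apply: aff_pair.
- exact: (aff_comp (aff_proj A (Ahat sigma) i) (@aff_to_T3 R (sigma i == 0) A)).
- exact: (aff_comp (aff_proj A (Ahat sigma) j) (@aff_to_SL2 R (sigma j == 0) A)).
- exact: (aff_comp (aff_proj A (Ahat sigma) k) (@aff_to_SL2 R (sigma k == 0) A)).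
Qed.

Lemma aff_Qinv A : aff (@Qinv A : Q A -> Ghat sigma A).
Proof.
apply: aff_big => l; case: (ijkP l) => ->.
- apply: (@aff_ext R A Q (Ahat sigma i) (fun q => of_T3 (sigma i == 0) q.1.1)) => [q|].
    by rewrite Qinv_i.
  exact: (aff_comp (aff_comp (aff_fst A _ _) (aff_fst A _ _)) (@aff_of_T3 R (sigma i == 0) A)).
- apply: (@aff_ext R A Q (Ahat sigma j) (fun q => of_SL2 (sigma j == 0) q.1.2)) => [q|].
    by rewrite Qinv_j.
  exact: (aff_comp (aff_comp (aff_fst A _ _) (aff_snd A _ _)) (@aff_of_SL2 R (sigma j == 0) A)).
- apply: (@aff_ext R A Q (Ahat sigma k) (fun q => of_SL2 (sigma k == 0) q.2)) => [q|].
    by rewrite Qinv_k.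
  exact: (aff_comp (aff_snd A _ _) (@aff_of_SL2 R (sigma k == 0) A)).
Qed.

Lemma rd_ptM A : {morph @rd_pt R sigma A : x y / (x * y)%g >-> (x * y)%g}.
Proof. by move=> x y; apply: val_inj; rewrite /= gp_grpM. Qed.

Lemma rd_pt_map A B (f : weil_hom A B) g : rd_pt (sg_map f g) = sg_map f (rd_pt (sigma := sigma) g).
Proof. by apply: val_inj; rewrite /= gp_map_grp. Qed.

Lemma aff_rd_pt A : aff (@rd_pt R sigma A).
Proof. by apply: (aff_sub (S := rd)); exact: (@aff_gg R sigma A). Qed.

Lemma rd_pt_inj A : cancel (@rd_pt R sigma A) (fun x => (sd (val x)).1).
Proof. by move=> g; rewrite /= (sd_grp sigmaV sigma0). Qed.

Lemma aff_rd_inv A : aff (fun x : sg_sub rd A => (sd (val x)).1 : Ghat sigma A).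
Proof.
exact: (aff_comp (aff_comp (aff_val A rd) (@aff_sd R sigma sigmaV sigma0 A)) (aff_fst A _ _)).
Qed.

Lemma Ghat_rd_isom : exists2 f : lie_hom (Ghat sigma) (sg_sub rd), lie_isom f &
  forall A g, val (f A g) = gg g.
Proof.
have [l li lE] := lie_isom_of rd_ptM rd_pt_map rd_pt_inj
  (@rd_ptK R sigma sigmaV sigma0) aff_rd_pt aff_rd_inv.
by exists l => // A g; rewrite lE.
Qed.

Lemma rd_Q_isom : isomorphic (sg_sub rd) Q.
Proof.
have sdM A (x y : sg_sub rd A) : (sd (val (x * y)%g)).1 = ((sd (val x)).1 * (sd (val y)).1)%g.
  by rewrite [sd _](sd_mulE sigmaV sigma0).
suff [l li _] : {l : lie_hom (sg_sub rd) Q | lie_isom l &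
    forall A, l A =1 (fun x => Qmap (sd (val x)).1)} by exists l.
apply: (lie_isom_of (g := fun A q => rd_pt (Qinv q))) => A.
- by move=> x y; rewrite sdM QmapM.
- move=> B f x; rewrite -Qmap_map; congr Qmap.
  by rewrite [sd _](sd_map sigmaV sigma0).
- by move=> x; rewrite QmapK (rd_ptK sigmaV sigma0).
- by move=> q; rewrite /= (sd_grp sigmaV sigma0) QinvK.
- exact: (aff_comp (@aff_rd_inv A) (@aff_Qmap A)).
- exact: (aff_comp (@aff_Qinv A) (@aff_rd_pt A)).
Qed.

End OneZeroProjection.

Section AbelianFactor.
Variables (R : realType) (sigma : 'I_3 -> CC R).
Hypothesis sigmaV : \sum_i sigma i = 0.
Notation GP0 := (Ghat_pair sigma).
Notation gg := (gp_grp (P := GP0)).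
Notation gop := (gp_oddprod (P := GP0)).
Notation sd := (sd sigmaV).

Lemma factor_mx_abelian (b : bool) A (x : factor R b A) : b -> factor_mx x = 1%:M.
Proof. by case: b x. Qed.

Lemma factor_abelian (b : bool) A (x y : factor R b A) : b -> (x * y = y * x)%g.
Proof.
case: b x y => // -[[a u] c] [[a' u'] c'] _; congr (_, _, _).
- exact: (@addrC (even_of A)).
- exact: unitg_mulC.
- exact: (@addrC (even_of A)).
Qed.

Lemma Ad_act_trivial A (g : Ghat sigma A) xi :
  (forall l, Ahat_mx g l = 1%:M) -> Ad_act g xi = xi.
Proof.
move=> g1; rewrite -[RHS](Ad_act1 sigmaV); apply/ffunP => a; rewrite !ffunE.
apply: eq_bigr => b _; congr (eact _ _); rewrite !Ghat_AdE //.
by apply: eq_bigr => l _; rewrite g1 Ahat_mx1.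
Qed.

Variable i : 'I_3.
Hypothesis si : sigma i = 0.
Let sigma0 : exists l, sigma l = 0. Proof. by exists i. Qed.
Let si0 : sigma i == 0. Proof. exact/eqP. Qed.

(** In the pair model, the i-th factor commutes with the other factors and, being Abelian, with
    itself; it moves no odd coordinate because its matrix is the identity. *)
Lemma Ahat_central : central (Ahat_sub sigma i).
Proof.
move=> A g _ [a ha <-].
apply: (can_inj (@sdK R sigma sigmaV sigma0 A)).
rewrite !(sd_mulE sigmaV sigma0) !(sd_grp sigmaV sigma0) /=; congr (_, _).
  apply/ffunP => l; rewrite !ffunE.
  have [->|li] := eqVneq l i; first exact: factor_abelian.
  by rewrite ha // mulg1 mul1g.
rewrite Ad_act0 add0r addr0 Ad_act_trivial // => l.
rewrite /Ahat_mx ffunE; have [->|li] := eqVneq l i; first exact: factor_mx_abelian.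
by rewrite ha // invg1 factor_mx1.
Qed.

Lemma emb_in_sub A (x : Ahat sigma i A) : Ahat_sub sigma i A (gg (emb x)).
Proof. by exists (emb x) => // m mi; rewrite emb_out. Qed.

Definition Ahat_pt A (x : Ahat sigma i A) : sg_sub (Ahat_sub sigma i) A :=
  Sub (gg (emb x)) (asboolT (emb_in_sub x)).

Lemma aff_emb A : aff (fun x : Ahat sigma i A => emb x).
Proof.
apply: aff_big => l; have [->|li] := eqVneq l i.
  by apply: (@aff_ext R A (Ahat sigma i) (Ahat sigma i) id) => [x|]; [rewrite emb_in | exact: aff_id].
apply: (@aff_ext R A (Ahat sigma i) (Ahat sigma l) (fun=> 1%g)) => [x|]; first by rewrite emb_out.
exact: (aff_1 _ _ (coord1_factor _)).
Qed.

Lemma Ahat_isom : isomorphic (sg_sub (Ahat_sub sigma i)) (Ahat sigma i).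
Proof.
pose f A (x : sg_sub (Ahat_sub sigma i) A) : Ahat sigma i A :=
  ((sd (val x)).1 : big_pt (Ahat sigma) A) i.
suff [l li _] : {l : lie_hom (sg_sub (Ahat_sub sigma i)) (Ahat sigma i) | lie_isom l &
    forall A, l A =1 f A} by exists l.
apply: (lie_isom_of (g := Ahat_pt)) => A.
- by move=> x y; rewrite /f /= [sd _](sd_mulE sigmaV sigma0) ffunE.
- by move=> B u x; rewrite /f /= [sd _](sd_map sigmaV sigma0) ffunE.
- move=> x; apply: val_inj; rewrite /f.
  have [a ha xa] : Ahat_sub sigma i A (val x) := asboolW (valP x).
  have {}xa : gg a = val x := xa.
  rewrite -xa (sd_grp sigmaV sigma0) /=; congr (gg _); apply/ffunP => m.
  by have [->|mi] := eqVneq m i; [rewrite emb_in | rewrite emb_out // ha].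
- by move=> x; rewrite /f /= (sd_grp sigmaV sigma0) emb_in.
- exact: (aff_comp (aff_comp (aff_comp (aff_val A (Ahat_sub sigma i))
    (@aff_sd R sigma sigmaV sigma0 A)) (aff_fst A _ _)) (aff_proj A (Ahat sigma) i)).
- apply: (aff_sub (S := Ahat_sub sigma i)).
  exact: (aff_comp (@aff_emb A) (@aff_gg R sigma A)).
Qed.

End AbelianFactor.

Lemma bits_bij (K : finType) (e : od_gen -> K) :
  #|K| = 8%N -> (forall a b, e a = e b -> forall l, minus a l = minus b l) ->
  {e' | cancel e e' & cancel e' e}.
Proof.
move=> K8 einj; have inj : injective e by move=> a b /einj/minus_inj.
have c8 : #|od_gen| = 8%N by rewrite card_prod card_option card_bool !card_ord.
have sur x : exists a, e a == x.
  have /codomP[a ->] : x \in codom e by apply: inj_card_onto => //; rewrite K8 c8.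
  by exists a.
exists (fun x => xchoose (sur x)) => x; last exact/eqP/(xchooseP (sur x)).
by apply: inj; apply/eqP/(xchooseP (sur (e x))).
Qed.

(** The two values of the sign along a degenerate factor index the two trivial summands. *)
Definition bit2 (b : bool) : unit + unit := if b then inr tt else inl tt.

Lemma bit2_inj : injective bit2.
Proof. by case; case. Qed.

Lemma bit_inj : injective bit.
Proof. by case; case. Qed.

Section OneZero.
Variables (R : realType) (sigma : 'I_3 -> CC R).
Hypothesis sigmaV : \sum_i sigma i = 0.
Variables i j k : 'I_3.
Hypotheses (ij : i != j) (ik : i != k) (jk : j != k).
Hypotheses (si : sigma i = 0) (sj : sigma j != 0) (sk : sigma k != 0).
Notation GP0 := (Ghat_pair sigma).
Notation gg := (gp_grp (P := GP0)).
Notation gop := (gp_oddprod (P := GP0)).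
Notation rd := (gp_rd GP0).
Notation G1 := (gp_1 GP0).
Notation Q := (sg_prod (sg_prod T3 SL2) SL2 : supergroup R).
Notation M := (outer (outer (dsum (triv_rep T3) (triv_rep T3)) box) box : rep Q).
Notation sd := (sd sigmaV).

Let sigma0 : exists l, sigma l = 0. Proof. by exists i. Qed.
Let si0 : sigma i == 0. Proof. exact/eqP. Qed.

Definition ebits (a : od_gen) : rix M :=
  ((bit2 (minus a i), bit (minus a j)), bit (minus a k)).

Lemma ebits_bij : {e' | cancel ebits e' & cancel e' ebits}.
Proof.
apply: bits_bij => [|a b [/bit2_inj ei /bit_inj ej /bit_inj ek] l].
  by rewrite !card_prod card_sum card_unit !card_ord.
by case: (ijkP ij ik jk l) => ->.
Qed.

(** This is [Ghat_AdE] with the factors in the order i, j, k: the i-th matrix is the identity, i.e.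
    the matrix of the sum of two trivial modules. *)
Lemma rmx_Ghat_Ad A (g : big_pt (Ahat sigma) A) a b :
  rmx (r := M) (Qmap i j k g) (ebits a) (ebits b) = Ghat_Ad (g : Ghat sigma A) a b.
Proof.
rewrite Ghat_AdE // (prod3_distinct _ ij ik jk) /= !val_to_SL2 //.
congr (_ * _ * _).
rewrite /Ahat_mx factor_mx_abelian // mxE bit_eq.
by rewrite /bit2; case: minus; case: minus.
Qed.

Lemma isom_affine8 : isomorphic (sg_sub G1) (odd_affine 'I_8).
Proof.
have [c8 _] : #|od_gen| = 8%N /\ True.
  by rewrite card_prod card_option card_bool !card_ord.
pose e (a : od_gen) : 'I_8 := cast_ord c8 (enum_rank a).
have [e' eK e'K] : {e' | cancel e e' & cancel e' e}.
  exists (fun x => enum_val (cast_ord (esym c8) x)) => x.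
    by rewrite /e cast_ordK enum_rankK.
  by rewrite /e enum_valK cast_ordKV.
have [l [m lm] _] := G1_isom sigmaV sigma0 eK e'K.
exists m, l => A; have [h1 h2] := lm A.
by split.
Qed.

Lemma Ghat_split_at_zero :
  let rd := gp_rd (Ghat_pair sigma) in
  let G1 := gp_1 (Ghat_pair sigma) in
  let Q := sg_prod (sg_prod T3 SL2) SL2 in
  let M := outer (outer (dsum (triv_rep T3) (triv_rep T3)) box) box in
  [/\ [/\ closed_lie_subsg (P := Ghat_pair sigma) (Ahat_sub sigma i),
          central (Ahat_sub sigma i),
          isomorphic (sg_sub (Ahat_sub sigma i)) (Ahat sigma i)
        & [/\ isomorphic (Ahat sigma i) T3,
              isomorphic (Ahat sigma j) SL2
            & isomorphic (Ahat sigma k) SL2]],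
      semidirect rd G1,
      [/\ exists2 f : lie_hom (Ghat sigma) (sg_sub rd), lie_isom f &
            forall A g, val (f A g) = gp_grp (P := Ghat_pair sigma) g
        & isomorphic (sg_sub rd) Q],
      [/\ closed_lie_subsg (P := Ghat_pair sigma) G1,
          normal G1,
          abelian_sg (sg_sub G1)
        & isomorphic (sg_sub G1) (odd_affine 'I_8)]
    & exists (ai : lie_hom (Ahat sigma i) T3)
        (aj : lie_hom (Ahat sigma j) SL2)
        (ak : lie_hom (Ahat sigma k) SL2)
        (phi : lie_hom (odd_module M) (sg_sub G1)),
      [/\ [/\ lie_isom ai, lie_isom aj & lie_isom ak],
          lie_isom phi,
          forall A (g : big_pt (Ahat sigma) A) (v : odd_module M A),
            val (phi A (rep_act (M := M) (ai A (g i), aj A (g j), ak A (g k)) v)) =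
            (gp_grp (P := Ghat_pair sigma) g * val (phi A v) *
             (gp_grp (P := Ghat_pair sigma) g)^-1)%g
        & exists (iota : lie_hom (odd_module M) (GGhat sigma))
            (p : lie_hom (GGhat sigma) Q),
          [/\ forall A v, iota A v = val (phi A v),
              forall A (g : big_pt (Ahat sigma) A),
                p A (gp_grp (P := Ghat_pair sigma) g) =
                (ai A (g i), aj A (g j), ak A (g k))
            & split_exact iota p]]].
Proof.
move=> rd' G1' Q' M'.
have [ai aii aiE] := T3_isom R si0.
have [aj aji ajE] := SL2_isom R sj.
have [ak aki akE] := SL2_isom R sk.
have [e' eK e'K] := ebits_bij.
have [phi phii phiE] := G1_isom sigmaV sigma0 eK e'K.
split; [split | | split | split |].
- exact: Ahat_closed_lie.
- exact: (Ahat_central sigmaV).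
- exact: (Ahat_isom sigmaV).
- by split; [exists ai | exists aj | exists ak].
- exact: (split_semidirect sigmaV).
- exact: (Ghat_rd_isom sigmaV si).
- exact: (rd_Q_isom sigmaV ij ik jk).
- exact: G1_closed_lie.
- exact: (G1_normal sigmaV).
- move=> A x y; apply: val_inj.
  rewrite -(G1_ptK sigmaV sigma0 x) -(G1_ptK sigmaV sigma0 y) /=.
  by rewrite -![RHS]/(gop _ * gop _)%g -[LHS]/(gop _ * gop _)%g !(G1_mul sigmaV sigma0) addrC.
- exact: isom_affine8.
exists ai, aj, ak, phi; split=> //.
  move=> A g v; rewrite !phiE.
  rewrite [RHS](conj_oddprod sigmaV sigma0); congr gp_oddprod.
  apply/ffunP => a; rewrite !ffunE.
  rewrite (reindex ebits); last by exists e' => x _.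
  apply: eq_bigr => b _; rewrite ffunE; congr (eact _ _).
  by rewrite aiE ajE akE -rmx_Ghat_Ad.
have [iota iotaE] : {l : lie_hom (odd_module M') (GGhat sigma) |
    forall A, l A =1 (fun v => val (phi A v))}.
  apply: lie_hom_of => [A x y|A B u x|A].
  - by rewrite lhM.
  - by rewrite lh_nat.
  - apply: (@aff_ext R A (odd_module M') (GGhat sigma)
      (fun v => gop [ffun a => (v : {ffun rix M' -> odd_of A}) (ebits a)])) => [v|].
      by rewrite phiE.
    exact: (aff_comp (aff_reindex A ebits) (@aff_gop R sigma A)).
have [p pE] : {l : lie_hom (GGhat sigma) Q' | forall A, l A =1 (fun x => Qmap i j k (sd x).1)}.
  apply: lie_hom_of => [A x y|A B u x|A].
  - by rewrite (sd_mulE sigmaV sigma0) QmapM.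
  - by rewrite (sd_map sigmaV sigma0) -Qmap_map.
  - exact: (aff_comp (aff_comp (@aff_sd R sigma sigmaV sigma0 A) (aff_fst A _ _))
      (@aff_Qmap R sigma i j k A)).
(* The section rebuilds the point of G from its three components and includes G in the
   supergroup. *)
have [s sE] : {l : lie_hom Q' (GGhat sigma) | forall A, l A =1 (fun q => gg (Qinv sigma i j k q))}.
  apply: lie_hom_of => [A x y|A B u x|A].
  - by rewrite (QinvM ij ik jk) // -gp_grpM.
  - by rewrite (Qinv_map ij ik jk) //= gp_map_grp.
  - exact: (aff_comp (@aff_Qinv R sigma i j k ij ik jk A) (@aff_gg R sigma A)).
exists iota, p; split=> [A v|A g|]; first exact: iotaE.
  by rewrite pE (sd_grp sigmaV sigma0) aiE ajE akE.
split=> [A x y|A x|].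
- rewrite !iotaE => /val_inj; have [m pm] := phii; have [pK _] := pm A.
  exact: (can_inj pK).
- have [m pm] := phii; have [_ mK] := pm A.
  rewrite pE; split=> [x1|[n ->]].
    (* A point with trivial image has trivial G-component, so it lies in the odd subsupergroup and
       comes from the module through the inverse of phi. *)
    have {}x1 : (sd x).1 = 1%g.
      apply: (Qmap_inj ij ik jk si sj sk).
      exact: etrans x1 (esym (Qmap1 sigma i j k A)).
    have Gx : gp_1 GP0 A x by apply/(G1P sigmaV sigma0).
    exists (m A (Sub x (asboolT Gx))).
    by rewrite iotaE mK.
  rewrite iotaE phiE (sd_oddprod sigmaV sigma0) /=.
  exact: (Qmap1 sigma i j k A).
- by exists s => A q; rewrite sE pE (sd_grp sigmaV sigma0) QinvK.
Qed.

End OneZero.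

(** * All parameters zero *)

Section AllZero.
Variables (R : realType) (sigma : 'I_3 -> CC R).
Hypothesis sigma_eq0 : forall l, sigma l = 0.
Notation GP0 := (Ghat_pair sigma).
Notation gg := (gp_grp (P := GP0)).
Notation gop := (gp_oddprod (P := GP0)).
Notation D := (dsum (triv_rep (@T3 R)) (triv_rep T3)).
Notation M := (outer (outer D D) D).
Notation T := (sg_prod (sg_prod T3 T3) T3 : supergroup R).

Let sigmaV : \sum_i sigma i = 0. Proof. by rewrite sum_eq0. Qed.
Let sigma0 : exists l, sigma l = 0. Proof. by exists i1. Qed.
Let s0 l : sigma l == 0. Proof. exact/eqP. Qed.
Notation sd := (sd sigmaV).

Lemma Ad_act_id A (g : Ghat sigma A) xi : Ad_act g xi = xi.
Proof. by apply: Ad_act_trivial => // l; exact: factor_mx_abelian. Qed.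

Lemma Ghat0_abelian : abelian_sg (GGhat sigma).
Proof.
move=> A x y; apply: (can_inj (@sdK R sigma sigmaV sigma0 A)).
rewrite !(sd_mulE sigmaV sigma0) !Ad_act_id addrC; congr (_, _).
by apply/ffunP => l; rewrite !ffunE factor_abelian.
Qed.

Definition ebits0 (a : od_gen) : rix M :=
  ((bit2 (minus a i1), bit2 (minus a i2)), bit2 (minus a i3)).

Lemma ebits0_bij : {e' | cancel ebits0 e' & cancel e' ebits0}.
Proof.
apply: bits_bij => [|a b [/bit2_inj e1 /bit2_inj e2 /bit2_inj e3] l].
  by rewrite !card_prod !card_sum !card_unit.
by case: (ord3P l) => ->.
Qed.

Lemma Ghat0_isom : isomorphic (GGhat sigma) (sg_prod T (odd_module M)).
Proof.
have [e' eK e'K] := ebits0_bij.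
pose tm A (g : big_pt (Ahat sigma) A) : T A :=
  ((to_T3 (g i1), to_T3 (g i2)), to_T3 (g i3)).
pose ti A (q : T A) : Ghat sigma A :=
  (emb (of_T3 _ q.1.1 : Ahat sigma i1 A) *
    (emb (of_T3 _ q.1.2 : Ahat sigma i2 A) * emb (of_T3 _ q.2 : Ahat sigma i3 A)))%g.
have ti1 A (q : T A) : (ti A q : big_pt _ A) i1 = of_T3 _ q.1.1.
  by rewrite ffunE [X in (_ * X)%g]ffunE emb_in !emb_out // !mulg1.
have ti2 A (q : T A) : (ti A q : big_pt _ A) i2 = of_T3 _ q.1.2.
  by rewrite ffunE [X in (_ * X)%g]ffunE emb_in !emb_out // mulg1 mul1g.
have ti3 A (q : T A) : (ti A q : big_pt _ A) i3 = of_T3 _ q.2.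
  by rewrite ffunE [X in (_ * X)%g]ffunE emb_in !emb_out // !mul1g.
have tmK A : cancel (tm A) (ti A).
  move=> g; apply/ffunP => l.
  by case: (ord3P l) => ->; rewrite ?ti1 ?ti2 ?ti3 /= to_T3K.
have tiK A : cancel (ti A) (tm A).
  by move=> [[x y] z]; rewrite /tm ti1 ti2 ti3 !of_T3K.
pose r A (v : odd_module M A) : odd_affine od_gen A :=
  [ffun a => (v : {ffun rix M -> odd_of A}) (ebits0 a)] : {ffun _ -> odd_of A}.
pose r' A (v : odd_affine od_gen A) : odd_module M A :=
  [ffun a => (v : {ffun od_gen -> odd_of A}) (e' a)] : {ffun rix M -> odd_of A}.
pose f A (x : GGhat sigma A) : sg_prod T (odd_module M) A := (tm A (sd x).1, r' A (sd x).2).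
suff [l li _] : {l : lie_hom (GGhat sigma) (sg_prod T (odd_module M)) | lie_isom l &
    forall A, l A =1 f A} by exists l.
pose g A (q : sg_prod T (odd_module M) A) : GGhat sigma A := ds (ti A q.1, r A q.2).
apply: (@lie_isom_of R _ _ f g) => A.
(* As Ad is trivial, the twisted product of the model is the direct product. *)
- move=> x y; rewrite /f (sd_mulE sigmaV sigma0) Ad_act_id; congr (_, _).
    by rewrite /tm /= !ffunE !to_T3M.
  by apply/ffunP => a; rewrite !ffunE.
- move=> B u x; rewrite /f (sd_map sigmaV sigma0); congr (_, _).
    by rewrite /tm /= !ffunE !to_T3_map.
  by apply/ffunP => a; rewrite !ffunE.
- move=> x; rewrite /g /f tmK -[RHS](sdK sigmaV sigma0); case: (sd x) => h v /=.
  by congr (ds (_, _)); apply/ffunP => a; rewrite !ffunE eK.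
- move=> [q v]; rewrite /f (dsK sigmaV sigma0) /= tiK; congr (_, _).
  by apply/ffunP => a; rewrite !ffunE e'K.
- have P l := aff_comp (aff_proj A (Ahat sigma) l) (@aff_to_T3 R (sigma l == 0) A).
  have Pt : aff (tm A : Ghat sigma A -> T A) := aff_pair (aff_pair (P i1) (P i2)) (P i3).
  apply: (aff_pair (Y := T) (Z := odd_module M)).
    exact: (aff_comp (aff_comp (@aff_sd R sigma sigmaV sigma0 A) (aff_fst A _ _)) Pt).
  exact: (aff_comp (aff_comp (@aff_sd R sigma sigmaV sigma0 A) (aff_snd A _ _)) (aff_reindex A e')).
- have Pt : aff (ti A : T A -> Ghat sigma A).
    apply: aff_big => l; case: (ord3P l) => ->.
    + apply: (@aff_ext R A T (Ahat sigma i1) (fun q => of_T3 (sigma i1 == 0) q.1.1)) => [q|].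
        by rewrite ti1.
      exact: (aff_comp (aff_comp (aff_fst A _ _) (aff_fst A _ _)) (@aff_of_T3 R (sigma i1 == 0) A)).
    + apply: (@aff_ext R A T (Ahat sigma i2) (fun q => of_T3 (sigma i2 == 0) q.1.2)) => [q|].
        by rewrite ti2.
      exact: (aff_comp (aff_comp (aff_fst A _ _) (aff_snd A _ _)) (@aff_of_T3 R (sigma i2 == 0) A)).
    + apply: (@aff_ext R A T (Ahat sigma i3) (fun q => of_T3 (sigma i3 == 0) q.2)) => [q|].
        by rewrite ti3.
      exact: (aff_comp (aff_snd A _ _) (@aff_of_T3 R (sigma i3 == 0) A)).
  apply: (@aff_comp R A _ _ _ (fun q : sg_prod T (odd_module M) A =>
    (ti A q.1, r A q.2) : sg_prod (Ghat sigma) (odd_affine od_gen) A) _ _ (@aff_ds R sigma A)).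
  apply: (aff_pair (Y := Ghat sigma) (Z := odd_affine od_gen)).
    exact: (aff_comp (aff_fst A _ _) Pt).
  exact: (aff_comp (aff_snd A _ _) (aff_reindex A ebits0)).
Qed.

End AllZero.

(** * Simplicity *)

Section TestAlgebra.
Variable R : realType.
Notation C := (CC R).

(* (a, b, c, d) stands for a + b eps + c eta + d eps eta in C[eps] (x) C[eta], *)
(* with eps even, eta odd, and eps^2 = eta^2 = 0. *)
Definition test_alg : Type := ((C^o * C^o) * (C^o * C^o))%type.
HB.instance Definition _ := Vector.copy test_alg ((C^o * C^o) * (C^o * C^o))%type.

Definition ta_one : test_alg := ((1, 0), (0, 0)).
Definition ta_mul (x y : test_alg) : test_alg :=
  ((x.1.1 * y.1.1, x.1.1 * y.1.2 + x.1.2 * y.1.1),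
   (x.1.1 * y.2.1 + x.2.1 * y.1.1,
    x.1.1 * y.2.2 + x.1.2 * y.2.1 + x.2.1 * y.1.2 + x.2.2 * y.1.1)).

Fact ta_mulA : associative ta_mul.
Proof.
by move=> [[a b] [c d]] [[a' b'] [c' d']] [[a'' b''] [c'' d'']]; rewrite /ta_mul /=;
  congr ((_, _), (_, _)); ring.
Qed.
Fact ta_mulC : commutative ta_mul.
Proof.
by move=> [[a b] [c d]] [[a' b'] [c' d']]; rewrite /ta_mul /=;
  congr ((_, _), (_, _)); ring.
Qed.
Fact ta_mul1 : left_id ta_one ta_mul.
Proof.
by move=> [[a b] [c d]]; rewrite /ta_mul /=; congr ((_, _), (_, _)); ring.
Qed.

Lemma ta_addE (x y : test_alg) : x + y =
  ((x.1.1 + y.1.1, x.1.2 + y.1.2), (x.2.1 + y.2.1, x.2.2 + y.2.2)).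
Proof. by []. Qed.
Fact ta_mulDl : left_distributive ta_mul +%R.
Proof.
move=> [[a b] [c d]] [[a' b'] [c' d']] [[a'' b''] [c'' d'']].
by rewrite !ta_addE /ta_mul /=; congr ((_, _), (_, _)); ring.
Qed.
Fact ta_1_neq0 : ta_one != 0.
Proof. by apply/eqP => -[] /eqP; rewrite oner_eq0. Qed.
HB.instance Definition _ := GRing.Zmodule_isComNzRing.Build test_alg
  ta_mulA ta_mulC ta_mul1 ta_mulDl ta_1_neq0.

Lemma ta_scaleE (z : C) (x : test_alg) : z *: x =
  (((z : C^o) * x.1.1, (z : C^o) * x.1.2), ((z : C^o) * x.2.1, (z : C^o) * x.2.2)).
Proof. by []. Qed.

Fact ta_scaleAl (z : C) (x y : test_alg) : z *: (ta_mul x y) = ta_mul (z *: x) y.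
Proof.
move: x y => [[a b] [c d]] [[a' b'] [c' d']].
rewrite !ta_scaleE /ta_mul /=; congr ((_, _), (_, _)); ring.
Qed.
HB.instance Definition _ := GRing.LSemiModule_isLSemiAlgebra.Build C test_alg ta_scaleAl.
HB.instance Definition _ := GRing.Lalgebra_isComAlgebra.Build C test_alg.
HB.instance Definition _ := Algebra_isFalgebra.Build C test_alg.

Fact ta_fst_linear : linear (fun x : test_alg => x.1 : (C^o * C^o)%type).
Proof. by move=> z [x y] [x' y']. Qed.
Fact ta_snd_linear : linear (fun x : test_alg => x.2 : (C^o * C^o)%type).
Proof. by move=> z [x y] [x' y']. Qed.
Fact ta_body_linear : linear (fun x : test_alg => x.1.1 : C^o).
Proof. by move=> z [x y] [x' y']. Qed.

Lemma lker_ex (V : vectType C) (f : test_alg -> V) : linear f ->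
  {U : {vspace test_alg} | forall x, (x \in U) = (f x == 0)}.
Proof.
move=> lf; pose fM := GRing.isLinear.Build _ _ _ _ _ lf.
pose g : {linear test_alg -> V} := HB.pack f fM.
by exists (lker (linfun g)) => x; rewrite memv_ker lfunE.
Qed.

(* Kept opaque, since unification would otherwise compare kernels. *)
Definition ta0 : {vspace test_alg} := sval (lker_ex ta_snd_linear).
Definition ta1 : {vspace test_alg} := sval (lker_ex ta_fst_linear).
Definition taN : {vspace test_alg} := sval (lker_ex ta_body_linear).

Lemma ta0P x : (x \in ta0) = (x.2 == 0). Proof. exact: (svalP (lker_ex ta_snd_linear)). Qed.
Lemma ta1P x : (x \in ta1) = (x.1 == 0). Proof. exact: (svalP (lker_ex ta_fst_linear)). Qed.
Lemma taNP x : (x \in taN) = (x.1.1 == 0). Proof. exact: (svalP (lker_ex ta_body_linear)). Qed.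

Lemma ta0I x : x \in ta0 -> exists a b, x = ((a, b), (0, 0)).
Proof. by case: x => [[a b] y]; rewrite ta0P => /eqP /= ->; exists a, b. Qed.
Lemma ta1I x : x \in ta1 -> exists c d, x = ((0, 0), (c, d)).
Proof. by case: x => [y [c d]]; rewrite ta1P => /eqP /= ->; exists c, d. Qed.
Lemma taNI x : x \in taN -> exists b c d, x = ((0, b), (c, d)).
Proof. by case: x => [[a b] [c d]]; rewrite taNP => /eqP /= ->; exists b, c, d. Qed.

Lemma ta_split01 a b c d :
  ((a, b), (c, d)) = ((a, b), (0, 0)) + ((0, 0), (c, d)) :> test_alg.
Proof. by rewrite ta_addE /= !addr0 !add0r. Qed.

Fact ta_full01 : (ta0 + ta1)%VS = fullv.
Proof.
apply/eqP; rewrite eqEsubv subvf; apply/subvP => -[[a b] [c d]] _.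
by rewrite ta_split01; apply: memv_add; [rewrite ta0P | rewrite ta1P].
Qed.

Fact ta_dir01 : (ta0 :&: ta1)%VS = 0%VS.
Proof.
apply/eqP; rewrite -subv0; apply/subvP => x; rewrite memv_cap => /andP[/ta0I[a [b ->]]].
by rewrite ta1P memv0 => /eqP /= [-> ->].
Qed.

Fact ta_00 : {in ta0 & ta0, forall x y : test_alg, ta_mul x y \in ta0}.
Proof.
move=> _ _ /ta0I[a [b ->]] /ta0I[a' [b' ->]]; rewrite ta0P /ta_mul /=.
by rewrite !(mulr0, mul0r, addr0).
Qed.

Fact ta_01 : {in ta0 & ta1, forall x y : test_alg, ta_mul x y \in ta1}.
Proof.
move=> _ _ /ta0I[a [b ->]] /ta1I[c [d ->]]; rewrite ta1P /ta_mul /=.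
by rewrite !(mulr0, mul0r, addr0).
Qed.

(** The odd part is spanned by eta and eps eta, and eta^2 = 0. *)
Lemma ta_11_0 : {in ta1 & ta1, forall x y : test_alg, ta_mul x y = 0}.
Proof.
move=> _ _ /ta1I[c [d ->]] /ta1I[c' [d' ->]]; rewrite /ta_mul /=.
by rewrite !(mulr0, mul0r, addr0).
Qed.

Fact ta_Nfull : (<[1 : test_alg]> + taN)%VS = fullv.
Proof.
apply/eqP; rewrite eqEsubv subvf; apply/subvP => -[[a b] [c d]] _.
have -> : ((a, b), (c, d)) = a *: (1 : test_alg) + ((0, b), (c, d)).
  by rewrite ta_addE ta_scaleE /= mulr1 !mulr0 !addr0 !add0r.
by apply: memv_add; [rewrite memvZ ?memv_line | rewrite taNP].
Qed.

Fact ta_Ndir : (<[1 : test_alg]> :&: taN)%VS = 0%VS.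
Proof.
apply/eqP; rewrite -subv0; apply/subvP => x; rewrite memv_cap => /andP[/vlineP[z ->]].
by rewrite taNP memv0 ta_scaleE /= !mulr1 !mulr0 => /eqP ->.
Qed.

Fact ta_Nideal (x y : test_alg) : y \in taN -> ta_mul x y \in taN /\ ta_mul y x \in taN.
Proof.
move=> /taNI[b [c [d ->]]]; rewrite (ta_mulC ((0, b), (c, d))) taNP /ta_mul /=.
by rewrite mulr0.
Qed.

Fact ta_Ngraded : taN = (taN :&: ta0 + taN :&: ta1)%VS.
Proof.
apply/eqP; rewrite eqEsubv; apply/andP; split; last first.
  by rewrite subv_add !capvSl.
apply/subvP => _ /taNI[b [c [d ->]]]; rewrite ta_split01.
by apply: memv_add; rewrite memv_cap taNP /= eqxx //=; rewrite (ta0P, ta1P).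
Qed.

(** Since eps^2 = eta^2 = 0, only eps eta survives in a product of two nilpotents; hence the
    exponent 3 in [ta_Nnil]. *)
Fact ta_N2 (x : test_alg) : x \in (taN * taN)%VS -> exists d, x = ((0, 0), (0, d)).
Proof.
pose f (x : test_alg) : (C^o * C^o * C^o)%type := (x.1, x.2.1).
have lf : linear f by move=> z [x1 [x2 x3]] [y1 [y2 y3]].
have [U UP] := lker_ex lf.
suff: (taN * taN <= U)%VS.
  move=> /subvP h /h; rewrite UP; case: x => [[a b] [c d]] /eqP [-> -> ->].
  by exists d.
apply/prodvP => _ _ /taNI[b [c [d ->]]] /taNI[b' [c' [d' ->]]].
rewrite UP -[_ * _]/(ta_mul _ _) /ta_mul /f /= .
by rewrite !(mulr0, mul0r, addr0).
Qed.

Fact ta_Nnil : exists n : nat, (taN ^+ n)%VS = 0%VS.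
Proof.
exists 3%N; apply/eqP; rewrite -subv0 !expvSl expv0 prodv1.
apply/prodvP => _ y /taNI[b [c [d ->]]] /ta_N2[e ->]; rewrite memv0.
rewrite -[_ * _]/(ta_mul _ _) /ta_mul /=.
by rewrite !(mulr0, mul0r, addr0).
Qed.

Definition testW : weil R :=
  @Weil R test_alg ta0 ta1 taN ta_full01 ta_dir01 (etrans (ta0P 1) (eqxx 0)) ta_00 ta_01
    (fun x y x1 y1 => eq_ind_r (fun z => z \in ta0) (mem0v ta0) (ta_11_0 x1 y1))
    (fun x _ y => mulrC x y)
    (fun x y x1 y1 => etrans (ta_11_0 x1 y1) (esym (etrans (congr1 -%R (ta_11_0 y1 x1)) (oppr0 _))))
    ta_Nfull ta_Ndir ta_Nideal ta_Ngraded ta_Nnil.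

End TestAlgebra.

Section TestElements.
Variable R : realType.
Notation C := (CC R).
Notation W := (testW R).

(** [lamc] and [lamd] are the coefficients of eta and of eps eta in an odd element. *)
Definition lamc (x : odd_of W) : C := (o2a x : test_alg R).2.1.
Definition lamd (x : odd_of W) : C := (o2a x : test_alg R).2.2.
Definition eps_coef (a : even_of W) : C := (e2a a : test_alg R).1.2.
Definition teps : even_of W := vsproj (w0 W) (((0, 1), (0, 0)) : test_alg R).
Definition teta : odd_of W := vsproj (w1 W) (((0, 0), (1, 0)) : test_alg R).

Lemma e2a_teps : e2a teps = ((0, 1), (0, 0)) :> test_alg R.
Proof. by rewrite /e2a /teps vsprojK // [w0 W]/(ta0 R) ta0P. Qed.

Lemma o2a_teta : o2a teta = ((0, 0), (1, 0)) :> test_alg R.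
Proof. by rewrite /o2a /teta vsprojK // [w1 W]/(ta1 R) ta1P. Qed.

Lemma wnil_teps : wnil teps.
Proof. by rewrite /wnil e2a_teps [wN W]/(taN R) taNP. Qed.

Lemma o2aW (x : odd_of W) : o2a x = ((0, 0), (lamc x, lamd x)) :> test_alg R.
Proof.
have [c [d e]] := @ta1I R (o2a x) (o2a_in x).
by rewrite /lamc /lamd e.
Qed.

Lemma e2aW (n : even_of W) : wnil n -> e2a n = ((0, eps_coef n), (0, 0)) :> test_alg R.
Proof.
have [a [b e]] := @ta0I R (e2a n) (e2a_in n).
by rewrite /wnil /eps_coef e [wN W]/(taN R) taNP /= => /eqP ->.
Qed.

Lemma omulW (x y : odd_of W) : omul x y = 0.
Proof.
apply: e2a_inj; rewrite e2a_omul e2a0.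
exact: (@ta_11_0 R _ _ (o2a_in x) (o2a_in y)).
Qed.

Lemma wnil_sqW (n : even_of W) : wnil n -> n * n = 0.
Proof.
move=> nN; apply: e2a_inj; rewrite e2a_mul e2a0 (e2aW nN).
rewrite -[LHS]/(ta_mul _ _) /ta_mul /=.
by rewrite !(mulr0, mul0r, addr0).
Qed.

Lemma lamcD x y : lamc (x + y) = lamc x + lamc y.
Proof. by rewrite /lamc o2aD. Qed.
Lemma lamdD x y : lamd (x + y) = lamd x + lamd y.
Proof. by rewrite /lamd o2aD. Qed.
Lemma lamcZ z x : lamc (z *: x) = z * lamc x.
Proof. by rewrite /lamc o2aZ. Qed.
Lemma lamdZ z x : lamd (z *: x) = z * lamd x.
Proof. by rewrite /lamd o2aZ. Qed.
Lemma lamc0 : lamc 0 = 0.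
Proof. by rewrite /lamc o2a0. Qed.
Lemma lamd0 : lamd 0 = 0.
Proof. by rewrite /lamd o2a0. Qed.
Lemma lamc_sum (I : finType) (F : I -> odd_of W) :
  lamc (\sum_i F i) = \sum_i lamc (F i).
Proof. exact: (big_morph _ lamcD lamc0). Qed.
Lemma lamd_sum (I : finType) (F : I -> odd_of W) :
  lamd (\sum_i F i) = \sum_i lamd (F i).
Proof. exact: (big_morph _ lamdD lamd0). Qed.

Lemma lamc_eact n x : wnil n -> lamc (eact n x) = 0.
Proof.
move=> nN; rewrite /lamc o2a_act (e2aW nN) o2aW -[_ * _]/(ta_mul _ _) /ta_mul /=.
by rewrite !(mulr0, mul0r, addr0).
Qed.

Lemma lamd_eact n x : wnil n -> lamd (eact n x) = eps_coef n * lamc x.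
Proof.
move=> nN; rewrite {1}/lamd o2a_act (e2aW nN) o2aW -[_ * _]/(ta_mul _ _) /ta_mul /=.
by rewrite !(mulr0, mul0r, addr0, add0r).
Qed.

Lemma eact_scal (A : weil R) z (a : even_of A) (x : odd_of A) :
  eact (z *: a) x = z *: eact a x.
Proof. by apply: o2a_inj; rewrite o2aZ !o2a_act e2aZ scalerAl. Qed.

Lemma lamc_teta : lamc teta = 1. Proof. by rewrite /lamc o2a_teta. Qed.
Lemma eps_coef_teps : eps_coef teps = 1. Proof. by rewrite /eps_coef e2a_teps. Qed.

Lemma scal_teps_inj (a b a' b' : C) :
  a *: 1 + b *: teps = a' *: 1 + b' *: teps -> a = a' /\ b = b'.
Proof.
move/(congr1 (fun x => e2a x)); rewrite !e2aD !e2aZ e2a_teps e2a_1 => e.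
have := congr1 (fun x : test_alg R => x.1) e.
rewrite -[_.1 in LHS]/(a * 1 + b * 0, a * 0 + b * 1) -[_.1 in RHS]/(a' * 1 + b' * 0, a' * 0 + b' * 1).
by rewrite !(mulr1, mulr0, addr0, add0r) => -[-> ->].
Qed.

(** Over this algebra the exponentials in the odd relations have parameter 0, so the semidirect
    model applies whatever sigma is. *)
Lemma hexp11W (sigma : 'I_3 -> C) (x y : odd_of W) i j :
  hexp (Ghat_pair sigma) (omul x y) (hbr11 i j) = 1%g /\
  hexp (Ghat_pair sigma) (omul x y) (2^-1 *: hbr11 i i) = 1%g.
Proof. by rewrite omulW; split; exact: Ghat_exp_0n. Qed.

End TestElements.

Lemma sum_pick (K : pzRingType) (I : finType) (a : I) (F G : I -> K) e :
  \sum_b ((if b == a then F b else 0) + e * G b) = F a + e * \sum_b G b.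
Proof.
rewrite big_split -mulr_sumr /=; congr (_ + _).
by rewrite (sum_unique (i0 := a)) ?eqxx // => b /negPf ->.
Qed.

(** * Infinitesimal consequences of normality *)

Section NormalSubsupergroups.
Variables (R : realType) (sigma : 'I_3 -> CC R).
Hypothesis sigmaV : \sum_i sigma i = 0.
Notation C := (CC R).
Notation W := (testW R).
Notation GP0 := (Ghat_pair sigma).
Notation gg := (gp_grp (P := GP0)).
Notation gop := (gp_oddprod (P := GP0)).
Notation lsa := {ffun ev_gen + od_gen -> C^o}.
Notation ev := (ev_incl (P := GP0)).
Notation od := (od_incl (P := GP0)).
Notation hx := (@hexp11W R sigma).
Notation phi := (@to_sd R sigma sigmaV W).

Lemma phiM1 x y : (phi (x * y)%g).1 = ((phi x).1 * (phi y).1)%g.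
Proof. exact: (congr1 fst (to_sdM sigmaV hx x y)). Qed.
Lemma phiM2 x y : (phi (x * y)%g).2 = Ad_act ((phi y).1^-1)%g (phi x).2 + (phi y).2.
Proof. exact: (congr1 snd (to_sdM sigmaV hx x y)). Qed.
Lemma phiV1 x : (phi (x^-1)%g).1 = ((phi x).1^-1)%g.
Proof. exact: (congr1 fst (to_sdV sigmaV hx x)). Qed.
Lemma phiV2 x : (phi (x^-1)%g).2 = - Ad_act (phi x).1 (phi x).2.
Proof. exact: (congr1 snd (to_sdV sigmaV hx x)). Qed.
Lemma phi_gg g : phi (gg g) = (g, 0).
Proof. exact: (to_sd_grp sigmaV hx). Qed.
Lemma phi_gop xi : phi (gop xi) = (1%g, xi).
Proof. exact: (to_sd_oddprod sigmaV hx). Qed.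

(** An element xi of W_1 (x) g_1 is eta [cof xi] + eps eta [dof xi], with both coefficients in
    g_1. *)
Definition cof (xi : {ffun od_gen -> odd_of W}) : {ffun od_gen -> C^o} :=
  [ffun a => lamc (xi a)].
Definition dof (xi : {ffun od_gen -> odd_of W}) : {ffun od_gen -> C^o} :=
  [ffun a => lamd (xi a)].
Definition cst_grp (A : weil R) (g : Ghat sigma weilC) : Ghat sigma A :=
  sg_map (scal_hom A) g.
Lemma cst_grpV A g : ((cst_grp A g)^-1)%g = cst_grp A (g^-1)%g.
Proof. by rewrite /cst_grp sg_mapV. Qed.
Definition adZ_act (Z : {ffun ev_gen -> C^o}) (Y : {ffun od_gen -> C^o}) :
  {ffun od_gen -> C^o} := [ffun a => \sum_b adZ sigma Z a b * (Y b : C)].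

Lemma emap_scalE (A : weil R) (a : even_of weilC) :
  emap (scal_hom A) a = (e2a a : C) *: 1.
Proof. by apply: e2a_inj; rewrite e2a_map e2aZ e2a_1. Qed.

Lemma cof_cst g xi : cof (Ad_act (cst_grp W g) xi) = Ad1 (P := GP0) g (cof xi).
Proof.
apply/ffunP => a; rewrite !ffunE lamc_sum; apply: eq_bigr => b _.
by rewrite ffunE [Ghat_Ad _ _ _]Ghat_Ad_map emap_scalE eact_scal eact1 lamcZ.
Qed.

Lemma dof_cst g xi : dof (Ad_act (cst_grp W g) xi) = Ad1 (P := GP0) g (dof xi).
Proof.
apply/ffunP => a; rewrite !ffunE lamd_sum; apply: eq_bigr => b _.
by rewrite ffunE [Ghat_Ad _ _ _]Ghat_Ad_map emap_scalE eact_scal eact1 lamdZ.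
Qed.

Lemma cof_exp n Z xi : wnil n -> cof (Ad_act (Ghat_exp sigma n Z) xi) = cof xi.
Proof.
move=> nN; apply/ffunP => a; rewrite !ffunE lamc_sum (sum_unique (i0 := a)).
  rewrite Ghat_Ad_exp // ?wnil_sqW // eqxx eactDl eact1 lamcD eact_scal lamcZ.
  by rewrite lamc_eact // mulr0 addr0.
move=> b; rewrite eq_sym => /negPf ab.
rewrite Ghat_Ad_exp // ?wnil_sqW // ab eactDl eact0l lamcD lamc0 eact_scal lamcZ.
by rewrite lamc_eact // mulr0 addr0.
Qed.

(** With n = t eps, exp(n Z) acts as 1 + t eps ad(Z): it adds t ad(Z) of the eta coefficient to the
    eps eta coefficient. *)
Lemma dof_exp n Z xi : wnil n ->
  dof (Ad_act (Ghat_exp sigma n Z) xi) =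
  dof xi + (eps_coef n : C) *: adZ_act Z (cof xi).
Proof.
move=> nN; apply/ffunP => a; rewrite !ffunE lamd_sum.
have E b : lamd (eact (Ghat_Ad (Ghat_exp sigma n Z) a b) (xi b)) =
    (if b == a then lamd (xi b) else 0) + eps_coef n * (adZ sigma Z a b * lamc (xi b)).
  rewrite Ghat_Ad_exp // ?wnil_sqW // eactDl lamdD eact_scal lamdZ (lamd_eact _ nN).
  rewrite mulrCA [b == a]eq_sym; congr (_ + _).
  by case: eqP => _; rewrite ?eact1 ?eact0l ?lamd0.
under eq_bigr => b _ do rewrite E.
rewrite (sum_pick a (fun b => lamd (xi b)) (fun b => adZ sigma Z a b * lamc (xi b))).
have -> : \sum_b adZ sigma Z a b * lamc (xi b) = \sum_b adZ sigma Z a b * (cof xi b : C).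
  by apply: eq_bigr => b _; rewrite ffunE.
by [].
Qed.

Variables (K : set (Ghat sigma weilC)) (k : {vspace lsa}).
Variable (S : forall A, set (GP GP0 A)).
Hypotheses (Kgrp : subgroup K) (ksub : sub_lsa (P := GP0) k).
Hypothesis kAd : forall g Y, K g -> od Y \in k -> od (Ad1 (P := GP0) g Y) \in k.
Hypothesis SE : forall A (x : GP GP0 A), @S A x <-> generated (fun y =>
        [\/ exists2 g, K g & y = gg (cst_grp A g),
            exists n Z, [/\ e2a n \in wN A, ev Z \in k & y = gg (Ghat_exp sigma n Z)]
          | exists (eta : odd_of A) v, od v \in k /\
              y = gop [ffun i => v i *: eta]]) x.
Hypothesis Snormal : normal S.

(** Membership in W_1 (x) k_1. *)
Definition k1W (xi : {ffun od_gen -> odd_of W}) := od (cof xi) \in k /\ od (dof xi) \in k.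

Lemma odD Y Y' : od (Y + Y') = od Y + od Y'.
Proof. by apply/ffunP => -[c|c]; rewrite !ffunE ?addr0. Qed.

Lemma odZ (z : C) Y : od (z *: Y) = z *: od Y.
Proof. by apply/ffunP => -[c|c]; rewrite !ffunE ?scaler0. Qed.

Lemma cofD xi eta : cof (xi + eta) = cof xi + cof eta.
Proof. by apply/ffunP => a; rewrite !ffunE lamcD. Qed.
Lemma dofD xi eta : dof (xi + eta) = dof xi + dof eta.
Proof. by apply/ffunP => a; rewrite !ffunE lamdD. Qed.
Lemma cofZ (z : C) xi : cof (z *: xi) = z *: cof xi.
Proof. by apply/ffunP => a; rewrite !ffunE lamcZ. Qed.
Lemma dofZ (z : C) xi : dof (z *: xi) = z *: dof xi.
Proof. by apply/ffunP => a; rewrite !ffunE lamdZ. Qed.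

Lemma k1W0 : k1W 0.
Proof.
have c0 : cof 0 = 0 by apply/ffunP => a; rewrite !ffunE lamc0.
have d0 : dof 0 = 0 by apply/ffunP => a; rewrite !ffunE lamd0.
have o0 : od 0 = 0 by apply/ffunP => -[c|c]; rewrite !ffunE.
by split; rewrite ?c0 ?d0 o0 mem0v.
Qed.

Lemma k1WD xi eta : k1W xi -> k1W eta -> k1W (xi + eta).
Proof. by move=> [h1 h2] [h3 h4]; split; rewrite ?cofD ?dofD odD memvD. Qed.

Lemma k1WN xi : k1W xi -> k1W (- xi).
Proof. by move=> [h1 h2]; rewrite -scaleN1r; split; rewrite ?cofZ ?dofZ odZ memvZ. Qed.

Lemma k_adZ Z Y : ev Z \in k -> od Y \in k -> od (adZ_act Z Y) \in k.
Proof. by move=> hZ hY; rewrite -lbr_adZ //; exact: ksub.2. Qed.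

Definition stab (g : Ghat sigma W) := forall xi, k1W xi -> k1W (Ad_act g xi).

(** Induction on generators. Stability under the inverse of the G-component is part of the invariant
    because the twisted product applies Ad of an inverse to the odd part. *)
Lemma stab_S x : @S W x ->
  [/\ stab (phi x).1, stab ((phi x).1^-1)%g & k1W (phi x).2].
Proof.
move=> /SE h; apply: (h (fun x => [/\ stab (phi x).1, stab ((phi x).1^-1)%g & k1W (phi x).2])).
- rewrite (to_sd1 sigmaV hx); have s1 : stab 1%g by move=> xi; rewrite Ad_act1.
  by split; rewrite /= ?invg1 //; exact: k1W0.
- move=> y z [sy sy' ky] [sz sz' kz]; rewrite (to_sdM sigmaV hx).
  split=> [xi kxi|xi kxi|]; rewrite /= ?invgM ?Ad_actM //; first exact/sy/sz.
    exact/sz'/sy'.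
  by apply: k1WD => //; exact: sz'.
- move=> y [sy sy' ky].
  have -> : phi (y^-1)%g = (((phi y).1^-1)%g, - Ad_act (phi y).1 (phi y).2).
    exact: (to_sdV sigmaV hx y).
  split; first exact: sy'; last exact/k1WN/sy.
  have -> : ((((phi y).1^-1)%g, - Ad_act (phi y).1 (phi y).2).1^-1)%g = (phi y).1.
    exact: invgK.
  exact: sy.
move=> y [[g Kg ->]|[n [Z [nN kZ ->]]]|[eta [v [kv ->]]]].
- have st g' : K g' -> stab (cst_grp W g').
    by move=> Kg' xi [h1 h2]; split; rewrite ?cof_cst ?dof_cst; exact: kAd.
  rewrite (to_sd_grp sigmaV hx); split=> /=; first exact: st.
    by rewrite [X in stab X]cst_grpV; apply: st; case: Kgrp => _ _; apply.
  exact: k1W0.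
- have nN' : wnil n by exact: nN.
  rewrite (to_sd_grp sigmaV hx); split=> /=.
  + move=> xi [h1 h2]; split; first by rewrite cof_exp.
    by rewrite dof_exp // odD odZ memvD // memvZ // k_adZ.
  + move=> xi [h1 h2].
    (* The action of the inverse exponential is found by solving Ad(exp(n Z)) u = xi, which
       [cof_exp] and [dof_exp] make explicit. *)
    have [u uE xiE] : exists2 u, Ad_act (Ghat_exp sigma n Z)^-1%g xi = u &
        xi = Ad_act (Ghat_exp sigma n Z) u.
      by exists (Ad_act (Ghat_exp sigma n Z)^-1%g xi); rewrite // -Ad_actM // mulgV Ad_act1.
    have cy : cof xi = cof u by rewrite xiE; exact: cof_exp.
    have dy : dof u = dof xi - (eps_coef n : C) *: adZ_act Z (cof xi).
      by rewrite xiE dof_exp // (cof_exp Z u nN') addrK.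
    rewrite [X in k1W X]uE; split; first by rewrite -cy.
    by rewrite dy -scaleNr odD odZ memvD // memvZ // k_adZ.
  + exact: k1W0.
- rewrite (to_sd_oddprod sigmaV hx); have s1 : stab 1%g by move=> xi; rewrite Ad_act1.
  split; rewrite /= ?invg1 //.
  have -> : [ffun i => (v i : C) *: eta] = [ffun i => v i *: eta] :> {ffun od_gen -> odd_of W} by [].
  have E (z : C) : od (z *: v) \in k by rewrite odZ memvZ.
  split; [have := E (lamc eta) | have := E (lamd eta)]; congr (od _ \in k);
    by apply/ffunP => a; rewrite !ffunE ?lamcZ ?lamdZ mulrC.
Qed.

Lemma S_oddprod A (eta : odd_of A) v : od v \in k -> @S A (gop [ffun i => v i *: eta]).
Proof. by move=> kv; apply/SE => S' _ _ _; apply; constructor 3; exists eta, v. Qed.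

Lemma S_cst A g : K g -> @S A (gg (cst_grp A g)).
Proof. by move=> Kg; apply/SE => S' _ _ _; apply; constructor 1; exists g. Qed.

Lemma S_exp A n Z : wnil n -> ev Z \in k -> @S A (gg (Ghat_exp sigma (n : even_of A) Z)).
Proof. by move=> nN kZ; apply/SE => S' _ _ _; apply; constructor 2; exists n, Z. Qed.

(** The element in question is the odd component of the conjugate of g by the odd product of xi. *)
Lemma S_conj_odd (g : Ghat sigma W) xi : @S W (gg g) ->
  k1W (Ad_act (g^-1)%g xi - xi).
Proof.
move=> Sg; have [_ _] := stab_S (Snormal (gop xi) Sg).
rewrite !phiM2 phiV1 phiV2 phi_gg phi_gop /= !invg1.
by rewrite !Ad_act1 // addr0.
Qed.

Lemma S_conj_grp (g : Ghat sigma W) xi : @S W (gop xi) -> k1W (Ad_act g xi).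
Proof.
move=> Sxi; have [_ _] := stab_S (Snormal (gg g) Sxi).
rewrite !phiM2 !phiV1 phiV2 phi_gg phi_gop /= invgK.
by rewrite !Ad_act0 oppr0 addr0 add0r.
Qed.

(** In [S_conj_odd] take g = exp(eps Z) and xi = eta Y: the odd component is - eps eta [Z, Y], so
    its eps eta coefficient lies in k. *)
Lemma k_bracket_odd Z Y : ev Z \in k -> od (adZ_act Z Y) \in k.
Proof.
move=> kZ; pose xi : {ffun od_gen -> odd_of W} := [ffun a => (Y a : C) *: teta R].
have [u uE xiE] : exists2 u, Ad_act (Ghat_exp sigma (teps R) Z)^-1%g xi = u &
    xi = Ad_act (Ghat_exp sigma (teps R) Z) u.
  exists (Ad_act (Ghat_exp sigma (teps R) Z)^-1%g xi) => //.
  by rewrite -Ad_actM // mulgV Ad_act1.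
have := S_conj_odd xi (S_exp (wnil_teps R) kZ); rewrite uE => -[_].
have cxi : cof xi = Y.
  by apply/ffunP => a; rewrite !ffunE lamcZ lamc_teta mulr1.
have cu : cof u = Y by rewrite -cxi xiE cof_exp //; exact: wnil_teps.
have -> : dof (u - xi) = - adZ_act Z Y.
  rewrite xiE -scaleN1r dofD dofZ dof_exp; last exact: wnil_teps.
  by rewrite eps_coef_teps scale1r cu scaleN1r opprD addrA subrr add0r.
by rewrite -scaleN1r odZ => /(memvZ (-1)); rewrite scalerA mulrNN mulr1 scale1r.
Qed.

(** Conjugate 1 + eta Y by the constant point g and read off the eta coefficient. Normality thus
    extends stability from K to all of G. *)
Lemma k_Ad_odd g Y : od Y \in k -> od (Ad1 (P := GP0) g Y) \in k.
Proof.
move=> kY; pose xi : {ffun od_gen -> odd_of W} := [ffun a => (Y a : C) *: teta R].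
have [+ _] := S_conj_grp (cst_grp W g) (S_oddprod (teta R) kY).
rewrite cof_cst; congr (od (Ad1 _ _) \in k).
by apply/ffunP => a; rewrite !ffunE lamcZ lamc_teta mulr1.
Qed.

Lemma SW_trivial : (forall Z, ev Z \in k -> Z = 0) -> (forall Y, od Y \in k -> Y = 0) ->
  forall x, @S W x -> exists2 g, K g & x = gg (cst_grp W g).
Proof.
move=> k0 k1 x /SE h; case: (Kgrp) => K1 KM KV.
apply: (h (fun x => exists2 g, K g & x = gg (cst_grp W g))).
- by exists 1%g; rewrite // /cst_grp sg_map1 gp_grp1.
- move=> _ _ [g Kg ->] [g' Kg' ->]; exists (g * g')%g; first exact: KM.
  by rewrite /cst_grp sg_mapM gp_grpM.
- move=> _ [g Kg ->]; exists (g^-1)%g; first exact: KV.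
  by rewrite -cst_grpV gp_grpV.
move=> y [//|[n [Z [nN /k0 -> ->]]]|[eta [v [/k1 v0 ->]]]]; exists 1%g => //.
- have [m nm] := wnil_exp nN; rewrite (Ghat_exp_n0 _ nm).
  by rewrite /cst_grp sg_map1.
- rewrite /cst_grp sg_map1 gp_grp1; apply: scal_oddprod0 => a.
  by rewrite v0 ffunE.
Qed.

Lemma S_trivial : (forall Z, ev Z \in k -> Z = 0) -> (forall Y, od Y \in k -> Y = 0) ->
  (forall g, K g -> g = 1%g) -> forall A x, @S A x -> x = 1%g.
Proof.
move=> k0 k1 K1 A x /SE h; apply: (h (fun x => x = 1%g)) => //.
- by move=> y z -> ->; rewrite mulg1.
- by move=> y ->; rewrite invg1.
move=> y [[g /K1 -> ->]|[n [Z [nN /k0 -> ->]]]|[eta [v [/k1 v0 ->]]]].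
- by rewrite /cst_grp sg_map1 gp_grp1.
- by have [m nm] := wnil_exp nN; rewrite (Ghat_exp_n0 _ nm) gp_grp1.
- by apply: scal_oddprod0 => a; rewrite v0 ffunE.
Qed.

Lemma S_full : (forall v, v \in k) -> (forall g, K g) -> forall A x, @S A x.
Proof.
move=> kT KT A x.
have Sg (g : Ghat sigma A) : @S A (gg g).
  apply: (Ghat_gen (Q := predT) (S := fun g => @S A (gg g))) => //.
  - by have := @S_cst A 1%g (KT _); rewrite /cst_grp sg_map1.
  - move=> y z Sy Sz; rewrite gp_grpM.
    by apply/SE => S' S1 SM SV SX; apply: (SM); [move/SE: Sy|move/SE: Sz]; apply.
  - by move=> h _; exact: S_cst.
  - by move=> n Z nN _; exact: S_exp.
apply: (gp_ind (S := fun x => @S A x)) => //.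
- by have := Sg 1%g; rewrite gp_grp1.
- move=> y z Sy Sz.
  by apply/SE => S' S1 SM SV SX; apply: (SM); [move/SE: Sy|move/SE: Sz]; apply.
- by move=> y Sy; apply/SE => S' S1 SM SV SX; apply: (SV); move/SE: Sy; apply.
- move=> i eta; have := @S_oddprod A eta [ffun j => (j == i)%:R] (kT _).
  rewrite -(gp_oddprod_single _ i eta); last exact: hexp0_Ghat.
  congr (@S A (gop _)); apply/ffunP => j; rewrite !ffunE.
  by case: eqP; rewrite ?scale1r ?scale0r.
Qed.

End NormalSubsupergroups.

Lemma sum_pick2 (V : nmodType) (I : finType) (a a' : I) (x y : V) :
  \sum_b ((if b == a then x else 0) + (if b == a' then y else 0)) = x + y.
Proof.
rewrite big_split /=; congr (_ + _).
  by rewrite (sum_unique (i0 := a)) ?eqxx // => b /negPf ->.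
by rewrite (sum_unique (i0 := a')) ?eqxx // => b /negPf ->.
Qed.

(** The signs are those of theta and beta_l; the difference of the two weights isolates the l-th
    coefficient. *)
Lemma sum3_sign (K : comPzRingType) (F : 'I_3 -> K) l :
  \sum_m F m - \sum_m (-1) ^+ (l == m) * F m = 2 * F l.
Proof. by rewrite !sum3; case: (ord3P l) => -> /=; ring. Qed.

(** * Irreducibility and faithfulness of g_1, generation of g by g_1 *)

Section Irreducibility.
Variables (R : realType) (sigma : 'I_3 -> CC R).
Hypothesis sigmaV : \sum_i sigma i = 0.
Hypothesis sigmaX : forall i, sigma i != 0.
Notation C := (CC R).
Notation GP0 := (Ghat_pair sigma).
Notation lsa := {ffun ev_gen + od_gen -> C^o}.
Notation ev := (ev_incl (P := GP0)).
Notation od := (od_incl (P := GP0)).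

Let s0 l : ~~ (sigma l == 0). Proof. exact: sigmaX. Qed.

Lemma factor_mx_of_SL2 (b : bool) (A : weil R) (x : SL2 A) : ~~ b -> factor_mx (of_SL2 b x) = val x.
Proof. by case: b. Qed.

Definition emb_SL2 (A : weil R) (l : 'I_3) (x : SL2 A) : Ghat sigma A :=
  emb (of_SL2 (sigma l == 0) x : Ahat sigma l A).

Lemma Ghat_Ad_emb (A : weil R) l (x : SL2 A) a b :
  Ghat_Ad (emb_SL2 l x) a b =
  (agree l a b)%:R * val x (bit (minus a l)) (bit (minus b l)).
Proof.
rewrite Ghat_AdE // (bigD1 l) //= {1}/Ahat_mx emb_in factor_mx_of_SL2 // mulrC.
congr (_ * _); rewrite -agree_prod; apply: eq_bigr => m ml.
by rewrite /Ahat_mx emb_out // factor_mx1 mxE bit_eq.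
Qed.

(** The elementary matrix 1 + t e for s true, 1 + t f for s false. *)
Definition elem (s : bool) (t : C) : SL2 (@weilC R) :=
  mkSL2 (mx2 1 (if s then t *: 1 else 0) (if s then 0 else t *: 1) 1).

Lemma det_elem s t :
  \det (mx2 1 (if s then t *: 1 else 0) (if s then 0 else t *: 1) 1 : 'M[even_of (@weilC R)]_2) = 1.
Proof. by rewrite det_mx2E mulr1; case: s; rewrite ?mulr0 ?mul0r subr0. Qed.

Lemma e2a_scal1 (t : C) : (e2a (t *: 1 : even_of (@weilC R)) : C) = t.
Proof. by rewrite e2aZ e2a_1; exact: mulr1. Qed.

Lemma Ad1_elem l s t (Y : {ffun od_gen -> C^o}) a :
  Ad1 (P := GP0) (emb_SL2 l (elem s t)) Y a =
  Y a + (if minus a l == ~~ s then t * Y (flip l a) else 0) :> C.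
Proof.
rewrite ffunE; have E b : (e2a (Ghat_Ad (emb_SL2 l (elem s t)) a b) : C) * Y b =
    (if b == a then Y a : C else 0) +
    (if b == flip l a then (if minus a l == ~~ s then t * Y (flip l a) else 0) else 0).
  rewrite Ghat_Ad_emb val_mkSL2 ?det_elem // agreeE.
  rewrite [a == b]eq_sym; have [->|ba] := eqVneq b a.
    rewrite mul1r [a == _]eq_sym flip_neq addr0.
    rewrite -[RHS]mul1r; congr (_ * _); rewrite mxE.
    by case: minus => /=; exact: (e2a_1 (@weilC R)).
  have -> : (a == flip l b) = (b == flip l a).
    by apply/eqP/eqP => ->; rewrite flipK.
  have [->|bf] := eqVneq b (flip l a); last first.
    by rewrite /= mul0r e2a0 addr0; exact: (@mul0r C).
  rewrite /= mul1r minus_flip eqxx add0r mxE.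
  have e1 : (e2a (t *: 1 : even_of (@weilC R)) : C) * Y (flip l a) = t * Y (flip l a).
    by rewrite e2a_scal1.
  have e0 : (e2a (0 : even_of (@weilC R)) : C) * Y (flip l a) = 0.
    by rewrite e2a0; exact: (@mul0r C).
  by case: s; case: minus; [exact: e0 | exact: e1 | exact: e1 | exact: e0].
rewrite (eq_bigr _ (fun b _ => E b)) sum_pick2.
by [].
Qed.

Variable k : {vspace lsa}.
Hypothesis ksub : sub_lsa (P := GP0) k.

Section OddIrreducible.
Hypothesis kAd : forall g Y, od Y \in k -> od (Ad1 (P := GP0) g Y) \in k.

Definition shift (l : 'I_3) (s : bool) (Y : {ffun od_gen -> C^o}) : {ffun od_gen -> C^o} :=
  [ffun a => if minus a l == s then Y (flip l a) else 0].

(** As e and f have square 0 in the tautological module, e = Ad(1 + e) - 1 and likewise for f: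
    stability under the group gives stability under e and f without differentiating. *)
Lemma k_shift l s Y : od Y \in k -> od (shift l s Y) \in k.
Proof.
move=> kY; have -> : od (shift l s Y) =
    od (Ad1 (P := GP0) (emb_SL2 l (elem (~~ s) 1)) Y) - od Y.
  apply/ffunP => -[c|a]; rewrite !ffunE ?subrr //.
  have := Ad1_elem l (~~ s) 1 Y a; rewrite ffunE => ->.
  by rewrite negbK mul1r addrC addKr.
by rewrite memvB // kAd.
Qed.

Definition odbas (a : od_gen) : {ffun od_gen -> C^o} := [ffun b => (b == a)%:R].

Lemma k_flip l a : od (odbas a) \in k -> od (odbas (flip l a)) \in k.
Proof.
move/(k_shift l (~~ minus a l)); congr (od _ \in k).
apply/ffunP => b; rewrite !ffunE.
have -> : (flip l b == a) = (b == flip l a) by apply/eqP/eqP => [<-|->]; rewrite flipK.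
case: (eqVneq b (flip l a)) => [->|_]; last by case: ifP.
by rewrite minus_flip eqxx addTb eqxx.
Qed.

(** The composites ef and fe are the projections onto the vectors with prescribed l-th sign. *)
Lemma k_project l s Y : od Y \in k ->
  od [ffun a => if minus a l == s then Y a else 0] \in k.
Proof.
move/(k_shift l (~~ s))/(k_shift l s); congr (od _ \in k).
apply/ffunP => a; rewrite !ffunE minus_flip eqxx flipK.
by case: (minus a l); case: s.
Qed.

(** Three projections isolate a nonzero coordinate of Y, which puts one basis vector in k; flips
    then give all the others. *)
Lemma k_odd_full Y Y' : od Y \in k -> Y != 0 -> od Y' \in k.
Proof.
move=> kY Y0; have [a Ya] : exists a, Y a != 0.
  apply/existsP; apply: contraNT Y0; rewrite negb_exists => /forallP h.
  by apply/eqP/ffunP => a; rewrite ffunE; apply/eqP; rewrite -[_ == _]negbK; exact: h.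
have ka : od (odbas a) \in k.
  have := k_project i3 (minus a i3) (k_project i2 (minus a i2) (k_project i1 (minus a i1) kY)).
  move/(memvZ (Y a)^-1); rewrite -odZ; congr (od _ \in k).
  apply/ffunP => b; rewrite !ffunE; case: (eqVneq b a) => [->|ba].
    by rewrite !eqxx; exact: mulVf.
  case: eqP => e3; last exact: mulr0; case: eqP => e2; last exact: mulr0.
  case: eqP => e1; last exact: mulr0; case/eqP: ba.
  by apply: minus_inj => l; case: (ord3P l) => ->.
have kb b : od (odbas b) \in k.
  by apply: (@flip_connected (fun b => is_true (od (odbas b) \in k)) _ a b ka) => l c; exact: k_flip.
have -> : od Y' = \sum_b (Y' b : C) *: od (odbas b).
  apply/ffunP => -[c|c]; rewrite sum_ffunE !ffunE.
    by rewrite sum_eq0 // => b; rewrite !ffunE scaler0.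
  rewrite (sum_unique (i0 := c)) => [|b /negPf bc]; rewrite !ffunE ?eqxx.
    by rewrite [RHS]mulr1.
  by rewrite eq_sym bc scaler0.
by apply: memv_suml => b _; rewrite memvZ.
Qed.

End OddIrreducible.

Definition lbas (c : ev_gen + od_gen) : lsa := [ffun d => (d == c)%:R].

Lemma lbr_bas a b : lbr (P := GP0) (lbas a) (lbas b) = ghat_br sigma a b.
Proof.
apply/ffunP => c; rewrite lbrE (sum_unique (i0 := a)) => [|d /negPf da].
  rewrite (sum_unique (i0 := b)) => [|d /negPf db]; rewrite !ffunE ?eqxx.
    by rewrite !mul1r.
  by rewrite db mulr0 mul0r.
by rewrite sum_eq0 // => e; rewrite ffunE da !mul0r.
Qed.

Lemma k_bas_bracket a b c (z : C) : lbas a \in k -> lbas b \in k -> z != 0 ->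
  (forall d, ghat_br sigma a b d = z * (d == c)%:R :> C) -> lbas c \in k.
Proof.
move=> ka kb z0 h; have := ksub.2 _ _ ka kb; rewrite lbr_bas => /(memvZ z^-1).
congr (_ \in k); apply/ffunP => d; rewrite !ffunE.
by have := h d; rewrite ffunE => ->; exact: mulKf.
Qed.

(** Brackets of the beta_i yield the vectors X of weight 2 eps_l and -2 eps_l, up to sign with
    coefficient the square of the product of the sigma_l; brackets of those yield sigma_l H. All
    these coefficients are nonzero. *)
Lemma k_full_of_odd : (forall Y, od Y \in k) -> forall v, v \in k.
Proof.
move=> kod.
have ko a : lbas (inr a) \in k.
  have := kod [ffun b => (b == a)%:R]; congr (_ \in k).
  by apply/ffunP => -[c|c]; rewrite !ffunE.
have t0 : (\prod_l sigma l) ^+ 2 != 0 :> C.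
  by rewrite expf_neq0 //; apply/prodf_neq0 => l _; exact: sigmaX.
have big3 (i j l : 'I_3) (F : 'I_3 -> gx R) : third i j l -> \sum_(m | third i j m) F m = F l.
  move=> t; rewrite (eq_bigl (pred1 l)) ?big_pred1_eq // => m.
  by move: t; case: (ord3P i) => ->; case: (ord3P j) => ->; case: (ord3P l) => -> //;
    case: (ord3P m) => ->.
have ex l : exists i j, third i j l.
  by case: (ord3P l) => ->; [exists i2, i3 | exists i1, i3 | exists i1, i2].
have ke l : lbas (inl (l, Some true)) \in k.
  have [i [j t]] := ex l.
  apply: (k_bas_bracket (ko (true, Some i)) (ko (true, Some j)) t0) => d.
  rewrite ghat_br11 //; congr (_ * _); rewrite /br11 (big3 _ _ _ _ t) ffunE.
  exact: ev_sigma_nat.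
have kf l : lbas (inl (l, Some false)) \in k.
  have [i [j t]] := ex l.
  apply: (k_bas_bracket (ko (false, Some i)) (ko (false, Some j)) (z := - (\prod_l sigma l) ^+ 2)).
    by rewrite oppr_eq0.
  move=> d; rewrite ghat_br11 // mulNr -mulrN; congr (_ * _).
  by rewrite /br11 (big3 _ _ _ _ t) !ffunE ev_sigmaN ev_sigma_nat.
have kh l : lbas (inl (l, None)) \in k.
  apply: (k_bas_bracket (ke l) (kf l) (sigmaX l)) => d; rewrite ffunE.
  have -> : hat_coef R (inl (l, Some true)) (inl (l, Some false)) d = (xv R l *: gH R l) d.
    by rewrite /hat_coef /= mul1r eqxx.
  by rewrite ffunE ev_sigmaM ev_sigma_xv // ffunE ev_sigma_nat.
move=> v; have -> : v = \sum_c (v c : C) *: lbas c.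
  apply/ffunP => c; rewrite sum_ffunE (sum_unique (i0 := c)) => [|d /negPf dc].
    by rewrite !ffunE eqxx; exact: esym (mulr1 _).
  by rewrite !ffunE eq_sym dc scaler0.
apply: memv_suml => -[[l [[]|]]|a] _; rewrite memvZ //.
Qed.

(** Off-diagonal entries of ad(Z) give the coefficients of e and f times sigma_l; the diagonal
    entries at theta and beta_l differ by 2 sigma_l times the coefficient of H. *)
Lemma adZ_faithful Z : (forall Y, adZ_act sigma Z Y = 0) -> Z = 0.
Proof.
move=> h; have adZ0 a b : adZ sigma Z a b = 0.
  have /ffunP/(_ a) := h [ffun c => (c == b)%:R]; rewrite !ffunE.
  rewrite (sum_unique (i0 := b)) => [|c /negPf cb]; rewrite ffunE ?eqxx ?mulr1 //.
  by rewrite cb mulr0.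
have Zef l s : Z (l, Some s) = 0.
  (* With all three signs equal to s, the l-th root vector of kind s does not kill b, and no other
     basis vector of g_0 contributes to this entry. *)
  pose b := unwt [ffun m => s].
  have := adZ0 (flip l b) b; rewrite adZ_ghat_br // (sum_unique (i0 := (l, Some s))).
    rewrite ghat_br_ef // minus_unwt ffunE !eqxx mulr1 => /eqP.
    by rewrite mulf_eq0 (negPf (sigmaX l)) orbF => /eqP.
  move=> [m [t|]] ne.
    rewrite ghat_br_ef // minus_unwt ffunE.
    case: eqP => [st|_]; last by rewrite !mulr0.
    case: eqP => [e|_]; last by rewrite !mulr0.
    case/eqP: ne; rewrite -st; congr (_, _).
    have := congr1 (minus^~ m) e; rewrite !minus_flip eqxx.
    by case: eqP => // _; case: minus.
  by rewrite ghat_br_h // flip_neq !mulr0.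
have Zh (a : od_gen) : \sum_l (-1) ^+ minus a l * (sigma l * Z (l, None)) = 0 :> C.
  transitivity (adZ sigma Z a a); last exact: adZ0.
  rewrite adZ_ghat_br // sum_ev; apply: eq_bigr => l _.
  rewrite !Zef !mul0r !addr0 ghat_br_h // eqxx mulr1.
  by rewrite mulrC -mulrA [RHS]mulrCA.
have Zh0 l : Z (l, None) = 0.
  have e0 := Zh (true, None); have e1 := Zh (true, Some l).
  have := sum3_sign (fun m => sigma m * (Z (m, None) : C)) l.
  have -> : \sum_m sigma m * (Z (m, None) : C) = 0.
    by rewrite -[RHS]e0; apply: eq_bigr => m _; rewrite expr0 mul1r.
  have -> : \sum_m (-1) ^+ (l == m) * (sigma m * (Z (m, None) : C)) = 0.
    rewrite -[RHS]e1; apply: eq_bigr => m _; congr (_ * _).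
  rewrite subrr => /esym/eqP; rewrite !mulf_eq0 pnatr_eq0 (negPf (sigmaX l)) /= => /eqP.
  by [].
by apply/ffunP => -[l [s|]]; rewrite ffunE.
Qed.

End Irreducibility.

(** * The case k = g: K is the whole group *)

Lemma CC_bound (R : realType) (x : CC R) : 0 <= x -> exists n : nat, x < n.+1%:R.
Proof.
(* In the order of the complex numbers, 0 <= x forces x to be real. *)
rewrite -[0 <= x]/(0 <= (x : R[i]))%C lecE /= => /andP[/eqP x0 rx].
exists (Num.bound (complex.Re (x : R[i]))).
rewrite -[_ < _]/((x : R[i]) < (Num.bound (complex.Re (x : R[i]))).+1%:R).
rewrite -(rmorph_nat (real_complex R)) ltcE /= x0 eqxx /=.
apply: lt_trans (archi_boundP rx) _; by rewrite ltr_nat.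
Qed.

Lemma ord2P (m : 'I_2) : m = ord0 \/ m = ord_max.
Proof. by case: m => [[|[|//]] pm]; [left | right]; apply: val_inj. Qed.

Lemma mx2_elem (R : realType) (K : comNzRingType) (u : K) s i j :
  mx2 1 (if s then u else 0) (if s then 0 else u) 1 i j =
  mx2 1 0 0 1 i j + (if (i, j) == cc R false (Some s) then u else 0).
Proof.
by case: (ord2P i) => ->; case: (ord2P j) => ->; case: s; rewrite !mxE /= ?addr0 ?add0r.
Qed.

Lemma mx2_elemM (K : comNzRingType) (t u : K) (s : bool) :
  mx2 1 (if s then t else 0) (if s then 0 else t) 1 *m
  mx2 1 (if s then u else 0) (if s then 0 else u) 1 =
  mx2 1 (if s then t + u else 0) (if s then 0 else t + u) 1.
Proof. by rewrite mx2M; case: s; congr mx2; ring. Qed.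

Lemma mx2_ULU (K : comNzRingType) (x y z : K) :
  mx2 1 x 0 1 *m mx2 1 0 z 1 *m mx2 1 y 0 1 =
  mx2 (1 + x * z) (x + (1 + x * z) * y) z (1 + y * z).
Proof. by rewrite !mx2M; congr mx2; ring. Qed.

Lemma mx2_row_sub (K : comNzRingType) (x y z : K) :
  mx2 1 0 (-1) 1 *m mx2 x y x (y + z) = mx2 x y 0 z.
Proof. by rewrite mx2M; congr mx2; ring. Qed.

Section IdentityComponent.
Variables (R : realType) (sigma : 'I_3 -> CC R).
Hypothesis sigmaX : forall i, sigma i != 0.
Notation C := (CC R).
Notation GP0 := (Ghat_pair sigma).
Notation G0 := (Ghat sigma).
Let s0 l : ~~ (sigma l == 0). Proof. exact: sigmaX. Qed.

Lemma of_SL2M (b : bool) (A : weil R) : {morph @of_SL2 R b A : x y / (x * y)%g}.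
Proof. by case: b => x y //=; rewrite mulg1. Qed.

Lemma emb_SL2M (A : weil R) l (x y : SL2 A) :
  emb_SL2 sigma l (x * y)%g = (emb_SL2 sigma l x * emb_SL2 sigma l y)%g.
Proof. by rewrite /emb_SL2 -embM; congr emb; exact: of_SL2M. Qed.

Lemma emb_SL2_1 (A : weil R) l : emb_SL2 sigma l (1%g : SL2 A) = 1%g.
Proof. by apply: (mulgI (emb_SL2 sigma l 1%g)); rewrite -emb_SL2M !mulg1. Qed.

Lemma elemD s (t u : C) : (elem s t * elem s u)%g = elem s (t + u).
Proof.
apply: etrans (mkSL2M (det_elem s t) (det_elem s u)) _.
by rewrite /elem scalerDl; congr mkSL2; exact: mx2_elemM.
Qed.

Lemma elem0 s : elem s 0 = 1%g :> SL2 (@weilC R).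
Proof.
by apply: val_inj; rewrite val_mkSL2 ?det_elem // scale0r; case: s; exact: mx2_1.
Qed.

Lemma coord_elem (b : bool) s (t : C) (p1 : {ffun sg_ix (factor R b) -> @weilC R}) : ~~ b ->
  sg_coord (1%g : factor R b weilC) p1 ->
  sg_coord (of_SL2 b (elem s t))
    [ffun c => (p1 c : C) + (if c == cc R b (Some s) then t else 0)].
Proof.
case: b p1 => // p1 _ h i j; rewrite ffunE h.
have -> : of_SL2 false (elem s t) = elem s t by [].
rewrite val_mkSL2 ?det_elem //.
have -> : val (1%g : SL2 (@weilC R)) = mx2 1 0 0 1 by rewrite mx2_1.
rewrite (mx2_elem R) e2aD; congr (_ + _).
by case: ifP => _; [exact: esym (e2a_scal1 t) | rewrite e2a0].
Qed.

Definition elem_coord (p1 : {ffun sg_ix G0 -> @weilC R}) l s (t : C) :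
  {ffun sg_ix G0 -> @weilC R} :=
  [ffun c => (p1 c : C) + (if c == ixc sigma (l, Some s) then t else 0)].

Lemma coord_emb_elem (p1 : {ffun sg_ix G0 -> @weilC R}) l s t :
  sg_coord (1%g : G0 weilC) p1 ->
  sg_coord (emb_SL2 sigma l (elem s t)) (elem_coord p1 l s t).
Proof.
move=> c1 m; have := c1 m; rewrite ffunE => c1m.
have [ml|ml] := eqVneq m l.
  move: c1m; rewrite ml => c1m; rewrite [X in sg_coord X]emb_in.
  have := coord_elem s t (s0 l) c1m; congr sg_coord; apply/ffunP => c; rewrite !ffunE.
  by rewrite /ixc eq_Tagged.
rewrite emb_out //; move: c1m; congr sg_coord; apply/ffunP => c; rewrite !ffunE.
case: eqP => [/(congr1 (fun x => tag x)) /= e|_]; first by rewrite e eqxx in ml.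
by rewrite addr0.
Qed.

(** The elementary matrices form an affine line through 1 in coordinates, which is continuous at t =
    0. *)
Lemma elem_coord_near (p1 : {ffun sg_ix G0 -> @weilC R}) l s (N : set 'rV[C]_#|sg_ix G0|) :
  nbhs (crow p1) N ->
  exists2 e : C, 0 < e & forall t : C, `|t| < e -> N (crow (elem_coord p1 l s t)).
Proof.
pose v : 'rV[C]_#|sg_ix G0| := \row_m (enum_val m == ixc sigma (l, Some s))%:R.
have vE t : crow p1 + t *: v = crow (elem_coord p1 l s t).
  apply/rowP => m; rewrite !mxE ffunE; congr (_ + _).
  by case: eqP => _; [exact: mulr1 | exact: mulr0].
move=> pN.
have : (crow p1 + t *: v @[t --> (0 : C)] --> crow p1 + (0 : C) *: v)%classic.
  apply: (@cvgD _ _ _ _ (nbhs_filter (0 : C)) (fun=> crow p1) (fun t : C => t *: v)).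
    exact: cvg_cst.
  exact: scalel_continuous.
rewrite scale0r addr0 => /(_ N pN) /nbhs_ballP [e /= e0 eN].
exists e => // t te; have := eN t; rewrite /= vE => eNt.
by apply: eNt; rewrite /ball /= sub0r normrN.
Qed.

Variable K : set (G0 weilC).
Hypothesis Kgrp : subgroup K.

(** An elementary matrix with parameter t is a power of the one with parameter t / (n + 1), which is
    small for n large. *)
Lemma K_elem_all l s (e : C) : 0 < e ->
  (forall t, `|t| < e -> K (emb_SL2 sigma l (elem s t))) ->
  forall t, K (emb_SL2 sigma l (elem s t)).
Proof.
move=> e0 h t; case: (Kgrp) => K1 KM _.
have [n hn] : exists n : nat, `|t| / e < n.+1%:R by apply: CC_bound; rewrite divr_ge0 // ltW.
have tE : t = (t / n.+1%:R) *+ n.+1.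
  by rewrite -[RHS]mulr_natr mulfVK // pnatr_eq0.
have small : K (emb_SL2 sigma l (elem s (t / n.+1%:R))).
  apply: h; rewrite normrM normfV normr_nat ltr_pdivrMr ?ltr0n //.
  by rewrite mulrC -ltr_pdivrMr.
rewrite tE; elim: {hn tE}n.+1 (t / n.+1%:R) small => [|m IH] u Ku.
  by rewrite mulr0n elem0 emb_SL2_1.
rewrite mulrS -elemD emb_SL2M.
exact: (KM _ _ Ku (IH u Ku)).
Qed.

(** A matrix with nonzero lower left entry c is a product upper, lower, upper; the case c = 0 is
    reduced to it by a row operation. *)
Lemma SL2_elem_gen (P : SL2 (@weilC R) -> Prop) :
  (forall x y, P x -> P y -> P (x * y)%g) -> (forall s t, P (elem s t)) -> forall x, P x.
Proof.
move=> PM PE.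
have fM (u v : C) : (u * v) *: 1 = (u *: 1) * (v *: 1) :> even_of (@weilC R).
  by rewrite -scalerAl mul1r scalerA.
have lift (a b c d : C) : a * d - b * c = 1 ->
    \det (mx2 (a *: 1) (b *: 1) (c *: 1) (d *: 1) : 'M[even_of (@weilC R)]_2) = 1.
  by move=> e; rewrite det_mx2E -!fM -scalerBl e scale1r.
have c0 (a b c d : C) : a * d - b * c = 1 -> c != 0 ->
    P (mkSL2 (mx2 (a *: 1) (b *: 1) (c *: 1) (d *: 1))).
  move=> e c0.
  have [u uc] : exists u : C, u * c = a - 1 by exists ((a - 1) / c); exact: mulfVK.
  have [v vc] : exists v : C, v * c = d - 1 by exists ((d - 1) / c); exact: mulfVK.
  have aE : a = 1 + u * c by rewrite uc addrC subrK.
  have dE : d = 1 + v * c by rewrite vc addrC subrK.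
  have bE : b = u + (1 + u * c) * v.
    have bc : b * c = a * d - 1 by rewrite -e; ring.
    by apply: (mulIf c0); rewrite -aE mulrDl -mulrA uc vc bc; ring.
  have := PM _ _ (PM _ _ (PE true u) (PE false c)) (PE true v).
  congr P; apply: etrans (congr1 (fun x => x * _)%g (mkSL2M (det_elem true u) (det_elem false c))) _.
  apply: etrans (mkSL2M _ (det_elem true v)) _.
    apply: etrans (det_mulmx _ _) _.
    by apply: etrans (congr2 *%R (det_elem true u) (det_elem false c)) _; exact: mulr1.
  have fA : a *: 1 = 1 + (u *: 1) * (c *: 1) :> even_of (@weilC R).
    by rewrite aE scalerDl scale1r fM.
  have fD : d *: 1 = 1 + (v *: 1) * (c *: 1) :> even_of (@weilC R).
    by rewrite dE scalerDl scale1r fM.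
  have fB : b *: 1 = u *: 1 + (a *: 1) * (v *: 1) :> even_of (@weilC R).
    by rewrite bE -aE scalerDl fM.
  rewrite fB fA fD.
  by congr mkSL2; exact: mx2_ULU.
have cA (a b c d : C) : a * d - b * c = 1 -> P (mkSL2 (mx2 (a *: 1) (b *: 1) (c *: 1) (d *: 1))).
  move=> e; have [cz|] := eqVneq c 0; last exact: c0.
  have a0 : a != 0.
    by apply: contra_eq_neq e => ->; rewrite cz mul0r mulr0 subrr eq_sym oner_eq0.
  (* Adding the first row to the second makes the lower left entry a, which is nonzero. *)
  have e' : a * (b + d) - b * a = 1 by rewrite -e cz; ring.
  have := PM _ _ (PE false (-1)) (c0 _ _ _ _ e' a0).
  congr P; apply: etrans (mkSL2M (det_elem false (-1)) (lift _ _ _ _ e')) _.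
  have f1 : (-1 : C) *: 1 = - 1 :> even_of (@weilC R) by rewrite scaleN1r.
  have f0 : c *: 1 = 0 :> even_of (@weilC R) by rewrite cz scale0r.
  have fD : (b + d) *: 1 = b *: 1 + d *: 1 :> even_of (@weilC R) by rewrite scalerDl.
  by rewrite f0 f1 fD; congr mkSL2; exact: mx2_row_sub.
move=> x; have sE (n : even_of (@weilC R)) : n = (e2a n : C) *: 1.
  by apply: e2a_inj; exact: esym (e2a_scal1 _).
have xE : x = mkSL2 (mx2 (val x ord0 ord0) (val x ord0 ord_max) (val x ord_max ord0) (val x ord_max ord_max)).
  by apply: val_inj; rewrite -mx2E [RHS]val_mkSL2 //; exact: eqP (valP x).
rewrite xE (sE (val x ord0 ord0)) (sE (val x ord0 ord_max)).
rewrite (sE (val x ord_max ord0)) (sE (val x ord_max ord_max)).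
apply: cA; have /eqP := valP x; rewrite det_mx2 => /(congr1 (fun n : even_of (@weilC R) => e2a n : C)).
by rewrite e2aB !e2a_mul e2a_1.
Qed.

(** Tangent space g_0 leaves no local equation for K near 1, so K contains small elementary matrices
    in each factor, and these generate G. *)
Lemma K_full (k : {vspace {ffun ev_gen + od_gen -> C^o}}) :
  submanifold_at1 (P := GP0) K [set Z | ev_incl (P := GP0) Z \in k]%classic ->
  (forall v, v \in k) -> forall g, K g.
Proof.
move=> [p1 c1 [r [F [_ near2 surj ker]]]] kT.
(* The differentials are onto C^r, yet all vanish on k_0 = g_0; hence r = 0. *)
have r0 (l : 'I_r) : False.
  have [Z h1] := surj (fun=> 1); have [h0 _] := ker Z.
  have : (0 : C) = 1 := etrans (esym (h0 (kT _) l)) (h1 l).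
  by move/eqP; rewrite eq_sym oner_eq0.
have Ke l s t : K (emb_SL2 sigma l (elem s t)).
  have [e e0 he] := elem_coord_near l s near2.
  apply: (K_elem_all e0) => u ue.
  have [_] := he u ue _ _ (coord_emb_elem l s u c1) (erefl _).
  by apply=> m; case: (r0 m).
case: (Kgrp) => K1 KM _.
have Kl l (x : SL2 (@weilC R)) : K (emb_SL2 sigma l x).
  apply: (SL2_elem_gen (P := fun x => K (emb_SL2 sigma l x))) => [y z Ky Kz|s t]; last exact: Ke.
  by rewrite emb_SL2M; exact: KM.
have Kx l (x : Ahat sigma l weilC) : K (emb x).
  have := Kl l (to_SL2 x); rewrite /emb_SL2; congr (K (emb _)).
  exact: (to_SL2K (s0 l)).
by move=> g; rewrite (Ghat_emb g); exact: (KM _ _ (Kx _ _) (KM _ _ (Kx _ _) (Kx _ _))).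
Qed.

End IdentityComponent.

(** The parts free of eps show that the two constant matrices agree in the entries concerned; the
    eps parts then say that the first one commutes with e or f. *)
Lemma mx2_teps_comm (R : realType) (s : bool) (u a b c d a' b' c' d' : CC R) : u != 0 ->
  let N := mx2 1 (if s then u *: teps R else 0) (if s then 0 else u *: teps R) 1 in
  N *m mx2 (a *: 1) (b *: 1) (c *: 1) (d *: 1) =
  mx2 (a' *: 1) (b' *: 1) (c' *: 1) (d' *: 1) *m N ->
  (if s then c else b) = 0 /\ a = d.
Proof.
move=> u0 /=; rewrite !mx2M => e.
have e00 := congr1 (fun M : 'M_2 => M ord0 ord0) e; rewrite !mxE /= in e00.
have e01 := congr1 (fun M : 'M_2 => M ord0 ord_max) e; rewrite !mxE /= in e01.
have e10 := congr1 (fun M : 'M_2 => M ord_max ord0) e; rewrite !mxE /= in e10.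
have e11 := congr1 (fun M : 'M_2 => M ord_max ord_max) e; rewrite !mxE /= in e11.
have tl (x : CC R) : (u *: teps R) * (x *: 1) = (u * x) *: teps R.
  by rewrite -scalerAl -scalerAr mulr1 scalerA.
have tr (x : CC R) : (x *: 1) * (u *: teps R) = (x * u) *: teps R.
  by rewrite -scalerAl mul1r scalerA.
have z (x : CC R) : x *: 1 + 0 *: teps R = x *: 1 by rewrite scale0r addr0.
case: s {e} e00 e01 e10 e11; rewrite !(tl, tr, mulr1, mul1r, mulr0, mul0r, addr0, add0r).
  rewrite -(z a') => /scal_teps_inj [ea /eqP uc] e01 _ _.
  have [_ ud] := scal_teps_inj (etrans e01 (addrC _ _)).
  split; first by move: uc; rewrite mulf_eq0 (negPf u0) => /eqP.
  by apply: (mulfI u0); rewrite ud ea mulrC.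
rewrite -(z a) => /scal_teps_inj [ea /esym/eqP bu].
rewrite -(z b) -(z b') => /scal_teps_inj [-> _] e10 e11.
have [_ ua] := scal_teps_inj (etrans (addrC _ _) e10).
rewrite addrC -(z d') in e11; have [ed _] := scal_teps_inj e11.
split; first by move: bu; rewrite mulf_eq0 (negPf u0) orbF => /eqP.
by apply: (mulfI u0); rewrite ua ed mulrC.
Qed.

(** * The case k = 0: K is trivial *)

Section DiscreteNormal.
Variables (R : realType) (sigma : 'I_3 -> CC R).
Hypothesis sigmaV : \sum_i sigma i = 0.
Hypothesis sigmaX : forall i, sigma i != 0.
Notation C := (CC R).
Notation W := (testW R).
Notation GP0 := (Ghat_pair sigma).
Notation G0 := (Ghat sigma).
Notation gg := (gp_grp (P := GP0)).
Let s0 l : ~~ (sigma l == 0). Proof. exact: sigmaX. Qed.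

Lemma coord_factor00 (b : bool) (x : factor R b weilC) p : ~~ b -> sg_coord x p ->
  p (cc R b None) = e2a (factor_mx x ord0 ord0).
Proof. by case: b x p => // x p _ h; exact: h. Qed.

Lemma coord_ex (g : big_pt (Ahat sigma) weilC) : exists p, sg_coord (g : G0 weilC) p.
Proof.
have aux (b : bool) (x : factor R b weilC) : ~~ b -> exists q, sg_coord x q.
  by case: b x => // x _; exists [ffun ij => e2a (val x ij.1 ij.2)] => i j; rewrite ffunE.
pose q l := cid (aux _ (g l) (s0 l)).
exists [ffun c => projT1 (q (tag c)) (tagged c)] => l.
by have := projT2 (q l); congr sg_coord; apply/ffunP => c; rewrite !ffunE.
Qed.

Lemma factor_mx_inj (b : bool) (A : weil R) : ~~ b -> injective (@factor_mx R b A).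
Proof. by case: b => // _ x y h; exact: val_inj. Qed.

Lemma det_Ahat_mx (A : weil R) (g : G0 A) l : \det (Ahat_mx g l) = 1.
Proof.
have aux b (x : factor R b A) : ~~ b -> \det (factor_mx x) = 1.
  by case: b x => // x _; exact: eqP (valP x).
exact: (aux _ _ (s0 l)).
Qed.

Lemma Ahat_mx_cst (g : G0 weilC) l :
  Ahat_mx (cst_grp W g) l = map_mx (emap (scal_hom W)) (Ahat_mx g l).
Proof.
rewrite /Ahat_mx /cst_grp /= /Defs.big_map ffunE.
have aux b (x : factor R b weilC) : ~~ b ->
    factor_mx (sg_map (scal_hom W) x) = map_mx (emap (scal_hom W)) (factor_mx x).
  by case: b x.
exact: (aux _ _ (s0 l)).
Qed.

Lemma Ahat_mx_exp_basis (s : bool) l :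
  Ahat_mx (Ghat_exp sigma (teps R) [ffun c => (c == (l, Some s))%:R]) l =
  mx2 1 (if s then sigma l *: teps R else 0) (if s then 0 else sigma l *: teps R) 1.
Proof.
apply/matrixP => i j; rewrite Ahat_mx_exp ?wnil_sqW //; last exact: wnil_teps.
have e0 : ((l, None) == (l, Some s)) = false by rewrite xpair_eqE andbF.
have e1 : ((l, Some true) == (l, Some s)) = s by rewrite xpair_eqE eqxx /=; case: (s).
have e2 : ((l, Some false) == (l, Some s)) = ~~ s by rewrite xpair_eqE eqxx /=; case: (s).
rewrite !mxE !ffunE e0 e1 e2; move: (teps R) => t.
have [z0 z1] : (sigma l * 0 = 0) /\ (sigma l * - 0 = 0) by rewrite oppr0 mulr0.
by move: {e0 e1 e2} (ord2P i) (ord2P j); case=> ->; case=> ->; case: s; rewrite ?eqxx /= ?z0 ?z1 ?mulr1 ?scale0r ?addr0 ?add0r.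
Qed.

Variables (K : set (G0 weilC)) (k : {vspace {ffun ev_gen + od_gen -> C^o}}).
Variable (S : forall A, set (GP GP0 A)).
Hypotheses (Kgrp : subgroup K).
Hypothesis SE : forall A (x : GP GP0 A), @S A x <-> generated (fun y =>
        [\/ exists2 g, K g & y = gg (cst_grp A g),
            exists n Z, [/\ e2a n \in wN A, ev_incl (P := GP0) Z \in k & y = gg (Ghat_exp sigma n Z)]
          | exists (eta : odd_of A) v, od_incl (P := GP0) v \in k /\
              y = gp_oddprod (P := GP0) [ffun i => v i *: eta]]) x.
Hypothesis Snormal : normal S.
Hypothesis k0 : forall Z, ev_incl (P := GP0) Z \in k -> Z = 0.
Hypothesis k1 : forall Y, od_incl (P := GP0) Y \in k -> Y = 0.

(** By normality the conjugate is a point of S over W, and for k = 0 these points are the constants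
    from K. *)
Lemma K_conj (h : G0 W) g : K g -> exists2 g', K g' & (h * cst_grp W g = cst_grp W g' * h)%g.
Proof.
move=> Kg; have Sx : @S W (gg h * gg (cst_grp W g) * (gg h)^-1)%g.
  exact: (Snormal _ (S_cst SE W Kg)).
have [g' Kg' e] := SW_trivial Kgrp SE k0 k1 Sx.
exists g' => //.
have := congr1 (fun x => (to_sd sigmaV x).1) e.
rewrite !phiM1 phiV1 !phi_gg /= => <-.
by rewrite -mulgA mulVg mulg1.
Qed.

(** With h = exp(eps X) for the two root vectors X of the l-th factor, the component of g commutes
    with e and with f, so it is a scalar; its determinant is 1. *)
Lemma K_scalar g l : K g -> exists2 a : C, a * a = 1 & Ahat_mx g l = mx2 (a *: 1) 0 0 (a *: 1).
Proof.
move=> Kg; pose G i j : C := e2a (Ahat_mx g l i j).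
have GE (x : G0 weilC) i j : Ahat_mx (cst_grp W x) l i j = (e2a (Ahat_mx x l i j) : C) *: 1.
  by rewrite Ahat_mx_cst mxE emap_scalE.
have step (s : bool) : G (if s then ord_max else ord0) (if s then ord0 else ord_max) = 0 /\
    G ord0 ord0 = G ord_max ord_max.
  pose h := Ghat_exp sigma (teps R) [ffun c => (c == (l, Some s))%:R].
  have [g' Kg' /(congr1 (fun x => Ahat_mx x l))] := K_conj h Kg.
  rewrite !Ahat_mxM Ahat_mx_exp_basis.
  rewrite [Ahat_mx (cst_grp W g) l]mx2E [Ahat_mx (cst_grp W g') l]mx2E !GE -!/(G _ _).
  move/(mx2_teps_comm (sigmaX l)) => [h0 h1]; split=> //.
  by move: h0; case: (s).
have [c0 ad] := step true; have [b0 _] := step false.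
have sE (n : even_of (@weilC R)) : n = (e2a n : C) *: 1.
  by apply: e2a_inj; exact: esym (e2a_scal1 _).
have AE : Ahat_mx g l = mx2 (G ord0 ord0 *: 1) 0 0 (G ord0 ord0 *: 1).
  rewrite [LHS]mx2E; congr (mx2 _ _ _ _).
  - exact: sE.
  - by rewrite [LHS]sE -/(G _ _) b0 scale0r.
  - by rewrite [LHS]sE -/(G _ _) c0 scale0r.
  - by rewrite [LHS]sE -/(G _ _) -ad.
exists (G ord0 ord0) => //.
have := det_Ahat_mx g l; rewrite AE det_mx2E mul0r subr0.
move/(congr1 (fun n : even_of (@weilC R) => e2a n : C)).
by rewrite e2a_mul !e2a_scal1 e2a_1.
Qed.

(* The upper left entry of each factor takes only the values 1 and -1 on K, so *)
(* it is constant. *)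
Lemma K_trivial : connected_in K -> forall g, K g -> g = 1%g.
Proof.
move=> Kconn g Kg; have [p1 c1] := coord1_Ghat sigma weilC.
have [p cp] := coord_ex g.
have pE x q l : K x -> sg_coord x q -> exists2 a : C, a * a = 1 &
    (Ahat_mx x l = mx2 (a *: 1) 0 0 (a *: 1)) /\ q (ixc sigma (l, None)) = a.
  move=> Kx cq; have [a aa aE] := K_scalar l Kx; exists a => //; split=> //.
  have := coord_factor00 (s0 l) (cq l); rewrite ffunE -/(Ahat_mx x l) aE mxE => h.
  exact: (etrans h (e2a_scal1 a)).
apply/ffunP => l; rewrite [RHS]ffunE; apply: (factor_mx_inj (s0 l)).
rewrite factor_mx1 -/(Ahat_mx g l) -mx2_1.
pose X : set 'rV[C]_#|sg_ix G0| := [set crow p | p in [set p | exists2 g, K g & sg_coord g p]]%classic.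
pose m := enum_rank (ixc sigma (l, None)).
have K1 : K 1%g by case: Kgrp.
have p1m : p1 (ixc sigma (l, None)) = 1 :> C.
  have := coord_factor00 (s0 l) (c1 l); rewrite !ffunE factor_mx1 -mx2_1 mxE => h.
  exact: (etrans h (e2a_1 (@weilC R))).
have XE x : X x -> x ord0 m = 1 \/ x ord0 m = -1.
  move=> [q [h Kh cq] <-]; have [a aa [_ qa]] := pE h q l Kh cq.
  rewrite crowE qa; have /eqP : (a - 1) * (a + 1) = 0.
    have -> : (a - 1) * (a + 1) = a * a - 1 by ring.
    by rewrite aa subrr.
  by rewrite mulf_eq0 subr_eq0 addr_eq0 => /orP[/eqP|/eqP]; [left|right].
have n1 : (1 : C) <> -1.
  by move/eqP; rewrite -subr_eq0 opprK -[1 + 1]/(2%:R) pnatr_eq0.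
(* This part of X contains the coordinates of 1, is closed, and is open as the complement in X of
   the part where the entry is -1. *)
have XT : (X `&` [set x | x ord0 m = 1])%classic = X.
  apply: Kconn.
  - by exists (crow p1); split; [exists p1 => //; exists 1%g | rewrite /= crowE].
  - exists (~` [set x : 'rV[C]_#|sg_ix G0| | x ord0 m = -1])%classic.
      by apply: closed_openC; exact: closed_coord.
    apply/seteqP; split=> x [Xx /= xm]; split=> //=.
      by rewrite xm.
    by case: (XE x Xx).
  - by exists [set x : 'rV[C]_#|sg_ix G0| | x ord0 m = 1]%classic; first exact: closed_coord.
have : X (crow p) by exists p => //; exists g.
rewrite -XT => -[_ /=]; rewrite crowE.
have [a _ [-> ->]] := pE g p l Kg cp.
by move=> ->; rewrite scale1r.
Qed.

End DiscreteNormal.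

(** The dichotomy is whether k contains a nonzero odd vector: if so S is everything, if not k_0 = 0
    as well and S is trivial. *)
Lemma Ghat_simple (R : realType) (sigma : 'I_3 -> CC R) : \sum_i sigma i = 0 ->
  (forall i, sigma i != 0) -> simple_supergroup (Ghat_pair sigma).
Proof.
move=> sigmaV sigmaX K k S [[Kgrp Kclosed] Ksub ksub kAd SE] Kconn Snormal.
have [[Y [kY Y0]]|kodd] := pselect (exists Y, od_incl (P := Ghat_pair sigma) Y \in k /\ Y != 0).
  right; have kAd' := k_Ad_odd sigmaV Kgrp ksub kAd SE Snormal.
  have kod Y' := k_odd_full sigmaV sigmaX kAd' Y' kY Y0.
  have kT := k_full_of_odd sigmaV sigmaX ksub kod.
  exact: (S_full SE kT (K_full sigmaX Kgrp Ksub kT)).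
left; have k1 Y : od_incl (P := Ghat_pair sigma) Y \in k -> Y = 0.
  by move=> kY; apply: contra_notP kodd => /eqP Y0; exists Y.
have k0 Z : ev_incl (P := Ghat_pair sigma) Z \in k -> Z = 0.
  move=> kZ; apply: (adZ_faithful sigmaV sigmaX) => Y; apply: k1.
  exact: (k_bracket_odd sigmaV Kgrp ksub kAd SE Snormal Y kZ).
exact: (S_trivial SE k0 k1 (K_trivial sigmaV sigmaX Kgrp SE Snormal k0 k1 Kconn)).
Qed.

Theorem theorem5p4 (R : realType) (sigma : 'I_3 -> CC R)
    (sigmaV : \sum_i sigma i = 0) :
  [/\ (forall i, sigma i != 0) -> simple_supergroup (Ghat_pair sigma),
      (forall i j k : 'I_3, i != j -> i != k -> j != k ->
        sigma i = 0 -> sigma j != 0 -> sigma k != 0 ->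
        let rd := gp_rd (Ghat_pair sigma) in
        let G1 := gp_1 (Ghat_pair sigma) in
        let Q := sg_prod (sg_prod T3 SL2) SL2 in
        let M := outer (outer (dsum (triv_rep T3) (triv_rep T3)) box) box in
        [/\ [/\ closed_lie_subsg (P := Ghat_pair sigma) (Ahat_sub sigma i),
                central (Ahat_sub sigma i),
                isomorphic (sg_sub (Ahat_sub sigma i)) (Ahat sigma i)
              & [/\ isomorphic (Ahat sigma i) T3,
                    isomorphic (Ahat sigma j) SL2
                  & isomorphic (Ahat sigma k) SL2]],
            semidirect rd G1,
            [/\ exists2 f : lie_hom (Ghat sigma) (sg_sub rd), lie_isom f &
                  forall A g, val (f A g) = gp_grp (P := Ghat_pair sigma) g
              & isomorphic (sg_sub rd) Q],
            [/\ closed_lie_subsg (P := Ghat_pair sigma) G1,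
                normal G1,
                abelian_sg (sg_sub G1)
              & isomorphic (sg_sub G1) (odd_affine 'I_8)]
          & exists (ai : lie_hom (Ahat sigma i) T3)
              (aj : lie_hom (Ahat sigma j) SL2)
              (ak : lie_hom (Ahat sigma k) SL2)
              (phi : lie_hom (odd_module M) (sg_sub G1)),
            [/\ [/\ lie_isom ai, lie_isom aj & lie_isom ak],
                lie_isom phi,
                (* phi is an isomorphism of modules *)
                forall A (g : big_pt (Ahat sigma) A) (v : odd_module M A),
                  val (phi A (rep_act (M := M) (ai A (g i), aj A (g j), ak A (g k)) v)) =
                  (gp_grp (P := Ghat_pair sigma) g * val (phi A v) *
                   (gp_grp (P := Ghat_pair sigma) g)^-1)%g
              & (* the split short exact sequence *)
                exists (iota : lie_hom (odd_module M) (GGhat sigma))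
                  (p : lie_hom (GGhat sigma) Q),
                [/\ forall A v, iota A v = val (phi A v),
                    forall A (g : big_pt (Ahat sigma) A),
                      p A (gp_grp (P := Ghat_pair sigma) g) =
                      (ai A (g i), aj A (g j), ak A (g k))
                  & split_exact iota p]]])
    & (forall i, sigma i = 0) ->
      let D := dsum (triv_rep (@T3 R)) (triv_rep T3) in
      abelian_sg (GGhat sigma) /\
      isomorphic (GGhat sigma)
        (sg_prod (sg_prod (sg_prod T3 T3) T3)
                 (odd_module (outer (outer D D) D)))].

Proof.
split; first exact: Ghat_simple.
  exact: Ghat_split_at_zero.
by move=> s0; split; [exact: Ghat0_abelian | exact: Ghat0_isom].
Qed.
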